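(* Let $\phi$ be an automorphism of $\mathbb{D}$ such that $\phi(0)\neq 0$ and let $\theta$ be an arbitrary inner function. Then the following statements are equivalent: (1) $(z\theta H^2)^\perp\in Lat(C_\phi)$. (2) $\theta H^2\in Lat(C_{\phi^{-1}})$. (3) $(\theta\circ\phi^{[n]})H^2\in Lat(C_{\phi^{-1}})$ for some $n\in\mathbb{Z}$. (4) $(\theta\circ\phi^{[n]})H^2\in Lat(C_{\phi^{-1}})$ for all $n\in\mathbb{Z}$. (5) $(z(\theta\circ\phi^{[n]})H^2)^\perp\in Lat(C_\phi)$ for some $n\in\mathbb{Z}$. (6) $(z(\theta\circ\phi^{[n]})H^2)^\perp\in Lat(C_\phi)$ for all $n\in\mathbb{Z}$.
   Context: $\mathbb{D}$ is the open unit disk and $H^2$ the Hardy-Hilbert space on $\mathbb{D}$; $\perp$ denotes orthogonal complement in $H^2$. An automorphism of $\mathbb{D}$ is a biholomorphic self-map. An inner function is a bounded holomorphic function on $\mathbb{D}$ with radial limits of modulus $1$ a.e. on the unit circle. $C_\psi f=f\circ\psi$ is the composition operator on $H^2$. For $n\in\mathbb{Z}$, $\phi^{[n]}$ is the $n$-th iterate of $\phi$ (iterates of $\phi^{-1}$ for negative $n$). For a bounded operator $T$ on $H^2$, $M\in Lat(T)$ means that $M$ is a closed subspace with $TM\subseteq M$. In $z\theta H^2$, $z$ denotes the coordinate function. *)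

(* Defs.v *)
From HB Require Import structures.
From mathcomp Require Import all_boot all_order all_algebra.
From mathcomp Require Import all_classical all_reals all_analysis.
From mathcomp Require Import complex.
Set Implicit Arguments.
Unset Strict Implicit.
Unset Printing Implicit Defensive.
Import Order.TTheory GRing.Theory Num.Theory.
Import numFieldNormedType.Exports.
Local Open Scope classical_set_scope.
Local Open Scope ring_scope.
Local Open Scope complex_scope.

(* R[i] itself carries an R-module structure; the alias carries the structure
   of a normed module over itself, so that [derivable] on it means complex
   differentiability. *)
Definition C (R : realType) : Type := R[i].
HB.instance Definition _ (R : realType) := Num.ClosedField.copy (C R) R[i].
HB.instance Definition _ (R : realType) := GRing.ComAlgebra.copy (C R) (C R)^o.
HB.instance Definition _ (R : realType) := Vector.copy (C R) (C R)^o.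
HB.instance Definition _ (R : realType) := NormedModule.copy (C R) (C R)^o.
HB.instance Definition _ (R : realType) := Num.ClosedField.on (C R).

Definition disk (R : realType) : Type := {z : C R | `|z| < 1}.

Definition disk0 (R : realType) : disk R :=
  exist (fun z : C R => `|z| < 1) 0
    (eq_ind_r (fun x : C R => is_true (x < 1)) ltr01 (normr0 (C R))).

Definition zcoord (R : realType) (z : disk R) : C R := val z.

(* Extension by zero.  Since the disk is open, neither differentiability at a
   point of the disk nor radial limits depend on the values outside. *)
Definition ext0 (R : realType) (f : disk R -> C R) (z : C R) : C R :=
  oapp f 0 (insub z).

Definition holomorphic (R : realType) (f : disk R -> C R) : Prop :=
  forall z : disk R, derivable (ext0 f) (zcoord z) (1 : C R).

Record disk_aut (R : realType) := DiskAut {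
  aut_fun :> disk R -> disk R;
  aut_inv : disk R -> disk R;
  aut_funK : cancel aut_fun aut_inv;
  aut_invK : cancel aut_inv aut_fun;
  aut_fun_hol : holomorphic (fun z => zcoord (aut_fun z));
  aut_inv_hol : holomorphic (fun z => zcoord (aut_inv z)) }.

Definition aut_iter (R : realType) (phi : disk_aut R) (n : int) :
    disk R -> disk R :=
  match n with
  | Posz k => iter k phi
  | Negz k => iter k.+1 (aut_inv phi)
  end.

Definition inner_function (R : realType) (theta : disk R -> C R) : Prop :=
  [/\ holomorphic theta,
      exists M : C R, forall z, `|theta z| <= M
    & {ae (@lebesgue_measure R), forall t : R, t \in `[0, 2 * pi] ->
        exists2 l : C R,
          (fun r : R => ext0 theta ((r%:C : C R) * (cos t +i* sin t))) @ 1^'- --> l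
        & `|l| = 1}].

Definition taylor_expansion (R : realType) (f : disk R -> C R)
    (a : nat -> C R) : Prop :=
  forall z : disk R, series (fun n => a n * zcoord z ^+ n) @ \oo --> f z.

Definition H2 (R : realType) : set (disk R -> C R) :=
  [set f | exists2 a : nat -> C R, taylor_expansion f a &
    cvgn (series (fun n => `|a n| ^+ 2))].
Arguments H2 R : clear implicits.

(* The Taylor expansion is unique, so [xget] selects the coefficients of f;
   the default value is used only for functions without an expansion. *)
Definition taylor_coef (R : realType) (f : disk R -> C R) : nat -> C R :=
  xget (fun=> 0) [set a | taylor_expansion f a].

Definition H2dot (R : realType) (f g : disk R -> C R) : C R :=
  limn (series (fun n => taylor_coef f n * (taylor_coef g n)^*)).

Definition H2norm (R : realType) (f : disk R -> C R) : C R :=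
  sqrtC (H2dot f f).

Definition H2perp (R : realType) (M : set (disk R -> C R)) :
    set (disk R -> C R) :=
  [set f | H2 R f /\ forall g, M g -> H2dot f g = 0].

Definition H2_closed_subspace (R : realType) (M : set (disk R -> C R)) :
    Prop :=
  [/\ M `<=` H2 R,
      M (fun=> 0),
      forall (c : C R) f g, M f -> M g -> M (fun z => c * f z + g z)
    & forall f, H2 R f ->
        (forall e : C R, 0 < e ->
           exists2 g, M g & H2norm (fun z => f z - g z) < e) -> M f].

Definition Lat (R : realType)
    (T : (disk R -> C R) -> (disk R -> C R)) : set (set (disk R -> C R)) :=
  [set M | H2_closed_subspace M /\ T @` M `<=` M].

Definition composition_op (R : realType) (psi : disk R -> disk R)
    (f : disk R -> C R) : disk R -> C R := f \o psi.

Definition mulH2 (R : realType) (h : disk R -> C R) : set (disk R -> C R) :=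
  [set h \* f | f in H2 R].

(* Main.v *)
Require Import Defs.
From mathcomp Require Import all_boot all_order all_algebra.
From mathcomp Require Import all_classical all_reals all_analysis.
From mathcomp Require Import complex.
From mathcomp Require Import ring lra.
Set Implicit Arguments.
Unset Strict Implicit.
Unset Printing Implicit Defensive.
Import Order.TTheory GRing.Theory Num.Theory.
Import numFieldNormedType.Exports.
Local Open Scope classical_set_scope.
Local Open Scope ring_scope.
Local Open Scope complex_scope.

(* The automorphism is [phi z = k (a - z) / (1 - conj a * z)] with [|k| = 1]:
   compose with the Mobius map that sends 0 to [phi^-1 0] and compare the
   derivatives at 0 of the resulting self-map and its inverse.  The weighted
   composition [f |-> s (1 - conj a * z)^-1 (f \o mob a)] is unitary, because it
   sends the monomials to an orthonormal family and is an involution.  Hence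
   [C_phi] is bounded and its adjoint maps [z h] to
   [k z (1 - c z)^-2 (h \o phi^-1)].  As [(1 - c z)^2] is invertible on [H^2] and
   commutes with multiplication by [theta], invariance of the orthogonal
   complement of [z theta H^2] under [C_phi] is, by taking orthogonal
   complements twice, invariance of [theta H^2] under [C_{phi^-1}].  The iterates
   enter through [(theta \o phi) H^2 = C_phi (theta H^2)] and the fact that
   [C_phi] commutes with [C_{phi^-1}].

   [theta H^2] is closed since [|theta f| = |f|]: on polynomials this is
   Parseval's identity on circles of radius [r] followed by dominated
   convergence as [r] tends to 1.  Parseval's identity requires the Taylor
   expansion of a holomorphic function, obtained from Goursat's theorem on
   rectangles applied to [f (exp w) exp (- n w)]. *)

(** * Complex modulus, limits and integrals *)

(** The factor [z] in the subspace is what makes the adjoint explicit. Composition with the Mobius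
    map is a unitary operator followed by multiplication by [1 - conj a * z]. The adjoint of this
    multiplication is the identity minus [a] times the backward shift, in general no multiplication;
    on [z h], however, the backward shift cancels [z] and the result is [(z - a) h]. The square of
    [1 - c z] then has two sources: the weight of the unitary operator, and the denominator of the
    Mobius map minus [a].

    Norms can be computed only on polynomials: for multiplication by [theta] through circle means,
    for the weighted composition through an orthonormal family. Both estimates pass to [H2] by
    density, and without loss in the constant, since an equality of norms has to survive. Closedness
    of [theta H2], of its shift and of its images under [C_phi] then comes from a single fact: an
    operator bounded above and below maps closed subspaces to closed subspaces. Hilbert space
    arguments are carried out on coefficient sequences, with squared norms. *)

Section Modulus.
Context {R : realType}.
Implicit Types (z w : C R) (x y : R).

(** The norm of [C R] takes its values in [C R], whose order is partial; the real-valued copy keeps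
    all estimates in the ordered field [R]. *)
Definition cabs z : R := complex.Re `|z|.

Definition cofr x : C R := x%:C.

Lemma cofrD x y : cofr (x + y) = cofr x + cofr y.
Proof. exact: (rmorphD (real_complex R)). Qed.

Lemma cofrB x y : cofr (x - y) = cofr x - cofr y.
Proof. exact: (rmorphB (real_complex R)). Qed.

Lemma cofrM x y : cofr (x * y) = cofr x * cofr y.
Proof. exact: (rmorphM (real_complex R)). Qed.

Lemma cofrX x n : cofr (x ^+ n) = cofr x ^+ n.
Proof. exact: (rmorphXn (real_complex R)). Qed.

Lemma cofr_sum I (r : seq I) (P : pred I) (F : I -> R) :
  cofr (\sum_(i <- r | P i) F i) = \sum_(i <- r | P i) cofr (F i).
Proof. exact: (rmorph_sum (real_complex R)). Qed.

Lemma cofr_inj : injective cofr.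
Proof. by move=> x y []. Qed.

Lemma cabsE z : `|z| = cofr (cabs z).
Proof. by rewrite /cabs /cofr normc_def. Qed.

Lemma cabs_def z :
  cabs z = Num.sqrt (complex.Re z ^+ 2 + complex.Im z ^+ 2).
Proof. by rewrite /cabs normc_def. Qed.

Lemma cabs_ge0 z : 0 <= cabs z.
Proof. by rewrite cabs_def sqrtr_ge0. Qed.

Lemma cabs0 : cabs 0 = 0.
Proof. by apply: cofr_inj; rewrite -cabsE normr0. Qed.

Lemma cabs1 : cabs 1 = 1.
Proof. by apply: cofr_inj; rewrite -cabsE normr1. Qed.

Lemma cabs0_eq0 z : cabs z = 0 -> z = 0.
Proof. by move=> z0; apply/eqP; rewrite -normr_eq0 cabsE z0. Qed.

Lemma cabs_gt0 z : (0 < cabs z) = (z != 0).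
Proof.
rewrite lt_def cabs_ge0 andbT; congr (~~ _); apply/eqP/eqP.
  exact: cabs0_eq0.
by move=> ->; rewrite cabs0.
Qed.

Lemma cabsM z w : cabs (z * w) = cabs z * cabs w.
Proof. by apply: cofr_inj; rewrite cofrM -!cabsE normrM. Qed.

Lemma cabsX z n : cabs (z ^+ n) = cabs z ^+ n.
Proof. by apply: cofr_inj; rewrite cofrX -!cabsE normrX. Qed.

Lemma cabsN z : cabs (- z) = cabs z.
Proof. by apply: cofr_inj; rewrite -!cabsE normrN. Qed.

Lemma cabsV z : cabs z^-1 = (cabs z)^-1.
Proof.
have [->|z0] := eqVneq z 0; first by rewrite invr0 cabs0 invr0.
have z1 : cabs z != 0 by rewrite gt_eqF // cabs_gt0.
apply: (mulfI z1).
by rewrite -cabsM !divff // cabs1.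
Qed.

Lemma cabsB z w : cabs (z - w) = cabs (w - z).
Proof. by rewrite -cabsN opprB. Qed.

Lemma cofr_le x y : (cofr x <= cofr y) = (x <= y).
Proof. exact: lecR. Qed.

Lemma cofr_lt x y : (cofr x < cofr y) = (x < y).
Proof. exact: ltcR. Qed.

Lemma cabsD z w : cabs (z + w) <= cabs z + cabs w.
Proof. by rewrite -cofr_le cofrD -!cabsE ler_normD. Qed.

Lemma cabs_sum I (r : seq I) (P : pred I) (F : I -> C R) :
  cabs (\sum_(i <- r | P i) F i) <= \sum_(i <- r | P i) cabs (F i).
Proof.
by rewrite -cofr_le cofr_sum -cabsE (le_trans (ler_norm_sum _ _ _)).
Qed.

Lemma cabs_cofr x : cabs (cofr x) = `|x|.
Proof. by rewrite cabs_def /= expr0n addr0 sqrtr_sqr. Qed.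

Lemma cabs_Re z : `|complex.Re z| <= cabs z.
Proof. by rewrite cabs_def -sqrtr_sqr ler_wsqrtr // lerDl sqr_ge0. Qed.

Lemma cabs_Im z : `|complex.Im z| <= cabs z.
Proof. by rewrite cabs_def -sqrtr_sqr ler_wsqrtr // lerDr sqr_ge0. Qed.

Lemma cabs_sqr z : cabs z ^+ 2 = complex.Re z ^+ 2 + complex.Im z ^+ 2.
Proof. by rewrite cabs_def sqr_sqrtr // addr_ge0 ?sqr_ge0. Qed.

Lemma cabs_ReIm z : cabs z <= `|complex.Re z| + `|complex.Im z|.
Proof.
rewrite -(@ler_pXn2r _ 2) ?nnegrE ?cabs_ge0 ?addr_ge0 //.
rewrite cabs_sqr sqrrD !real_normK ?num_real // addrAC lerDl.
by rewrite mulrn_wge0 // mulr_ge0.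
Qed.

Lemma eq_ReIm z w : complex.Re z = complex.Re w ->
  complex.Im z = complex.Im w -> z = w.
Proof. by case: z => ? ?; case: w => ? ? /= -> ->. Qed.

Definition cconj z : C R := z^*.

Lemma cconjD z w : cconj (z + w) = cconj z + cconj w.
Proof. exact: (rmorphD (@conjc R)). Qed.

Lemma cconjB z w : cconj (z - w) = cconj z - cconj w.
Proof. exact: (rmorphB (@conjc R)). Qed.

Lemma cconjN z : cconj (- z) = - cconj z.
Proof. exact: (rmorphN (@conjc R)). Qed.

Lemma cconjM z w : cconj (z * w) = cconj z * cconj w.
Proof. exact: (rmorphM (@conjc R)). Qed.

Lemma cconjX z n : cconj (z ^+ n) = cconj z ^+ n.
Proof. exact: (rmorphXn (@conjc R)). Qed.

Lemma cconj_sum I (r : seq I) (P : pred I) (F : I -> C R) :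
  cconj (\sum_(i <- r | P i) F i) = \sum_(i <- r | P i) cconj (F i).
Proof. exact: (rmorph_sum (@conjc R)). Qed.

Lemma cconj0 : cconj 0 = 0.
Proof. exact: conjc0. Qed.

Lemma cconj1 : cconj 1 = 1.
Proof. exact: conjc1. Qed.

Lemma cconjK z : cconj (cconj z) = z.
Proof. exact: conjcK. Qed.

Lemma mul_cconj z : z * cconj z = cofr (cabs z ^+ 2).
Proof. by case: z => a b; apply: eq_ReIm; rewrite ?cabs_sqr /=; ring. Qed.

Lemma cabs_conj z : cabs (cconj z) = cabs z.
Proof. by case: z => a b; rewrite !cabs_def /= sqrrN. Qed.

Lemma ReD z w : complex.Re (z + w) = complex.Re z + complex.Re w.
Proof. by case: z; case: w. Qed.

Lemma ImD z w : complex.Im (z + w) = complex.Im z + complex.Im w.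
Proof. by case: z; case: w. Qed.

Lemma ReN z : complex.Re (- z) = - complex.Re z.
Proof. by case: z. Qed.

Lemma ImN z : complex.Im (- z) = - complex.Im z.
Proof. by case: z. Qed.

Lemma ReM z w : complex.Re (z * w) =
  complex.Re z * complex.Re w - complex.Im z * complex.Im w.
Proof. by case: z; case: w. Qed.

Lemma ImM z w : complex.Im (z * w) =
  complex.Re z * complex.Im w + complex.Im z * complex.Re w.
Proof. by case: z; case: w. Qed.

Section Limits.
Context {T : Type} {F : set_system T} {FF : Filter F}.

(** A positive element of [C R] is real, so the radii on both sides range over the same numbers. *)
Lemma ccvgP (f : T -> C R) (l : C R) :
  f @ F --> l <-> (fun t => cabs (f t - l)) @ F --> (0 : R).
Proof.
split=> [fl|fl].
  apply/cvgrPdist_lt => e e0.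
  have e0C : (0 : C R) < cofr e by rewrite (_ : 0 = cofr 0) // cofr_lt.
  move/cvgrPdist_lt: fl => /(_ _ e0C); apply: filterS => t.
  by rewrite cabsE cofr_lt sub0r normrN ger0_norm ?cabs_ge0 // cabsB.
apply/cvgrPdist_lt => e e0.
have eE : e = cofr (complex.Re e).
  by move: e0; rewrite ltcE => /andP[/eqP]; case: e => a b /= -> _.
have e0R : 0 < complex.Re e by move: e0; rewrite ltcE => /andP[].
move/cvgrPdist_lt: fl => /(_ _ e0R); apply: filterS => t.
by rewrite eE cabsE cofr_lt sub0r normrN ger0_norm ?cabs_ge0 // cabsB.
Qed.

Lemma ccvg_ReIm (f : T -> C R) (l : C R) :
  (fun t => complex.Re (f t)) @ F --> complex.Re l ->
  (fun t => complex.Im (f t)) @ F --> complex.Im l -> f @ F --> l.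
Proof.
move=> fr fi; apply/ccvgP.
have h : (fun t => `|complex.Re (f t) - complex.Re l| +
                `|complex.Im (f t) - complex.Im l|) @ F --> (0 : R).
  rewrite -[0 in X in _ --> X]addr0; apply: cvgD.
    by rewrite -(normr0 R); apply: cvg_norm; rewrite -(subrr (complex.Re l));
      apply: cvgB => //; exact: cvg_cst.
  by rewrite -(normr0 R); apply: cvg_norm; rewrite -(subrr (complex.Im l));
      apply: cvgB => //; exact: cvg_cst.
apply: (squeeze_cvgr (f := fun=> 0) _ _ h); last exact: cvg_cst.
apply: nearW => t; rewrite cabs_ge0 /=.
by rewrite (le_trans (cabs_ReIm _)) // ReD ImD ReN ImN.
Qed.

Lemma ccvg_Re (f : T -> C R) (l : C R) :
  f @ F --> l -> (fun t => complex.Re (f t)) @ F --> complex.Re l.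
Proof.
move=> /ccvgP fl; apply/cvgrPdist_lt => e e0.
move/cvgrPdist_lt: fl => /(_ _ e0); apply: filterS => t.
rewrite sub0r normrN ger0_norm ?cabs_ge0 //; apply: le_lt_trans.
by rewrite cabsB (le_trans _ (cabs_Re _)) // ReD ReN.
Qed.

Lemma ccvg_Im (f : T -> C R) (l : C R) :
  f @ F --> l -> (fun t => complex.Im (f t)) @ F --> complex.Im l.
Proof.
move=> /ccvgP fl; apply/cvgrPdist_lt => e e0.
move/cvgrPdist_lt: fl => /(_ _ e0); apply: filterS => t.
rewrite sub0r normrN ger0_norm ?cabs_ge0 //; apply: le_lt_trans.
by rewrite cabsB (le_trans _ (cabs_Im _)) // ImD ImN.
Qed.

Lemma ccvg_cst (c : C R) : (fun _ : T => c) @ F --> c.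
Proof. exact: cvg_cst. Qed.

Lemma ccvgD (f g : T -> C R) (l k : C R) : f @ F --> l -> g @ F --> k ->
  (fun t => f t + g t) @ F --> l + k.
Proof. exact: cvgD. Qed.

Lemma ccvgN (f : T -> C R) (l : C R) : f @ F --> l ->
  (fun t => - f t) @ F --> - l.
Proof. exact: cvgN. Qed.

Lemma ccvgB (f g : T -> C R) (l k : C R) : f @ F --> l -> g @ F --> k ->
  (fun t => f t - g t) @ F --> l - k.
Proof. exact: cvgB. Qed.

Lemma ccvgM (f g : T -> C R) (l k : C R) : f @ F --> l -> g @ F --> k ->
  (fun t => f t * g t) @ F --> l * k.
Proof. exact: cvgM. Qed.

Lemma ccvg_conj (f : T -> C R) (l : C R) :
  f @ F --> l -> (fun t => cconj (f t)) @ F --> cconj l.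
Proof.
move=> /ccvgP fl; apply/ccvgP.
rewrite (_ : (fun _ => _) = (fun t => cabs (f t - l))) //.
by apply/funext => t; rewrite -cconjB cabs_conj.
Qed.

Lemma ccvg_abs (f : T -> C R) (l : C R) :
  f @ F --> l -> (fun t => cabs (f t)) @ F --> cabs l.
Proof.
move=> fl; have /ccvg_Re : (fun t => `|f t|) @ F --> `|l| by exact: cvg_norm.
by [].
Qed.

Lemma ccvg_cofr (f : T -> R) (l : R) :
  f @ F --> l -> (fun t => cofr (f t)) @ F --> cofr l.
Proof. by move=> fl; apply: ccvg_ReIm => //; exact: cvg_cst. Qed.

End Limits.

End Modulus.

Section Cont.
Context {R : realType} {T : topologicalType}.
Implicit Types (f g : T -> C R) (z : T).

Lemma ccont_cst (c : C R) z : {for z, continuous (fun _ : T => c)}.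
Proof. exact: (@ccvg_cst R T (nbhs z) (nbhs_filter z)). Qed.

Lemma ccontD f g z : {for z, continuous f} -> {for z, continuous g} ->
  {for z, continuous (fun t => f t + g t)}.
Proof. exact: (@ccvgD R T (nbhs z) (nbhs_filter z)). Qed.

Lemma ccontM f g z : {for z, continuous f} -> {for z, continuous g} ->
  {for z, continuous (fun t => f t * g t)}.
Proof. exact: (@ccvgM R T (nbhs z) (nbhs_filter z)). Qed.

End Cont.
Arguments ccont_cst {R T} c z _ _.
Arguments ccvg_cst {R T F FF} c _ _.

Lemma ccont_id {R : realType} (z : C R) : {for z, continuous (fun t : C R => t)}.
Proof. by []. Qed.

(** * Integrals of real and complex functions over segments *)

Section Integral.
Context {R : realType}.
Implicit Types (a b x y : R) (f g : R -> R) (h k : R -> C R).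
Notation mu := (@lebesgue_measure R).

Definition rint a b f : R := \int[mu]_(x in `[a, b]) f x.

Definition ccont a b f := forall x, x \in `[a, b] -> {for x, continuous f}.

Lemma ccont_integrable a b f : ccont a b f ->
  mu.-integrable `[a, b] (EFin \o f).
Proof.
move=> cf; apply: continuous_compact_integrable; first exact: segment_compact.
by apply: continuous_in_subspaceT => x /set_mem; exact: cf.
Qed.

Lemma ccontZ a b c f : ccont a b f -> ccont a b (fun x => c * f x).
Proof. by move=> cf x /cf fx; apply: cvgM => //; exact: cvg_cst. Qed.

Lemma rint_lin a b c f g : ccont a b f -> ccont a b g ->
  rint a b (fun x => c * f x + g x) = c * rint a b f + rint a b g.
Proof.
move=> cf cg; rewrite /rint RintegralD //=.
- by rewrite RintegralZl //; exact: ccont_integrable.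
- by apply: ccont_integrable; exact: ccontZ.
- exact: ccont_integrable.
Qed.

Lemma rint_split a b c f : a <= b -> b <= c -> ccont a c f ->
  rint a c f = rint a b f + rint b c f.
Proof.
move=> ab bc cf; have cfi := ccont_integrable cf.
have := Rintegral_itvB cfi (x := b); rewrite !bnd_simp => /(_ ab bc).
rewrite /rint => /eqP; rewrite subr_eq addrC => /eqP ->; congr (_ + _).
apply: Rintegral_itv_obnd_cbnd.
apply: integrableS cfi => //; apply: subset_itvScc => //=.
Qed.

Lemma le_rint a b f g : ccont a b f -> ccont a b g ->
  (forall x, x \in `[a, b] -> f x <= g x) -> rint a b f <= rint a b g.
Proof.
move=> cf cg fg; apply: le_Rintegral => //; try exact: ccont_integrable.
Qed.

Lemma rint_cst a b c : a <= b -> rint a b (fun=> c) = c * (b - a).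
Proof.
move=> ab; rewrite /rint Rintegral_cst //= lebesgue_measure_itv /= lte_fin.
case: ltP => //= ba.
by rewrite (_ : b = a) ?subrr //; apply: le_anti; rewrite ab ba.
Qed.

Lemma eq_rint a b f g : (forall x, x \in `[a, b] -> f x = g x) ->
  rint a b f = rint a b g.
Proof. by move=> fg; apply: eq_Rintegral => x /set_mem; exact: fg. Qed.

Lemma rint_bound a b f B : a <= b -> ccont a b f ->
  (forall x, x \in `[a, b] -> `|f x| <= B) -> `|rint a b f| <= B * (b - a).
Proof.
move=> ab cf fB.
have cc : ccont a b (fun=> B) by move=> x _; exact: cvg_cst.
have ccN : ccont a b (fun=> - B) by move=> x _; exact: cvg_cst.
rewrite ler_norml -mulNr -!rint_cst //.
by apply/andP; split; apply: le_rint => // x /fB; rewrite ler_norml => /andP[].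
Qed.

Lemma rint_FTC a b f F : a <= b -> continuous f ->
  (forall x, is_derive x (1 : R) F (f x)) -> rint a b f = F b - F a.
Proof.
rewrite le_eqVlt => /predU1P[<- _ _|ab cf dF].
  by rewrite subrr /rint set_itv1 Rintegral_set1.
have cF x : {for x, continuous F}.
  by apply: differentiable_continuous; apply/derivable1_diffP; case: (dF x).
rewrite /rint /Rintegral (@continuous_FTC2 _ f F) //.
- by apply: continuous_subspaceT.
- split => [x _||].
  + by case: (dF x).
  + exact/cvg_at_right_filter/cF.
  + exact/cvg_at_left_filter/cF.
- by move=> x _; rewrite derive1E; case: (dF x).
Qed.

Definition cint a b h : C R :=
  rint a b (fun x => complex.Re (h x)) +i* rint a b (fun x => complex.Im (h x)).

Definition ccontc a b h := forall x, x \in `[a, b] -> {for x, continuous h}.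

Lemma ccontc_Re a b h : ccontc a b h -> ccont a b (fun x => complex.Re (h x)).
Proof. by move=> ch x /ch; exact: ccvg_Re. Qed.

Lemma ccontc_Im a b h : ccontc a b h -> ccont a b (fun x => complex.Im (h x)).
Proof. by move=> ch x /ch; exact: ccvg_Im. Qed.

Lemma rintD a b f g : ccont a b f -> ccont a b g ->
  rint a b (fun x => f x + g x) = rint a b f + rint a b g.
Proof.
move=> cf cg; have := rint_lin 1 cf cg; rewrite mul1r => <-.
by apply: eq_rint => x _; rewrite mul1r.
Qed.

Lemma rintZ a b c f : ccont a b f ->
  rint a b (fun x => c * f x) = c * rint a b f.
Proof. by move=> cf; rewrite /rint RintegralZl //; exact: ccont_integrable. Qed.

Lemma cintZ a b (c : C R) h : ccontc a b h ->
  cint a b (fun x => c * h x) = c * cint a b h.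
Proof.
move=> ch; have cr := ccontc_Re ch; have ci := ccontc_Im ch.
apply: eq_ReIm; rewrite ?ReM ?ImM /=.
  rewrite -mulNr -!rintZ // -rintD; try exact: ccontZ.
  by apply: eq_rint => x _; rewrite ReM mulNr.
rewrite -!rintZ // -rintD; try exact: ccontZ.
by apply: eq_rint => x _; rewrite ImM.
Qed.

Lemma cintD a b h k : ccontc a b h -> ccontc a b k ->
  cint a b (fun x => h x + k x) = cint a b h + cint a b k.
Proof.
move=> ch ck; apply: eq_ReIm; rewrite ?ReD ?ImD /=.
  rewrite -rintD; try exact: ccontc_Re.
  by apply: eq_rint => x _; rewrite ReD.
rewrite -rintD; try exact: ccontc_Im.
by apply: eq_rint => x _; rewrite ImD.
Qed.

Lemma eq_cint a b h k : (forall x, x \in `[a, b] -> h x = k x) ->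
  cint a b h = cint a b k.
Proof.
by move=> hk; apply: eq_ReIm; apply: eq_rint => x /hk ->.
Qed.

Lemma cint_split a b c h : a <= b -> b <= c -> ccontc a c h ->
  cint a c h = cint a b h + cint b c h.
Proof.
move=> ab bc ch; apply: eq_ReIm; rewrite ?ReD ?ImD /=; apply: rint_split => //.
  exact: ccontc_Re.
exact: ccontc_Im.
Qed.

(** Real and imaginary parts are bounded separately, whence the factor 2. It is harmless: the bound
    only serves to show that quantities are arbitrarily small. *)
Lemma cint_bound a b h B : a <= b -> ccontc a b h ->
  (forall x, x \in `[a, b] -> cabs (h x) <= B) ->
  cabs (cint a b h) <= 2 * B * (b - a).
Proof.
move=> ab ch hB; apply: (le_trans (cabs_ReIm _)) => /=.
rewrite mulr_natl mulrnAl mulr2n; apply: lerD; apply: rint_bound => //.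
- exact: ccontc_Re.
- by move=> x /hB; apply: le_trans; exact: cabs_Re.
- exact: ccontc_Im.
- by move=> x /hB; apply: le_trans; exact: cabs_Im.
Qed.

Lemma cint_cst a b (c : C R) : a <= b -> cint a b (fun=> c) = c * cofr (b - a).
Proof.
move=> ab; rewrite /cint !rint_cst //; apply: eq_ReIm; rewrite ?ReM ?ImM /=.
  by rewrite mulr0 subr0.
by rewrite mulr0 add0r.
Qed.

Lemma cint_id a b : a <= b ->
  cint a b (fun x => cofr x) = cofr ((b ^+ 2 - a ^+ 2) / 2).
Proof.
move=> ab; apply: eq_ReIm => /=; last by rewrite rint_cst // mul0r.
have -> : (b ^+ 2 - a ^+ 2) / 2 = b ^+ 2 / 2 - a ^+ 2 / 2 by rewrite mulrBl.
apply: (@rint_FTC a b id (fun x => x ^+ 2 / 2)) => //.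
  by move=> x; exact: cvg_id.
by move=> x; apply: is_derive_eq; rewrite /GRing.scale /=; field.
Qed.

End Integral.

(** * Cauchy theorem on rectangles *)

Section Goursat.
Context {R : realType}.
Implicit Types (x y a b c d : R) (F : C R -> C R) (z : C R).

Definition cpt x y : C R := x +i* y.

Lemma cptE x y : cpt x y = cofr x + cpt 0 1 * cofr y.
Proof. by apply: eq_ReIm; rewrite ?ReD ?ImD ?ReM ?ImM /=; ring. Qed.

Definition cderiv F z (D : C R) := forall e : R, 0 < e ->
  exists2 d, 0 < d & forall u : C R, cabs u < d ->
    cabs (F (z + u) - F z - D * u) <= e * cabs u.

Lemma cvg_cabs_lt F z (l : C R) :
  (forall e : R, 0 < e -> exists2 d, 0 < d &
     forall u, cabs u < d -> cabs (F (z + u) - l) < e) ->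
  F @ z --> l.
Proof.
move=> Fl; apply/(@ccvgP _ _ (nbhs z) (nbhs_filter z))/cvgrPdist_lt => e e0; have [d d0 dF] := Fl _ e0.
have d0C : (0 : C R) < cofr d by rewrite (_ : 0 = cofr 0) // cofr_lt.
apply/nbhs_normP; exists (cofr d) => //= t /=.
rewrite cabsE cofr_lt => zt.
rewrite sub0r normrN ger0_norm ?cabs_ge0 //.
have -> : t = z + (t - z) by rewrite addrC subrK.
by apply: dF; rewrite cabsB.
Qed.

Lemma cderiv_continuous F z D : cderiv F z D -> {for z, continuous F}.
Proof.
move=> FD; apply: cvg_cabs_lt => e e0.
have [d d0 dF] := FD _ ltr01.
have M0 : 0 < 1 + cabs D by rewrite ltr_pwDl // cabs_ge0.
exists (Num.min d (e / (1 + cabs D))).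
  by rewrite lt_min d0 divr_gt0.
move=> u; rewrite lt_min => /andP[ud ue].
have -> : F (z + u) - F z = (F (z + u) - F z - D * u) + D * u by rewrite subrK.
apply: (le_lt_trans (cabsD _ _)); apply: (@le_lt_trans _ _ ((1 + cabs D) * cabs u)).
  by rewrite mulrDl cabsM lerD2r dF.
by rewrite mulrC -ltr_pdivlMr.
Qed.

Lemma cvg_hor x y : (fun t : R => cpt t y) @ x --> cpt x y.
Proof. by apply: ccvg_ReIm; [exact: cvg_id|exact: cvg_cst]. Qed.

Lemma cvg_ver x y : (fun t : R => cpt x t) @ y --> cpt x y.
Proof. by apply: ccvg_ReIm; [exact: cvg_cst|exact: cvg_id]. Qed.

(** The contour integral taken counterclockwise along the boundary; [cpt 0 1] is the imaginary unit
    of [dz = i dy] on the vertical sides. *)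
Definition rect F a b c d : C R :=
  cint a b (fun x => F (cpt x c)) - cint a b (fun x => F (cpt x d)) +
  cpt 0 1 * (cint c d (fun y => F (cpt b y)) - cint c d (fun y => F (cpt a y))).

Definition rcont F a b c d := forall x y, x \in `[a, b] -> y \in `[c, d] ->
  {for cpt x y, continuous F}.

Lemma rcont_hor F a b c d y : rcont F a b c d -> y \in `[c, d] ->
  ccontc a b (fun x => F (cpt x y)).
Proof.
move=> cF yc x xa; apply: (continuous_comp (f := fun t => cpt t y)).
  exact: cvg_hor.
exact: cF.
Qed.

Lemma rcont_ver F a b c d x : rcont F a b c d -> x \in `[a, b] ->
  ccontc c d (fun y => F (cpt x y)).
Proof.
move=> cF yc y xa; apply: (continuous_comp (f := fun t => cpt x t)).
  exact: cvg_ver.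
exact: cF.
Qed.

Lemma rcontS F a b c d a' b' c' d' : a <= a' -> b' <= b -> c <= c' -> d' <= d ->
  rcont F a b c d -> rcont F a' b' c' d'.
Proof.
move=> aa bb cc dd cF x y; rewrite !in_itv /= => /andP[ax xb] /andP[cy yd].
apply: cF; rewrite in_itv /=.
  by rewrite (le_trans aa) // (le_trans xb).
by rewrite (le_trans cc) // (le_trans yd).
Qed.

(** Every interior edge is traversed twice, in opposite directions. *)
Lemma rect_split4 F a m b c n d : a <= m <= b -> c <= n <= d ->
  rcont F a b c d ->
  rect F a b c d = rect F a m c n + rect F m b c n + rect F a m n d +
                   rect F m b n d.
Proof.
move=> /andP[am mb] /andP[cn nd] cF.
have hs y : y \in `[c, d] -> cint a b (fun x => F (cpt x y)) =
    cint a m (fun x => F (cpt x y)) + cint m b (fun x => F (cpt x y)).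
  by move=> yc; apply: cint_split => //; exact: rcont_hor cF yc.
have vs x : x \in `[a, b] -> cint c d (fun y => F (cpt x y)) =
    cint c n (fun y => F (cpt x y)) + cint n d (fun y => F (cpt x y)).
  by move=> xa; apply: cint_split => //; exact: rcont_ver cF xa.
have ab := le_trans am mb; have cd := le_trans cn nd.
rewrite /rect !hs ?vs ?in_itv /= ?lexx ?ab ?cd //.
by ring.
Qed.

Lemma rectB F G a b c d : a <= b -> c <= d -> rcont F a b c d ->
  rcont G a b c d ->
  rect (fun z => F z + G z) a b c d = rect F a b c d + rect G a b c d.
Proof.
move=> ab cd cF cG; rewrite /rect.
have cc : c \in `[c, d] by rewrite in_itv /= lexx.
have dd : d \in `[c, d] by rewrite in_itv /= lexx cd.
have aa : a \in `[a, b] by rewrite in_itv /= lexx.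
have bb : b \in `[a, b] by rewrite in_itv /= lexx ab.
rewrite (cintD (rcont_hor cF cc) (rcont_hor cG cc)).
rewrite (cintD (rcont_hor cF dd) (rcont_hor cG dd)).
rewrite (cintD (rcont_ver cF aa) (rcont_ver cG aa)).
rewrite (cintD (rcont_ver cF bb) (rcont_ver cG bb)).
by ring.
Qed.

Lemma cint_affine a b (p q : C R) : a <= b ->
  cint a b (fun x => p + q * cofr x) =
  p * cofr (b - a) + q * cofr ((b ^+ 2 - a ^+ 2) / 2).
Proof.
move=> ab.
have cid : ccontc a b (fun x => cofr x).
  by move=> x _; apply: ccvg_cofr; exact: cvg_id.
have cq : ccontc a b (fun x => q * cofr x).
  by move=> x /cid cx; apply: ccvgM cx; exact: ccvg_cst.
have cp : ccontc a b (fun=> p) by move=> x _; exact: cvg_cst.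
by rewrite (cintD cp cq) (cintZ q cid) (cint_cst p ab) (cint_id ab).
Qed.

(** The case of Cauchy's theorem that can be computed by hand; in [goursat] it removes the
    first-order approximation of [F]. *)
Lemma rect_affine (p q : C R) a b c d : a <= b -> c <= d ->
  rect (fun z => p + q * z) a b c d = 0.
Proof.
move=> ab cd; rewrite /rect.
have h y : cint a b (fun x => p + q * cpt x y) =
    (p + q * cpt 0 1 * cofr y) * cofr (b - a) +
    q * cofr ((b ^+ 2 - a ^+ 2) / 2).
  rewrite -cint_affine //; apply: eq_cint => x _.
  by rewrite [cpt x y]cptE; ring.
have v x : cint c d (fun y => p + q * cpt x y) =
    (p + q * cofr x) * cofr (d - c) +
    q * cpt 0 1 * cofr ((d ^+ 2 - c ^+ 2) / 2).
  rewrite -cint_affine //; apply: eq_cint => y _.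
  by rewrite [cpt x y]cptE; ring.
by rewrite !h !v [cofr (b - a)]cofrB [cofr (d - c)]cofrB; ring.
Qed.

Lemma rect_quarter F x y w h : 0 <= w -> 0 <= h ->
  rcont F x (x + w) y (y + h) ->
  exists p : R * R, [/\ (p.1 = x \/ p.1 = x + w / 2),
    (p.2 = y \/ p.2 = y + h / 2) &
    cabs (rect F x (x + w) y (y + h)) <=
    4 * cabs (rect F p.1 (p.1 + w / 2) p.2 (p.2 + h / 2))].
Proof.
move=> w0 h0 cF; set S := cabs _.
have e (u v : R) : u + v / 2 + v / 2 = u + v by field.
have : rect F x (x + w) y (y + h) = _ :=
  @rect_split4 F x (x + w / 2) (x + w) y (y + h / 2) (y + h) _ _ cF.
rewrite !lerD2l !lerDl !ler_piMr ?divr_ge0 // ?invf_le1 ?ler1n //.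
move=> /(_ isT isT) rE.
(* If all four quarters had integrals of modulus below a fourth of [S], additivity and the triangle
   inequality would give [S < S]. *)
apply: contrapT => H.
have Q (p : R * R) : (p.1 = x \/ p.1 = x + w / 2) ->
    (p.2 = y \/ p.2 = y + h / 2) ->
    4 * cabs (rect F p.1 (p.1 + w / 2) p.2 (p.2 + h / 2)) < S.
  move=> p1 p2; rewrite ltNge; apply/negP => pS; apply: H; exists p; split => //.
have := Q (x, y) (or_introl erefl) (or_introl erefl).
have := Q (x + w / 2, y) (or_intror erefl) (or_introl erefl).
have := Q (x, y + h / 2) (or_introl erefl) (or_intror erefl).
have := Q (x + w / 2, y + h / 2) (or_intror erefl) (or_intror erefl).
rewrite /= !e => q1 q2 q3 q4.
have D4 (t1 t2 t3 t4 : C R) :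
    cabs (t1 + t2 + t3 + t4) <= cabs t1 + cabs t2 + cabs t3 + cabs t4.
  by rewrite !(le_trans (cabsD _ _)) // !lerD2r !(le_trans (cabsD _ _)) ?lerD2r ?cabsD.
move: (D4 (rect F x (x + w / 2) y (y + h / 2))
   (rect F (x + w / 2) (x + w) y (y + h / 2))
   (rect F x (x + w / 2) (y + h / 2) (y + h))
   (rect F (x + w / 2) (x + w) (y + h / 2) (y + h))); rewrite -rE -/S.
move: q1 q2 q3 q4; do 4!move: (cabs (rect _ _ _ _ _)) => ?; clear H Q rE; clearbody S; lra.
Qed.

Lemma rect_bound F a w c h B : 0 <= w -> 0 <= h ->
  rcont F a (a + w) c (c + h) ->
  (forall x y, x \in `[a, a + w] -> y \in `[c, c + h] ->
    cabs (F (cpt x y)) <= B) ->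
  cabs (rect F a (a + w) c (c + h)) <= 4 * B * (w + h).
Proof.
move=> w0 h0 cF FB.
have aw : a <= a + w by rewrite lerDl.
have ch : c <= c + h by rewrite lerDl.
have hb y : y \in `[c, c + h] ->
    cabs (cint a (a + w) (fun x => F (cpt x y))) <= 2 * B * w.
  move=> yI; have := cint_bound aw (rcont_hor cF yI) (fun x xI => FB x y xI yI).
  by rewrite [a + w - _]addrAC subrr add0r.
have vb x : x \in `[a, a + w] ->
    cabs (cint c (c + h) (fun y => F (cpt x y))) <= 2 * B * h.
  move=> xI; have := cint_bound ch (rcont_ver cF xI) (fun y yI => FB x y xI yI).
  by rewrite [c + h - _]addrAC subrr add0r.
have i1 : cabs (cpt 0 1 : C R) = 1.
  by rewrite cabs_def /= expr0n expr1n add0r sqrtr1.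
have -> : 4 * B * (w + h) = (2 * B * w + 2 * B * w) + (2 * B * h + 2 * B * h).
  by ring.
rewrite /rect; apply: (le_trans (cabsD _ _)); rewrite cabsM i1 mul1r.
have cc : c \in `[c, c + h] by rewrite in_itv /= lexx.
have dd : c + h \in `[c, c + h] by rewrite in_itv /= lexx ch.
have aa : a \in `[a, a + w] by rewrite in_itv /= lexx.
have bb : a + w \in `[a, a + w] by rewrite in_itv /= lexx aw.
apply: lerD; apply: (le_trans (cabsD _ _)); rewrite cabsN.
  by apply: lerD; [exact: hb cc|exact: hb dd].
by apply: lerD; [exact: vb bb|exact: vb aa].
Qed.

Lemma dist_itv_le (a b p W : R) : p <= a <= p + W -> p <= b <= p + W ->
  `|a - b| <= W.
Proof. by move=> *; rewrite ler_norml; apply/andP; split; lra. Qed.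

Lemma nested_intervals (u v : nat -> R) : (forall n, u n <= u n.+1) ->
  (forall n, v n.+1 <= v n) -> (forall n, u n <= v n) ->
  exists c, forall n, u n <= c <= v n.
Proof.
move=> uS vS uv.
have um : {homo u : m n / (m <= n)%N >-> m <= n} by apply/nondecreasing_seqP.
have vm : {homo v : m n / (m <= n)%N >-> m >= n} by apply/nonincreasing_seqP.
have uvm m n : u m <= v n.
  have [mn|nm] := leqP m n; first exact: le_trans (um _ _ mn) (uv _).
  exact: le_trans (uv _) (vm _ _ (ltnW nm)).
exists (sup (range u)) => n; apply/andP; split.
  apply: ub_le_sup; last by exists n.
  by exists (v 0) => _ [m _ <-].
by apply: ge_sup; [exists (u 0), 0|move=> _ [m _ <-]].
Qed.

(* Goursat's bisection argument: the defect of Cauchy's theorem on a rectangle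
   is additive, while differentiability makes it quadratically small in the
   diameter. *)
Lemma goursat F x y w h : 0 <= w -> 0 <= h ->
  (forall u v, u \in `[x, x + w] -> v \in `[y, y + h] ->
     exists D, cderiv F (cpt u v) D) ->
  rect F x (x + w) y (y + h) = 0.
Proof.
move=> w0 h0 dF.
have cF : rcont F x (x + w) y (y + h).
  by move=> u v uI vI; have [D /cderiv_continuous] := dF _ _ uI vI.
pose inside n (p : R * R) := [/\ x <= p.1, p.1 + w / 2 ^+ n <= x + w, y <= p.2
  & p.2 + h / 2 ^+ n <= y + h].
pose J n (p : R * R) :=
  cabs (rect F p.1 (p.1 + w / 2 ^+ n) p.2 (p.2 + h / 2 ^+ n)).
have e2 n (v : R) : v / 2 ^+ n / 2 = v / 2 ^+ n.+1.
  by rewrite -mulrA -invfM exprSr.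
have e3 n (v : R) : 0 <= v -> 0 <= v / 2 ^+ n.
  by move=> v0; rewrite divr_ge0 // exprn_ge0.
have step n p : inside n p -> exists q, [/\ inside n.+1 q, J n p <= 4 * J n.+1 q,
   p.1 <= q.1 /\ q.1 + w / 2 ^+ n.+1 <= p.1 + w / 2 ^+ n
   & p.2 <= q.2 /\ q.2 + h / 2 ^+ n.+1 <= p.2 + h / 2 ^+ n].
  move=> [i1 i2 i3 i4].
  have cp : rcont F p.1 (p.1 + w / 2 ^+ n) p.2 (p.2 + h / 2 ^+ n).
    exact: rcontS cF.
  have [q [q1 q2 q3]] := rect_quarter (e3 n _ w0) (e3 n _ h0) cp.
  exists q; have := e3 n.+1 _ w0; have := e3 n.+1 _ h0.
  have ew : w / 2 ^+ n = w / 2 ^+ n.+1 + w / 2 ^+ n.+1 by rewrite -e2; field.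
  have eh : h / 2 ^+ n = h / 2 ^+ n.+1 + h / 2 ^+ n.+1 by rewrite -e2; field.
  rewrite !e2 in q1 q2 q3; rewrite /J ew eh.
  move: i2 i4; rewrite ew eh; rewrite ew eh in q3.
  set W := w / 2 ^+ n.+1; set H := h / 2 ^+ n.+1 => i2 i4 W0 H0.
  have [a1 a2] : p.1 <= q.1 /\ q.1 + W <= p.1 + (W + W).
    by rewrite /W; case: q1 => ->; rewrite -/W; split; lra.
  have [b1 b2] : p.2 <= q.2 /\ q.2 + H <= p.2 + (H + H).
    by rewrite /H; case: q2 => ->; rewrite -/H; split; lra.
  clear q1 q2; split => //; split; [exact: le_trans a1|exact: le_trans i2|
    exact: le_trans b1|exact: le_trans i4].
(* The invariant [inside] is a premise, so that a successor exists for every pair and choice yields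
   a total function. *)
pose good (np : nat * (R * R)) (q : R * R) := inside np.1 np.2 ->
    [/\ inside np.1.+1 q, J np.1 np.2 <= 4 * J np.1.+1 q,
   np.2.1 <= q.1 /\ q.1 + w / 2 ^+ np.1.+1 <= np.2.1 + w / 2 ^+ np.1
   & np.2.2 <= q.2 /\ q.2 + h / 2 ^+ np.1.+1 <= np.2.2 + h / 2 ^+ np.1].
have [g gP] : {g & forall np, good np (g np)}.
  apply: (@boolp.choice _ _ good) => -[n p]; rewrite /good /=.
  have [/step [q qP]|np] := pselect (inside n p); first by exists q.
  by exists p.
pose s := fix s n := if n is m.+1 then g (m, s m) else (x, y).
have sin n : inside n (s n).
  elim: n => [|n /= IH]; first by rewrite /inside /= !expr0 !divr1 !lexx.
  by have [] := gP (n, s n) IH.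
have sJ n : J 0%N (s 0%N) <= 4 ^+ n * J n (s n).
  elim: n => [|n IH]; first by rewrite expr0 mul1r.
  apply: (le_trans IH); rewrite exprSr -mulrA ler_wpM2l ?exprn_ge0 //.
  by have [] := gP (n, s n) (sin n).
have [X Xs] : exists c, forall n, (s n).1 <= c <= (s n).1 + w / 2 ^+ n.
  apply: nested_intervals => n; last by rewrite lerDl e3.
    by have [_ _ [] ] := gP (n, s n) (sin n).
  by have [_ _ [] ] := gP (n, s n) (sin n).
have [Y Ys] : exists c, forall n, (s n).2 <= c <= (s n).2 + h / 2 ^+ n.
  apply: nested_intervals => n; last by rewrite lerDl e3.
    by have [_ _ _ [] ] := gP (n, s n) (sin n).
  by have [_ _ _ [] ] := gP (n, s n) (sin n).
have [D FD] : exists D, cderiv F (cpt X Y) D.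
  have := Xs 0%N; have := Ys 0%N; rewrite /= !expr0 !divr1 => ? ?.
  by apply: dF; rewrite in_itv.
have J0 : J 0%N (s 0%N) = cabs (rect F x (x + w) y (y + h)).
  by rewrite /J /= !expr0 !divr1.
apply: cabs0_eq0; apply: le_anti; rewrite cabs_ge0 andbT.
rewrite -J0; apply/ler_addgt0Pl => e e0; rewrite addr0.
(* The factor that remains at the end of the estimate is [4 * (w + h) ^+ 2]; adding 1 allows
   dividing by [M] even for a degenerate rectangle. *)
pose M := 4 * (w + h) ^+ 2 + 1.
have M0 : 0 < M by rewrite ltr_pwDr // mulr_ge0 // sqr_ge0.
have [d d0 dFd] := FD _ (divr_gt0 e0 M0).
have [n nd] : exists n, (w + h) / 2 ^+ n < d.
  exists (Num.bound ((w + h) / d)).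
  rewrite ltr_pdivrMr ?exprn_gt0 // mulrC -ltr_pdivrMr //.
  apply: (lt_trans (archi_boundP _)); first by rewrite divr_ge0 ?addr_ge0 ?(ltW d0).
  by rewrite -natrX ltr_nat ltn_expl.
apply: (le_trans (sJ n)).
set p := s n.
have [W WE] : {W | W = w / 2 ^+ n} by exists (w / 2 ^+ n).
have [H HE] : {H | H = h / 2 ^+ n} by exists (h / 2 ^+ n).
have W0 : 0 <= W by rewrite WE e3.
have H0 : 0 <= H by rewrite HE e3.
have cp : rcont F p.1 (p.1 + W) p.2 (p.2 + H).
  by have := sin n; rewrite /inside -/p -WE -HE => -[*]; exact: rcontS cF.
(* [A] is the tangent map at the common point of the nested rectangles. Its contour integral
   vanishes, so [F] may be replaced by the error [E]. *)
pose A z := (F (cpt X Y) - D * cpt X Y) + D * z.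
pose E z := F z + (- 1) * A z.
have cA z : {for z, continuous A}.
  by apply: ccontD; [exact: ccont_cst|apply: ccontM; [exact: ccont_cst|exact: ccont_id]].
have cE : rcont E p.1 (p.1 + W) p.2 (p.2 + H).
  move=> a b aI bI; apply: ccontD; first exact: cp.
  by apply: ccontM; [exact: ccont_cst|exact: cA].
have JE : J n p = cabs (rect E p.1 (p.1 + W) p.2 (p.2 + H)).
  have cA' : rcont A p.1 (p.1 + W) p.2 (p.2 + H) by move=> a b _ _; exact: cA.
  have W1 : p.1 <= p.1 + W by rewrite lerDl.
  have H1 : p.2 <= p.2 + H by rewrite lerDl.
  have := rectB W1 H1 cE cA'; rewrite (rect_affine _ _ W1 H1) addr0 => <-.
  have EF : (fun z => E z + A z) = F.
    by apply/funext => z; rewrite /E mulN1r subrK.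
  by rewrite EF /J -WE -HE.
have Eb a b : a \in `[p.1, p.1 + W] -> b \in `[p.2, p.2 + H] ->
    cabs (E (cpt a b)) <= e / M * (W + H).
  have := Xs n; have := Ys n; rewrite -/p -WE -HE.
  move=> /andP[Y1 Y2] /andP[X1 X2]; rewrite !in_itv /= => /andP[a1 a2] /andP[b1 b2].
  have ub : cabs (cpt a b - cpt X Y) <= W + H.
    apply: (le_trans (cabs_ReIm _)); rewrite ReD ImD ReN ImN /=.
    apply: lerD; [apply: (@dist_itv_le _ _ p.1)|apply: (@dist_itv_le _ _ p.2)];
      exact/andP.
  have -> : E (cpt a b) = F (cpt X Y + (cpt a b - cpt X Y)) - F (cpt X Y) -
       D * (cpt a b - cpt X Y).
    rewrite [cpt X Y + _]addrC subrK /E /A mulN1r.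
    by move: (F (cpt a b)) (F (cpt X Y)) (cpt a b) (cpt X Y) => ? ? ? ?; ring.
  apply: (le_trans (dFd _ _)).
    by apply: (le_lt_trans ub); rewrite WE HE -mulrDl.
  by rewrite ler_wpM2l // divr_ge0 // ltW.
have R1 := rect_bound W0 H0 cE Eb.
rewrite JE; apply: (le_trans (ler_wpM2l _ R1)); first by rewrite exprn_ge0.
(* Both sides shrink like [2 ^+ n], so a bound quadratic in them cancels the [4 ^+ n] lost in the
   bisections. *)
have -> : 4 ^+ n * (4 * (e / M * (W + H)) * (W + H)) = e * (4 * (w + h) ^+ 2) / M.
  have -> : 4 ^+ n = 2 ^+ n * 2 ^+ n :> R.
    by rewrite -exprMn; congr (_ ^+ n); ring.
  have p0 : 2 ^+ n != 0 :> R by rewrite expf_neq0.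
  have M1 : M != 0 by rewrite gt_eqF.
  rewrite WE HE; move: (2 ^+ n) p0 M M1 {M0 dFd Eb R1} => k k0 M M1.
  by field; rewrite k0 M1.
by rewrite ler_pdivrMr // ler_wpM2l ?(ltW e0) // /M lerDl.
Qed.

End Goursat.

(** * Complex differentiability *)

Section ComplexDifferentiability.
Context {R : realType}.
Implicit Types (F G : C R -> C R) (z w u : C R).

Lemma near_cabsP z (P : C R -> Prop) :
  (\forall w \near z, P w) <->
  exists2 d : R, 0 < d & forall w, cabs (w - z) < d -> P w.
Proof.
split=> [/nbhs_normP[e /= e0 eP]|[d d0 dP]].
  have eE : e = cofr (complex.Re e).
    by move: e0; rewrite ltcE => /andP[/eqP]; case: e {eP} => a b /= -> _.
  exists (complex.Re e); first by move: e0; rewrite ltcE => /andP[].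
  by move=> w wz; apply: eP; rewrite /= cabsE eE cofr_lt cabsB.
apply/nbhs_normP; exists (cofr d).
  by rewrite /= (_ : 0 = cofr 0) // cofr_lt.
by move=> w /=; rewrite cabsE cofr_lt cabsB; exact: dP.
Qed.

Lemma near_call z (P : C R -> Prop) : (forall w, P w) -> \forall w \near z, P w.
Proof. by move=> Pw; apply/near_cabsP; exists 1. Qed.

Lemma near_cS2 z (P Q S : C R -> Prop) : (\forall w \near z, P w) ->
  (\forall w \near z, Q w) -> (forall w, P w -> Q w -> S w) ->
  \forall w \near z, S w.
Proof.
move=> /near_cabsP[d d0 dP] /near_cabsP[e e0 eQ] PQS; apply/near_cabsP.
exists (Num.min d e); first by rewrite lt_min d0.
by move=> w; rewrite lt_min => /andP[/dP ? /eQ ?]; exact: PQS.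
Qed.

Lemma cvg_cabs_ltP F z (l : C R) :
  F @ z --> l <->
  (forall e : R, 0 < e -> exists2 d, 0 < d &
     forall w, cabs (w - z) < d -> cabs (F w - l) < e).
Proof.
split=> [|Fl].
  move/(@ccvgP _ _ (nbhs z) (nbhs_filter z)) => /cvgrPdist_lt Fl e e0.
  have /near_cabsP[d d0 dP] := Fl _ e0; exists d => // w /dP.
  by rewrite sub0r normrN ger0_norm ?cabs_ge0.
apply: cvg_cabs_lt => e /Fl[d d0 dP]; exists d => // u ud.
by apply: dP; rewrite [z + u]addrC addrK.
Qed.

Definition dslope F z (D : C R) w :=
  if w == z then D else (F w - F z) / (w - z).

Lemma dslopeE F z D w : F w - F z = dslope F z D w * (w - z).
Proof.
rewrite /dslope; case: eqVneq => [->|wz]; first by rewrite !subrr mulr0.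
by rewrite divfK // subr_eq0.
Qed.

(* Caratheodory's form of complex differentiability. *)
Definition cdif F z := exists2 q : C R -> C R, {for z, continuous q} &
  \forall w \near z, F w - F z = q w * (w - z).

Lemma cderiv_dslope F z D : cderiv F z D -> {for z, continuous (dslope F z D)}.
Proof.
move=> FD; apply/cvg_cabs_ltP => e e0.
have [d d0 dF] := FD _ (divr_gt0 e0 (ltr0Sn R 1)); exists d => // w wd.
rewrite /dslope eqxx; case: eqVneq => [_|wz].
  by rewrite subrr cabs0.
have wz0 : 0 < cabs (w - z) by rewrite cabs_gt0 subr_eq0.
have -> : (F w - F z) / (w - z) - D =
    (F (z + (w - z)) - F z - D * (w - z)) / (w - z).
  rewrite [z + _]addrC subrK [RHS]mulrBl -mulrA divff ?mulr1 //.
  by rewrite subr_eq0.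
rewrite cabsM cabsV ltr_pdivrMr //; apply: (le_lt_trans (dF _ wd)).
by rewrite ltr_pM2r // gtr_pMr // invf_lt1 ?ltr1n.
Qed.

Lemma cderiv_cdif F z D : cderiv F z D -> cdif F z.
Proof.
move=> /cderiv_dslope cq; exists (dslope F z D) => //.
by apply: near_call => w; exact: dslopeE.
Qed.

Lemma cdif_cderiv F z : cdif F z -> exists D, cderiv F z D.
Proof.
move=> [q /cvg_cabs_ltP qc /near_cabsP[d d0 dF]]; exists (q z) => e e0.
have [d' d'0 d'q] := qc _ e0.
exists (Num.min d d') => [|u]; first by rewrite lt_min d0.
rewrite lt_min => /andP[ud ud'].
have zu : z + u - z = u by rewrite addrC addKr.
rewrite dF ?zu // -mulrBl cabsM ler_wpM2r ?cabs_ge0 // ltW // d'q //.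
by rewrite zu.
Qed.

Lemma cdif_cst (c : C R) z : cdif (fun=> c) z.
Proof.
exists (fun=> 0); first exact: ccont_cst.
by apply: near_call => w; rewrite subrr mul0r.
Qed.

Lemma cdif_id z : cdif (fun w => w) z.
Proof.
exists (fun=> 1); first exact: ccont_cst.
by apply: near_call => w; rewrite mul1r.
Qed.

Lemma cdif_continuous F z : cdif F z -> {for z, continuous F}.
Proof. by move=> /cdif_cderiv[D]; exact: cderiv_continuous. Qed.

Lemma cdifD F G z : cdif F z -> cdif G z -> cdif (fun w => F w + G w) z.
Proof.
move=> [p cp pF] [q cq qG]; exists (fun w => p w + q w); first exact: (ccontD cp cq).
apply: (near_cS2 pF qG) => w; rewrite mulrDl => <- <-.
by rewrite opprD addrACA.
Qed.

Lemma cdifM F G z : cdif F z -> cdif G z -> cdif (fun w => F w * G w) z.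
Proof.
move=> dF dG; have [p cp pF] := dF; have [q cq qG] := dG.
exists (fun w => p w * G w + F z * q w).
  exact: (ccontD (ccontM cp (cdif_continuous dG)) (ccontM (ccont_cst _ _) cq)).
apply: (near_cS2 pF qG) => w e1 e2.
rewrite mulrDl -mulrA (mulrC (G w)) mulrA -e1 -mulrA -e2.
by rewrite mulrBl mulrBr addrA subrK.
Qed.

Lemma cdifX F z n : cdif F z -> cdif (fun w => F w ^+ n) z.
Proof.
move=> dF; elim: n => [|n IH]; first by under eq_fun do rewrite expr0; exact: cdif_cst.
by under eq_fun do rewrite exprS; exact: cdifM.
Qed.

Lemma cdif_near F G z : (\forall w \near z, F w = G w) -> cdif F z -> cdif G z.
Proof.
move=> FG [q cq qF]; exists q => //.
have FGz : F z = G z by exact: (nbhs_singleton FG).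
by apply: (near_cS2 FG qF) => w <- <-; rewrite FGz.
Qed.

(** In Caratheodory's form the slope functions multiply, which avoids dividing by an increment of
    [F] that may vanish. *)
Lemma cdif_comp F G z : cdif F z -> cdif G (F z) -> cdif (fun w => G (F w)) z.
Proof.
move=> dF [q cq qG]; have [p cp pF] := dF; have cF := cdif_continuous dF.
exists (fun w => q (F w) * p w).
  exact: (ccontM (continuous_comp cF cq) cp).
have qGF := cF _ qG.
by apply: (near_cS2 pF qGF) => w /= e1 ->; rewrite -mulrA -e1.
Qed.

Lemma ccontV (T : topologicalType) (f : T -> C R) (t : T) : f t != 0 ->
  {for t, continuous f} -> {for t, continuous (fun s => (f s)^-1)}.
Proof. by move=> ft0 cf; exact: (@cvgV _ _ (nbhs t) (nbhs_filter t)). Qed.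

Lemma near_neq0 F z : {for z, continuous F} -> F z != 0 ->
  \forall w \near z, F w != 0.
Proof.
move=> /cvg_cabs_ltP cF Fz; apply/near_cabsP.
have [d d0 dP] := cF (cabs (F z)) (ltac:(by rewrite cabs_gt0)).
exists d => // w /dP; apply: contraTN => /eqP ->.
by rewrite sub0r cabsN ltxx.
Qed.

Lemma cdifV F z : F z != 0 -> cdif F z -> cdif (fun w => (F w)^-1) z.
Proof.
move=> Fz dF; have [q cq qF] := dF; have cF := cdif_continuous dF.
exists (fun w => - q w * ((F z)^-1 * (F w)^-1)).
  have cN := @ccvgN _ _ (nbhs z) (nbhs_filter z) _ _ cq.
  exact: (ccontM cN (ccontM (ccont_cst _ _) (ccontV Fz cF))).
have Fw := near_neq0 cF Fz.
apply: (near_cS2 Fw qF) => w w0 e; rewrite mulrAC mulNr -e.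
by field; rewrite w0 Fz.
Qed.

Lemma derivable_cdif F z : derivable F z (1 : C R) -> cdif F z.
Proof.
move=> /cvg_ex[D FD]; apply: (@cderiv_cdif _ _ D) => e e0.
have /cvgrPdist_lt/(_ (cofr e)) := FD.
have e0C : (0 : C R) < cofr e by rewrite (_ : 0 = cofr 0) // cofr_lt.
move=> /(_ e0C); rewrite near_withinE => /near_cabsP[d d0 dF].
exists d => // u ud; have [->|u0] := eqVneq u 0.
  by rewrite mulr0 subr0 addr0 subrr cabs0 mulr0.
have u1 : 0 < cabs u by rewrite cabs_gt0.
have := dF u; rewrite subr0 => /(_ ud u0); rewrite cabsE cofr_lt => h.
rewrite -ler_pdivrMr // -cabsV -cabsM; apply: ltW; move: h.
rewrite cabsB; congr (cabs _ < e) => /=.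
rewrite -[_ *: 1]/(u * 1) mulr1 -[u^-1 *: _]/(u^-1 * _).
by rewrite (addrC u z) mulrBl mulfK // mulrC.
Qed.

Lemma cdif_derivable F z : cdif F z -> derivable F z (1 : C R).
Proof.
move=> /cdif_cderiv[D FD]; apply/cvg_ex; exists D; apply/cvgrPdist_lt => e e0.
have eE : e = cofr (complex.Re e).
  by move: e0; rewrite ltcE => /andP[/eqP]; case: e => a b /= -> _.
have e0R : 0 < complex.Re e by move: e0; rewrite ltcE => /andP[].
rewrite near_withinE; apply/near_cabsP.
have [d d0 dF] := FD _ (divr_gt0 e0R (ltr0Sn R 1)); exists d => // u.
rewrite subr0 => ud u0; have u1 : 0 < cabs u by rewrite cabs_gt0.
rewrite eE cabsE cofr_lt cabsB /=.
rewrite -[_ *: 1]/(u * 1) mulr1 -[u^-1 *: _]/(u^-1 * _) (addrC u z).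
have -> : u^-1 * (F (z + u) - F z) - D = (F (z + u) - F z - D * u) / u.
  by rewrite [RHS]mulrBl mulfK // mulrC.
rewrite cabsM cabsV ltr_pdivrMr //; apply: (le_lt_trans (dF _ ud)).
by rewrite ltr_pM2r // gtr_pMr // invf_lt1 ?ltr1n.
Qed.

End ComplexDifferentiability.

(** * Fourier coefficients and Taylor expansions *)

Section Fourier.
Context {R : realType}.
Implicit Types (t x y : R) (h g : R -> C R) (k m j : int) (c : C R).

Definition cis t : C R := cos t +i* sin t.

Lemma cisD x y : cis (x + y) = cis x * cis y.
Proof. by apply: eq_ReIm; rewrite ?ReM ?ImM /= ?cosD ?sinD // addrC. Qed.

Lemma cis0 : cis 0 = 1.
Proof. by rewrite /cis cos0 sin0. Qed.

Lemma cabs_cis t : cabs (cis t) = 1.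
Proof. by rewrite cabs_def /= cos2Dsin2 sqrtr1. Qed.

Lemma cis_conj t : cconj (cis t) = cis (- t).
Proof. by rewrite /cis cosN sinN. Qed.

Lemma cisN t : cis (- t) * cis t = 1.
Proof. by rewrite -cisD addNr cis0. Qed.

Lemma cisMn n x : cis (n%:R * x) = cis x ^+ n.
Proof.
elim: n => [|n IH]; first by rewrite mul0r cis0 expr0.
by rewrite -natr1 mulrDl mul1r cisD IH exprSr.
Qed.

Lemma cis_2pi : cis (2 * pi) = 1.
Proof. by rewrite mulr_natl /cis cos2pi sin2pi. Qed.

Lemma cis_int k : cis (k%:~R * (2 * pi)) = 1.
Proof.
case: k => n; first by rewrite -pmulrn cisMn cis_2pi expr1n.
have := cisN (n.+1%:R * (2 * pi)).
by rewrite cisMn cis_2pi expr1n mulr1 NegzE mulrNz mulNr -pmulrn.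
Qed.

Lemma cont_cis (a : R) t : {for t, continuous (fun t => cis (a * t))}.
Proof.
have ca : (fun t : R => a * t) @ t --> a * t.
  by apply: cvgM; [exact: cvg_cst|exact: cvg_id].
apply: ccvg_ReIm => /=.
  by apply: (continuous_comp (f := fun t => a * t)) => //; exact: continuous_cos.
by apply: (continuous_comp (f := fun t => a * t)) => //; exact: continuous_sin.
Qed.

Lemma continuous_cis t : {for t, continuous cis}.
Proof.
by apply: ccvg_ReIm => /=; [exact: continuous_cos|exact: continuous_sin].
Qed.

Definition gcont h := forall t, {for t, continuous h}.

Lemma gcontc h a b : gcont h -> ccontc a b h.
Proof. by move=> ch t _; exact: ch. Qed.

Lemma gcontD h g : gcont h -> gcont g -> gcont (fun t => h t + g t).
Proof. by move=> ch cg t; exact: (ccontD (ch t) (cg t)). Qed.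

Lemma gcontM h g : gcont h -> gcont g -> gcont (fun t => h t * g t).
Proof. by move=> ch cg t; exact: (ccontM (ch t) (cg t)). Qed.

Lemma gcont_cst c : gcont (fun=> c).
Proof. by move=> t; exact: ccont_cst. Qed.

Lemma gcont_cis (a : R) : gcont (fun t => cis (a * t)).
Proof. by move=> t; exact: cont_cis. Qed.

Lemma gcont_conj h : gcont h -> gcont (fun t => cconj (h t)).
Proof. by move=> ch t; exact: (@ccvg_conj _ _ (nbhs t) (nbhs_filter t) _ _ (ch t)). Qed.

Lemma gcont_abs2 h : gcont h -> forall t, {for t, continuous (fun t => cabs (h t) ^+ 2)}.
Proof.
move=> ch t.
have c1 : {for t, continuous (fun t => cabs (h t))}.
  exact: (@ccvg_abs _ _ (nbhs t) (nbhs_filter t) _ _ (ch t)).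
exact: (cvgM c1 c1).
Qed.

Definition tau : R := 2 * pi.

Lemma tau_gt0 : 0 < tau.
Proof. by rewrite mulr_gt0 ?pi_gt0. Qed.

Lemma tau_neq0 : tau != 0. Proof. by rewrite gt_eqF ?tau_gt0. Qed.

Definition mean h : C R := cofr tau^-1 * cint 0 tau h.

Definition msq h : R := tau^-1 * rint 0 tau (fun t => cabs (h t) ^+ 2).

Definition fourier h k : C R := mean (fun t => h t * cis ((- k)%:~R * t)).

Lemma meanD h g : gcont h -> gcont g ->
  mean (fun t => h t + g t) = mean h + mean g.
Proof.
move=> ch cg; rewrite /mean -mulrDr.
by rewrite (cintD (@gcontc _ 0 tau ch) (@gcontc _ 0 tau cg)).
Qed.

Lemma meanZ c h : gcont h -> mean (fun t => c * h t) = c * mean h.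
Proof.
by move=> ch; rewrite /mean mulrCA (cintZ c (@gcontc _ 0 tau ch)).
Qed.

Lemma eq_mean h g : h =1 g -> mean h = mean g.
Proof. by move=> /funext ->. Qed.

Lemma mean_cst c : mean (fun=> c) = c.
Proof.
rewrite /mean cint_cst ?ltW ?tau_gt0 // subr0 mulrCA -cofrM mulVf ?tau_neq0 //.
by rewrite mulr1.
Qed.

Lemma mean_bound h B : gcont h -> (forall t, cabs (h t) <= B) ->
  cabs (mean h) <= 2 * B.
Proof.
move=> ch hB; have t0 := tau_gt0.
rewrite /mean cabsM cabs_cofr gtr0_norm ?invr_gt0 // mulrC ler_pdivrMr //.
have := cint_bound (ltW t0) (gcontc ch) (fun t _ => hB t).
by rewrite subr0.
Qed.

Lemma mean_cofr (f : R -> R) :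
  mean (fun t => cofr (f t)) = cofr (tau^-1 * rint 0 tau f).
Proof.
rewrite cofrM /mean; congr (_ * _); apply: eq_ReIm => //=.
by rewrite rint_cst ?ltW ?tau_gt0 // mul0r.
Qed.

Lemma mean_conj h : gcont h -> mean (fun t => cconj (h t)) = cconj (mean h).
Proof.
move=> ch; rewrite /mean cconjM; congr (_ * _).
  by rewrite /cofr /cconj /= oppr0.
have ci := ccontc_Im (@gcontc _ 0 tau ch).
apply: eq_ReIm => /=.
  by apply: eq_rint => t _; case: (h t).
rewrite -mulN1r -rintZ //; apply: eq_rint => t _.
by rewrite mulN1r; case: (h t).
Qed.

Lemma msqE h : cofr (msq h) = mean (fun t => h t * cconj (h t)).
Proof. by rewrite /msq -mean_cofr; apply: eq_mean => t; rewrite mul_cconj. Qed.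

Lemma le_msq h g : gcont h -> gcont g -> (forall t, cabs (h t) <= cabs (g t)) ->
  msq h <= msq g.
Proof.
move=> ch cg hg; rewrite /msq ler_pM2l ?invr_gt0 ?tau_gt0 //.
apply: le_rint => [t _|t _|t _]; try exact: gcont_abs2.
by rewrite ler_pXn2r ?nnegrE ?cabs_ge0.
Qed.

Lemma msq_cst c : msq (fun=> c) = cabs c ^+ 2.
Proof. by apply: cofr_inj; rewrite msqE mean_cst mul_cconj. Qed.

Lemma msqZ c h : gcont h -> msq (fun t => c * h t) = cabs c ^+ 2 * msq h.
Proof.
move=> ch; apply: cofr_inj; rewrite cofrM !msqE -mul_cconj.
rewrite -meanZ; last exact: (gcontM ch (gcont_conj ch)).
by apply: eq_mean => t; rewrite cconjM mulrACA.
Qed.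

Lemma msq_ge0 h : 0 <= msq h.
Proof.
rewrite /msq mulr_ge0 ?invr_ge0 ?(ltW tau_gt0) //.
by apply: Rintegral_ge0 => x _; rewrite exprn_ge0 ?cabs_ge0.
Qed.

Lemma mean_cis k : mean (fun t => cis (k%:~R * t)) = (k == 0)%:R.
Proof.
case: eqVneq => [->|k0].
  by rewrite -[RHS](mean_cst 1); apply: eq_mean => t; rewrite mul0r cis0.
have a0 : k%:~R != 0 :> R by rewrite intr_eq0.
set a := k%:~R in a0 *.
have cm t : (fun t : R => a * t) @ t --> a * t.
  by apply: cvgM; [exact: cvg_cst|exact: cvg_id].
have t0 := ltW tau_gt0.
have [c1 s1] : cos (a * tau) = 1 /\ sin (a * tau) = 0.
  by have := cis_int k; rewrite /cis => -[-> ->].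
have dm t : is_derive t (1 : R) (fun t => a * t) a.
  by apply: is_derive_eq; rewrite /GRing.scale /= mulr1.
have IC : rint 0 tau (fun t => cos (a * t)) =
    a^-1 * sin (a * tau) - a^-1 * sin (a * 0).
  apply: (@rint_FTC _ 0 tau (fun t => cos (a * t))
    (fun t => a^-1 * sin (a * t)) t0) => t.
    exact: (continuous_comp (f := fun t => a * t) (cm t) (@continuous_cos _ _)).
  have h2 := is_derive1_comp (is_derive_sin (a * t)) (dm t).
  by apply: is_derive_eq; rewrite /GRing.scale /=; field.
have IS : rint 0 tau (fun t => sin (a * t)) =
    - a^-1 * cos (a * tau) - - a^-1 * cos (a * 0).
  apply: (@rint_FTC _ 0 tau (fun t => sin (a * t))
    (fun t => - a^-1 * cos (a * t)) t0) => t.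
    exact: (continuous_comp (f := fun t => a * t) (cm t) (@continuous_sin _ _)).
  have h2 := is_derive1_comp (is_derive_cos (a * t)) (dm t).
  by apply: is_derive_eq; rewrite /GRing.scale /=; field.
rewrite /mean (_ : cint _ _ _ = 0) ?mulr0 //; apply: eq_ReIm.
  by rewrite [LHS]IC s1 !mulr0 sin0 mulr0 subrr.
by rewrite [LHS]IS c1 !mulr0 cos0 subrr.
Qed.

Lemma gcont_hat h k : gcont h -> gcont (fun t => h t * cis ((- k)%:~R * t)).
Proof. by move=> ch; exact: (gcontM ch (@gcont_cis _)). Qed.

Lemma fourierD c h g k : gcont h -> gcont g ->
  fourier (fun t => h t + c * g t) k = fourier h k + c * fourier g k.
Proof.
move=> ch cg; have hk := @gcont_hat h k ch; have gk := @gcont_hat g k cg.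
rewrite /fourier -(meanZ c gk) -(meanD hk (gcontM (@gcont_cst c) gk)).
by apply: eq_mean => t; rewrite mulrDl mulrA.
Qed.

Lemma hat_cis m k : fourier (fun t => cis (m%:~R * t)) k = (m == k)%:R.
Proof.
rewrite -subr_eq0 -mean_cis; apply: eq_mean => t.
by rewrite -cisD -mulrDl -intrD.
Qed.

(** The two cross terms of the expanded square are conjugate. With [c = - fourier h m] this is one
    step of Bessel's identity; when [fourier h m] is zero it is one step of Parseval's. *)
Lemma msq_add c h m : gcont h ->
  msq (fun t => h t + c * cis (m%:~R * t)) =
  msq h + 2 * complex.Re (cconj c * fourier h m) + cabs c ^+ 2.
Proof.
move=> ch.
have H : cofr (msq (fun t => h t + c * cis (m%:~R * t))) =
    cofr (msq h) + cconj c * fourier h m + cconj (cconj c * fourier h m) +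
      cofr (cabs c ^+ 2).
  have cE := @gcont_hat h m ch.
  have cF : gcont (fun t => cconj c * (h t * cis ((- m)%:~R * t))).
    exact: (gcontM (@gcont_cst (cconj c)) cE).
  have cG : gcont (fun t => h t * cconj (h t)).
    exact: (gcontM ch (gcont_conj ch)).
  rewrite !msqE /fourier -meanZ // -mean_conj // -(mean_cst (cofr (cabs c ^+ 2))).
  have c1 := gcontD cG cF; have c2 := gcontD c1 (gcont_conj cF).
  rewrite -(meanD cG cF) -(meanD c1 (gcont_conj cF)).
  rewrite -(meanD c2 (@gcont_cst _)).
  apply: eq_mean => t; rewrite cconjD !cconjM cconjK -mul_cconj cis_conj.
  rewrite mulrNz mulNr cis_conj opprK.
  have := cisN (m%:~R * t).
  move: (cis (- _)) (cis (_ * t)) (h t) (cconj (h t)) => u v a b uv.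
  by rewrite -[X in _ = _ + X]mulr1 -uv; ring.
have := congr1 (fun z => complex.Re z) H; rewrite /= !ReD /= => ->.
by case: (cconj c * fourier h m) => a b /=; ring.
Qed.

(* Bessel's identity, obtained by removing one frequency at a time. *)
Fixpoint resid h (m : nat -> int) n : R -> C R :=
  if n is n'.+1 then
    fun t => resid h m n' t + (- fourier h (m n')) * cis ((m n')%:~R * t)
  else h.

Lemma gcont_resid h (m : nat -> int) n : gcont h -> gcont (resid h m n).
Proof.
move=> ch; elim: n => [//|n IH] /=.
exact: (gcontD IH (gcontM (@gcont_cst _) (@gcont_cis _))).
Qed.

Lemma hat_resid h (m : nat -> int) n j : gcont h ->
  (forall i, (i < n)%N -> m i != j) -> fourier (resid h m n) j = fourier h j.
Proof.
move=> ch; elim: n => [//|n IH] mj /=.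
rewrite (fourierD _ _ (@gcont_resid h m n ch) (@gcont_cis _)) hat_cis.
by rewrite (negPf (mj n _)) // mulr0 addr0 IH // => i /ltnW; exact: mj.
Qed.

Lemma bessel_eq h (m : nat -> int) n : gcont h -> injective m ->
  msq h = \sum_(i < n) cabs (fourier h (m i)) ^+ 2 + msq (resid h m n).
Proof.
move=> ch mI; elim: n => [|n IH]; first by rewrite big_ord0 add0r.
rewrite big_ord_recr /= IH (msq_add _ _ (@gcont_resid h m n ch)) cabsN.
rewrite hat_resid //; last first.
  by move=> i ilt; rewrite (inj_eq mI) ltn_eqF.
rewrite cconjN mulNr ReN [cconj _ * _]mulrC mul_cconj /=.
by rewrite [in RHS]addrA; move: (\sum_(i < n) _) (msq _) (_ ^+ 2) => *; ring.
Qed.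

Lemma bessel h (m : nat -> int) n : gcont h -> injective m ->
  \sum_(i < n) cabs (fourier h (m i)) ^+ 2 <= msq h.
Proof.
by move=> ch mI; rewrite (@bessel_eq h m n ch mI) lerDl msq_ge0.
Qed.

End Fourier.

(** * The complex exponential *)

Section Exponential.
Context {R : realType}.
Implicit Types (F : C R -> C R) (w z u : C R).

Definition cexp w : C R := cofr (expR (complex.Re w)) * cis (complex.Im w).

Lemma cexpD w z : cexp (w + z) = cexp w * cexp z.
Proof. by rewrite /cexp ReD ImD expRD cisD cofrM mulrACA. Qed.

Lemma real_derive_bound (f : R -> R) (x d : R) : is_derive x (1 : R) f d ->
  forall e : R, 0 < e -> exists2 r, 0 < r & forall h, `|h| < r ->
    `|f (x + h) - f x - d * h| <= e * `|h|.
Proof.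
move=> [df dE] e e0.
have : (fun h => h^-1 *: ((f \o shift x) (h *: 1) - f x)) @ 0^' --> d.
  by rewrite -dE; exact: df.
move=> /cvgrPdist_lt/(_ _ e0); rewrite near_withinE => /nbhs_normP[r /= r0 rP].
exists r => // h hr; have [->|h0] := eqVneq h 0.
  by rewrite addr0 subrr sub0r mulr0 normr0 oppr0 normr0 mulr0.
have := rP h; rewrite /ball_ /= sub0r normrN => /(_ hr h0).
rewrite distrC /GRing.scale /= mulr1 (addrC h x) => H.
have h1 : 0 < `|h| by rewrite normr_gt0.
rewrite -ler_pdivrMr // -normfV -normrM mulrBl mulfK // ltW //.
by rewrite [_ / h]mulrC.
Qed.

Lemma cderiv_cexp0 : cderiv cexp 0 1.
Proof.
move=> e e0.
(* The real part of the error is at most [4 * e1 * U] and the imaginary part at most [5 * e1 * U],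
   which gives the 9. The conditions [e1 <= 1] and [U < e1] bound [X] by 3 and [X - 1] by
   [2 * e1]. *)
have [e1 [e10 e1l e1e]] : exists e1 : R, [/\ 0 < e1, e1 <= 1 & 9 * e1 <= e].
  exists (Num.min 1 (e / 9)); split.
  - by rewrite lt_min ltr01 divr_gt0.
  - by rewrite ge_min lexx.
  - by rewrite mulrC -ler_pdivlMr // ge_min lexx orbT.
have [r1 r10 E1] := real_derive_bound (is_derive_expR 0) e10.
have [r2 r20 E2] := real_derive_bound (is_derive_cos 0) e10.
have [r3 r30 E3] := real_derive_bound (is_derive_sin 0) e10.
exists (Num.min (Num.min r1 r2) (Num.min r3 e1)).
  by rewrite !lt_min r10 r20 r30 e10.
move=> u; rewrite !lt_min => /andP[/andP[u1 u2] /andP[u3 u4]].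
have xu := cabs_Re u; have yu := cabs_Im u.
set U := cabs u in u1 u2 u3 u4 xu yu *.
set x := complex.Re u in xu *; set y := complex.Im u in yu *.
have := E1 x (le_lt_trans xu u1); have := E2 y (le_lt_trans yu u2).
have := E3 y (le_lt_trans yu u3).
rewrite !add0r expR0 cos0 sin0 oppr0 mul0r !subr0 !mul1r ?addr0.
set s := sin y; set c := cos y; set X := expR x => hs hc hX.
have X0 : 0 <= X by exact: expR_ge0.
have xabs := normr_ge0 x; have yabs := normr_ge0 y.
have hX1 : `|X - 1| <= 2 * `|x|.
  rewrite (_ : X - 1 = (X - 1 - x) + x); last by rewrite subrK.
  by apply: (le_trans (ler_normD _ _)); nra.
have X3 : X <= 3.
  have : `|X - 1| <= 2 by nra.
  by rewrite ler_norml => /andP[_]; lra.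
apply: (le_trans (cabs_ReIm _)).
have -> : complex.Re (cexp u - cexp 0 - u) = X * (c - 1) + (X - 1 - x).
  rewrite !ReD !ReN !ReM /= -/x -/y -/s -/c -/X expR0 cos0 sin0; ring.
have -> : complex.Im (cexp u - cexp 0 - u) = X * (s - y) + (X - 1) * y.
  rewrite !ImD !ImN !ImM /= -/x -/y -/s -/c -/X expR0 cos0 sin0; ring.
have h1 := ler_normD (X * (c - 1)) (X - 1 - x).
have h2 := ler_normD (X * (s - y)) ((X - 1) * y).
rewrite !normrM (ger0_norm X0) in h1 h2.
have h3 : X * `|c - 1| <= 3 * (e1 * U).
  by apply: ler_pM => //; apply: (le_trans hc); rewrite ler_pM2l.
have h4 : X * `|s - y| <= 3 * (e1 * U).
  by apply: ler_pM => //; apply: (le_trans hs); rewrite ler_pM2l.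
have h5 : `|X - 1| * `|y| <= 2 * e1 * U.
  apply: ler_pM => //; apply: (le_trans hX1).
  by rewrite ler_pM2l // (le_trans xu) // ltW.
have h6 : `|X - 1 - x| <= e1 * U.
  by apply: (le_trans hX); rewrite ler_pM2l.
have : 9 * e1 * U <= e * U by rewrite ler_wpM2r // cabs_ge0.
rewrite -!mulrA in h5 *.
move: h1 h2 h3 h4 h5 h6.
move: (X * (c - 1) + _) (X * (s - y) + _) (e * U) => A B eU.
move: (X * _) (X * _) (`|X - 1 - x|) (`|X - 1| * _) (e1 * U) => P Q S V W.
lra.
Qed.

(** The functional equation carries differentiability from 0 to every point. *)
Lemma cdif_cexp w : cdif cexp w.
Proof.
have d1 : cdif (fun z => z + (- w)) w.
  exact: (cdifD (cdif_id w) (cdif_cst (- w) w)).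
have d2 : cdif cexp (w + - w) by rewrite subrr; exact: cderiv_cdif cderiv_cexp0.
have := cdifM (cdif_cst (cexp w) w) (cdif_comp d1 d2).
apply: cdif_near; apply: near_call => z.
by rewrite -cexpD addrC subrK.
Qed.

Lemma cexp_cpt x y : cexp (cpt x y) = cofr (expR x) * cis y.
Proof. by []. Qed.

Lemma cos_sin_surj (x y : R) : x ^+ 2 + y ^+ 2 = 1 ->
  exists t, x = cos t /\ y = sin t.
Proof.
move=> xy.
have x1 : -1 <= x <= 1.
  by rewrite -ler_norml -(@ler_pXn2r _ 2) ?nnegrE // real_normK ?num_real // expr1n; nra.
have yE : y ^+ 2 = 1 - x ^+ 2 by rewrite -xy addrC addKr.
have [y0|y0] := leP 0 y.
  exists (acos x); rewrite acosK ?in_itv //= sin_acos // -yE.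
  by rewrite sqrtr_sqr ger0_norm.
exists (- acos x); rewrite cosN sinN acosK ?in_itv //= sin_acos // -yE.
by rewrite sqrtr_sqr ltr0_norm // opprK.
Qed.

Lemma polar_form z : z != 0 -> exists t, z = cofr (cabs z) * cis t.
Proof.
move=> z0; have r0 : cabs z != 0 by rewrite gt_eqF // cabs_gt0.
have [|t [ct st]] := @cos_sin_surj (complex.Re z / cabs z) (complex.Im z / cabs z).
  by rewrite !expr_div_n -mulrDl -cabs_sqr divff // expf_neq0.
exists t; apply: eq_ReIm; rewrite ?ReM ?ImM /= -ct -st; field.
all: by rewrite r0.
Qed.

End Exponential.

Lemma bounded_series_cvg0 {R : realType} (u : nat -> R) (M : R) :
  (forall n, 0 <= u n) -> (forall n, \sum_(i < n) u i <= M) ->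
  u @ \oo --> (0 : R).
Proof.
move=> u0 uM; apply: cvg_series_cvg_0; apply: nondecreasing_is_cvgn.
  by apply/nondecreasing_seqP => n; rewrite seriesSr lerDl.
by exists M => _ [n _ <-]; rewrite /series /= big_mkord.
Qed.

Lemma sqr_cvg0 {R : realType} (u : nat -> R) : (forall n, 0 <= u n) ->
  (fun n => u n ^+ 2) @ \oo --> (0 : R) -> u @ \oo --> (0 : R).
Proof.
move=> u0 /cvgrPdist_lt u2; apply/cvgrPdist_lt => e e0.
have := u2 _ (exprn_gt0 2 e0); apply: filterS => n.
rewrite !sub0r !normrN ger0_norm ?sqr_ge0 // ger0_norm //.
by rewrite ltr_pXn2r ?nnegrE // ltW.
Qed.

(** * Taylor expansion of holomorphic functions *)

Section Taylor.
Context {R : realType}.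
Variable F : C R -> C R.
Hypothesis Fhol : forall z, cabs z < 1 -> cdif F z.
Implicit Types (r t x y : R) (z w : C R) (k : int).

Definition circ (G : C R -> C R) r t : C R := G (cofr r * cis t).

Lemma cabs_polar r t : 0 <= r -> cabs (cofr r * cis t) = r.
Proof. by move=> r0; rewrite cabsM cabs_cis mulr1 cabs_cofr ger0_norm. Qed.

Lemma gcont_circ (G : C R -> C R) r : 0 <= r ->
  (forall z, cabs z = r -> {for z, continuous G}) -> gcont (circ G r).
Proof.
move=> r0 cG t.
have h1 := ccontM (ccont_cst (cofr r) t) (continuous_cis (t := t)).
have h2 := cG _ (cabs_polar t r0).
exact: (@continuous_comp _ _ _ (fun t => cofr r * cis t) G t h1 h2).
Qed.

Lemma gcont_circF r : 0 <= r < 1 -> gcont (circ F r).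
Proof.
move=> /andP[r0 r1]; apply: gcont_circ => // z zr.
by apply: cdif_continuous; apply: Fhol; rewrite zr.
Qed.

(** The function [g] of the proof has period [2 pi i] because [k] is an integer. On the rectangle
    with sides [[ln r1, ln r2]] and [[0, 2 pi]] the horizontal sides therefore cancel, and Goursat's
    theorem equates the vertical ones. *)
Lemma circ_const k r1 r2 : 0 < r1 -> r1 <= r2 -> r2 < 1 ->
  cofr (expR ((- k)%:~R * ln r1)) * fourier (circ F r1) k =
  cofr (expR ((- k)%:~R * ln r2)) * fourier (circ F r2) k.
Proof.
move=> r10 r12 r21; have r20 := lt_le_trans r10 r12.
have r11 := le_lt_trans r12 r21.
pose a : R := (- k)%:~R.
pose g w := F (cexp w) * cexp (cofr a * w).
have gE x y : g (cpt x y) =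
    cofr (expR (a * x)) * (circ F (expR x) y * cis (a * y)).
  rewrite /g /circ cexp_cpt /cexp ReM ImM /= !mul0r subr0 addr0.
  by rewrite mulrCA.
have l12 : 0 <= ln r2 - ln r1 by rewrite subr_ge0 ler_ln ?posrE.
have t0 := ltW (@tau_gt0 R).
have dg u v : u \in `[ln r1, ln r1 + (ln r2 - ln r1)] -> v \in `[0, 0 + tau] ->
    exists D, cderiv g (cpt u v) D.
  rewrite in_itv /= [ln r1 + _]addrC subrK => /andP[u1 u2] _.
  apply: cdif_cderiv; apply: cdifM.
    apply: (cdif_comp (cdif_cexp _)); apply: Fhol.
    rewrite cexp_cpt cabs_polar ?expR_ge0 //.
    by apply: (le_lt_trans _ r21); rewrite -[leRHS](lnK _) ?posrE // ler_expR.
  exact: (cdif_comp (cdifM (cdif_cst _ _) (cdif_id _)) (cdif_cexp _)).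
have := goursat l12 t0 dg.
rewrite /rect [ln r1 + _]addrC subrK add0r.
rewrite (_ : cint _ _ (fun x => g (cpt x 0)) = cint (ln r1) (ln r2) (fun x => g (cpt x tau))); last first.
  apply: eq_cint => x _; rewrite !gE /circ.
  rewrite mulr0 cis0 /tau cis_2pi.
  by rewrite /a cis_int.
rewrite subrr add0r => /eqP; rewrite mulf_eq0.
have -> : cpt 0 1 == 0 :> C R = false.
  by apply/negP => /eqP /(congr1 (fun z => complex.Im z)) /eqP; rewrite /= oner_eq0.
rewrite /= subr_eq0 => /eqP.
have cE r : 0 < r -> r < 1 -> cint 0 tau (fun y => g (cpt (ln r) y)) =
    cofr (expR (a * ln r)) * cint 0 tau (fun t => circ F r t * cis (a * t)).
  move=> r0 rr1.
  have cc : gcont (circ F r) by apply: gcont_circF; rewrite ltW.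
  rewrite -(cintZ _ (@gcontc _ _ 0 tau (@gcont_hat _ _ k cc))).
  by apply: eq_cint => t _; rewrite gE lnK ?posrE.
by rewrite !cE // => E; rewrite /fourier /mean -/a !(mulrCA (cofr (expR _))) E.
Qed.

(** By [circ_const] every radius in [(0, 1)] gives the same value; one half is an arbitrary
    choice. *)
Definition tcoef k : C R :=
  cofr (expR ((- k)%:~R * ln 2^-1)) * fourier (circ F 2^-1) k.

Lemma hat_tcoef r k : 0 < r < 1 ->
  fourier (circ F r) k = cofr (expR (k%:~R * ln r)) * tcoef k.
Proof.
move=> /andP[r0 r1].
have h0 : (0 : R) < 2^-1 by rewrite invr_gt0.
have h1 : (2^-1 : R) < 1 by rewrite invf_lt1 ?ltr1n.
have -> : tcoef k = cofr (expR ((- k)%:~R * ln r)) * fourier (circ F r) k.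
  rewrite /tcoef; have [h|h] := leP r 2^-1.
    by rewrite (@circ_const k r 2^-1).
  by rewrite (@circ_const k 2^-1 r) // ltW.
by rewrite mulrA -cofrM -expRD mulrNz mulNr subrr expR0 mul1r.
Qed.

Lemma hat_tcoefn r n : 0 < r < 1 ->
  fourier (circ F r) (Posz n) = cofr (r ^+ n) * tcoef (Posz n).
Proof.
by move=> r01; rewrite hat_tcoef // -pmulrn expRM_natl lnK // posrE; case/andP: r01.
Qed.

(** The coefficient equals [r ^+ n.+1] times a Fourier coefficient that stays bounded as [r] tends
    to 0, by continuity of [F] at 0. *)
Lemma tcoef_neg n : tcoef (Negz n) = 0.
Proof.
have F0 : {for (0 : C R), continuous F}.
  by apply: cdif_continuous; apply: Fhol; rewrite cabs0.
move/cvg_cabs_ltP: F0 => /(_ 1 ltr01)[d d0 dF].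
apply: cabs0_eq0; apply: le_anti; rewrite cabs_ge0 andbT.
pose B := cabs (F 0) + 1.
have B0 : 0 < B by rewrite ltr_pwDr // cabs_ge0.
apply/ler_addgt0Pl => e e0; rewrite addr0.
(* The three terms ensure [r < d], [r < 1] and [2 * B * r <= e]. *)
pose r := Num.min (Num.min (d / 2) (2^-1)) (e / (2 * B)).
have r0 : 0 < r by rewrite !lt_min divr_gt0 // invr_gt0 divr_gt0 ?mulr_gt0 //= ltr0n.
have rd : r < d.
  apply: (@le_lt_trans _ _ (d / 2)); first by rewrite !ge_min lexx.
  by rewrite ltr_pdivrMr // mulr_natr mulr2n ltrDl.
have r1 : r < 1.
  apply: (@le_lt_trans _ _ 2^-1); first by rewrite !ge_min lexx orbT.
  by rewrite invf_lt1 ?ltr1n.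
have re : 2 * B * r <= e.
  by rewrite mulrC -ler_pdivlMr ?mulr_gt0 // !ge_min lexx !orbT.
have cF : gcont (circ F r) by apply: gcont_circF; rewrite (ltW r0).
have bF t : cabs (circ F r t) <= B.
  have -> : circ F r t = (circ F r t - F 0) + F 0 by rewrite subrK.
  apply: (le_trans (cabsD _ _)); rewrite addrC lerD2l ltW //.
  by apply: dF; rewrite subr0 cabs_polar // ltW.
have hb : cabs (fourier (circ F r) (Negz n)) <= 2 * B.
  apply: mean_bound; first exact: (@gcont_hat _ _ (Negz n) cF).
  by move=> t; rewrite cabsM cabs_cis mulr1.
have : tcoef (Negz n) = cofr (r ^+ n.+1) * fourier (circ F r) (Negz n).
  rewrite hat_tcoef ?r0 // mulrA -cofrM -[r in r ^+ _](lnK _) ?posrE //.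
  rewrite -expRM_natl -expRD NegzE mulrNz mulNr -pmulrn subrr expR0.
  by rewrite mul1r.
move=> ->; rewrite cabsM cabs_cofr ger0_norm ?exprn_ge0 ?(ltW r0) //.
apply: (le_trans _ re); rewrite mulrC; apply: ler_pM => //.
- exact: cabs_ge0.
- by rewrite exprn_ge0 // ltW.
- by rewrite exprS ler_piMr ?(ltW r0) // exprn_ile1 ?(ltW r0) // ltW.
Qed.

(** The coefficient is the mean of [F] over each circle about 0, and these means tend to [F 0] by
    continuity. *)
Lemma tcoef0 : tcoef 0 = F 0.
Proof.
have F0 : {for (0 : C R), continuous F}.
  by apply: cdif_continuous; apply: Fhol; rewrite cabs0.
apply/eqP; rewrite -subr_eq0; apply/eqP.
apply: cabs0_eq0; apply: le_anti; rewrite cabs_ge0 andbT.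
apply/ler_addgt0Pl => e e0; rewrite addr0.
move/cvg_cabs_ltP: F0 => /(_ _ (divr_gt0 e0 (ltr0Sn R 1)))[d d0 dF].
pose r := Num.min (d / 2) (2^-1).
have r0 : 0 < r by rewrite lt_min divr_gt0 // invr_gt0 ltr0n.
have rd : r < d.
  apply: (@le_lt_trans _ _ (d / 2)); first by rewrite !ge_min lexx.
  by rewrite ltr_pdivrMr // mulr_natr mulr2n ltrDl.
have r1 : r < 1.
  apply: (@le_lt_trans _ _ 2^-1); first by rewrite !ge_min lexx orbT.
  by rewrite invf_lt1 ?ltr1n.
have cF : gcont (circ F r) by apply: gcont_circF; rewrite (ltW r0).
have cB : gcont (fun t => circ F r t + - F 0).
  exact: (gcontD cF (@gcont_cst _ _)).
have := @mean_bound _ _ (e / 2) cB.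
rewrite (meanD cF (@gcont_cst _ _)) mean_cst.
have -> : mean (circ F r) = tcoef 0.
  have := @hat_tcoef r 0; rewrite r0 r1 mul0r expR0 mul1r => <- //.
  by apply: eq_mean => t; rewrite oppr0 mul0r cis0 mulr1.
rewrite [2 * (e / 2)]mulrC divfK // => -> // t.
by apply: ltW; apply: dF; rewrite subr0 cabs_polar // ltW.
Qed.

(* Chernoff's argument: dividing [F - F z] by [w - z] turns the Fourier
   partial sums into a telescoping sum, whose ends vanish by
   Riemann-Lebesgue. *)
Lemma taylor_polar r t0 : 0 < r < 1 ->
  series (fun n => tcoef (Posz n) * (cofr r * cis t0) ^+ n) @ \oo -->
  F (cofr r * cis t0).
Proof.
move=> r01; have /andP[r0 r1] := r01; set z := cofr r * cis t0.
have zr : cabs z = r by rewrite cabs_polar // ltW.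
have [D FD] : exists D, cderiv F z D by apply: cdif_cderiv; apply: Fhol; rewrite zr.
pose q := dslope F z D.
have cv : gcont (circ q r).
  apply: gcont_circ; first exact: ltW.
  move=> w wr; have [->|wz] := eqVneq w z; first exact: cderiv_dslope.
  have wz0 : w - z != 0 by rewrite subr_eq0.
  apply: cdif_continuous.
  have dsub : cdif (fun u => u - z) w := cdifD (cdif_id w) (cdif_cst (- z) w).
  have dF : cdif (fun u => F u - F z) w.
    by apply: (cdifD (G := fun=> - F z)); [apply: Fhol; rewrite wr|exact: cdif_cst].
  have dQ := cdifM dF (@cdifV _ (fun u => u - z) _ wz0 dsub).
  apply: cdif_near dQ; apply/near_cabsP; exists (cabs (w - z)).
    by rewrite cabs_gt0.
  move=> u uw; rewrite /q /dslope; case: eqVneq => // uz.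
  by move: uw; rewrite uz cabsB ltxx.
pose v := circ q r.
(* On the circle [F - F z] is [q] times [w - z]: multiplication by [w] scales by [r] and shifts the
   frequency by one, and the constant [F z] is seen by frequency 0 alone. *)
have key k : fourier (circ F r) k - F z * (k == 0)%:R =
    cofr r * fourier v (k - 1) - z * fourier v k.
  have cF : gcont (circ F r) by apply: gcont_circF; rewrite (ltW r0).
  have e1 : fourier (circ F r) k - F z * (k == 0)%:R =
      fourier (fun t => circ F r t + (- F z) * cis (0%:~R * t)) k.
    rewrite (fourierD _ _ cF (@gcont_cis _ _)) hat_cis eq_sym mulNr //.
  rewrite e1 /fourier -(meanZ _ (@gcont_hat _ _ (k - 1) cv)).
  rewrite -mulNr -(meanZ _ (@gcont_hat _ _ k cv)).
  rewrite -meanD; last 2 first.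
    exact: (gcontM (@gcont_cst _ _) (@gcont_hat _ _ (k - 1) cv)).
    exact: (gcontM (@gcont_cst _ _) (@gcont_hat _ _ k cv)).
  apply: eq_mean => t; rewrite mul0r cis0 mulr1.
  rewrite /v /circ (dslopeE F z D) -/q.
  have -> : (- (k - 1))%:~R * t = (- k)%:~R * t + t.
    by rewrite opprB addrC intrD mulrDl mul1r.
  rewrite cisD.
  have rg (a b c d e : C R) : a * (e * b - d) * c =
      e * (a * (c * b)) + - d * (a * c) by ring.
  exact: rg.
(* After multiplication by [cis (k t0)], the right side of [key] is a difference of consecutive
   values of [V]. *)
pose V k := cofr r * cis ((k + 1)%:~R * t0) * fourier v k.
have stepV k : fourier (circ F r) k * cis (k%:~R * t0) - F z * (k == 0)%:R =
    V (k - 1) - V k.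
  have -> : F z * (k == 0)%:R = F z * (k == 0)%:R * cis (k%:~R * t0).
    by case: eqVneq => [->|_]; rewrite ?mulr0 ?mul0r // cis0 mulr1.
  have -> : V k = cofr r * (cis (k%:~R * t0) * cis t0) * fourier v k.
    by rewrite /V intrD mulrDl mul1r cisD.
  have -> : V (k - 1) = cofr r * cis (k%:~R * t0) * fourier v (k - 1).
    by rewrite /V subrK.
  have rg (a b c d e : C R) : (a * b - a * d * e) * c =
      a * c * b - a * (c * d) * e by ring.
  by rewrite -mulrBl key /z; exact: rg.
have Vabs k : cabs (V k) = r * cabs (fourier v k).
  by rewrite !cabsM cabs_cofr cabs_cis mulr1 ger0_norm // ltW.
have hv (m : nat -> int) : injective m ->
    (fun n => cabs (V (m n))) @ \oo --> (0 : R).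
  move=> mI.
  have h2 : (fun n => cabs (fourier v (m n)) ^+ 2) @ \oo --> (0 : R).
    apply: (@bounded_series_cvg0 _ _ (msq v)) => n; first exact: sqr_ge0.
    exact: bessel.
  have h1 : (fun n => cabs (fourier v (m n))) @ \oo --> (0 : R).
    by apply: sqr_cvg0 h2 => n; exact: cabs_ge0.
  have -> : (fun n => cabs (V (m n))) = (fun n => r * cabs (fourier v (m n))).
    by apply/funext => n; rewrite Vabs.
  have h : (fun n => r * cabs (fourier v (m n))) @ \oo --> r * 0.
    by apply: cvgM; [exact: cvg_cst|exact: h1].
  by rewrite mulr0 in h.
(* The coefficients of negative index vanish, so [V] is constant on negative indices. By [hv] this
   constant is 0, which disposes of the lower end of the telescoping sum. *)
have Vneg n : V (Negz n) = V (-1).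
  elim: n => [//|n <-]; have := stepV (Negz n).
  rewrite hat_tcoef // tcoef_neg mulr0 mul0r mulr0 subr0 => /esym/eqP.
  rewrite subr_eq0 => /eqP <-; congr (V _).
  by rewrite !NegzE -addn1 PoszD opprD.
have Vm1 : V (-1) = 0.
  apply: cabs0_eq0.
  have mI : injective Negz by move=> x y [].
  have h := hv _ mI.
  have e : (fun n => cabs (V (Negz n))) = fun=> cabs (V (-1)).
    by apply/funext => n; rewrite Vneg.
  rewrite e in h.
  have h' : (fun _ : nat => cabs (V (-1))) @ \oo --> cabs (V (-1)).
    exact: cvg_cst.
  have h1 := cvg_lim (@norm_hausdorff _ R) h.
  have h2 := cvg_lim (@norm_hausdorff _ R) h'.
  by rewrite -h2 h1.
have sumV N : series (fun n => tcoef (Posz n) * z ^+ n) N.+1 =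
    F z - V (Posz N).
  elim: N => [|N IH].
    rewrite seriesSr /series /= big_nil add0r expr0 mulr1.
    have := stepV 0; rewrite hat_tcoef // mul0r expR0 mul1r mul0r cis0 mulr1 eqxx mulr1 Vm1.
    by move=> /eqP; rewrite subr_eq sub0r addrC => /eqP.
  rewrite seriesSr IH.
  have := stepV (Posz N.+1); rewrite hat_tcoefn // mulr0 subr0 -pmulrn cisMn.
  have -> : Posz N.+1 - 1 = Posz N by rewrite -addn1 PoszD addrK.
  rewrite /z exprMn cofrX => e.
  have -> : tcoef (Posz N.+1) * (cofr r ^+ N.+1 * cis t0 ^+ N.+1) = V (Posz N) - V (Posz N.+1).
    by rewrite -e mulrA [tcoef _ * _]mulrC.
  by rewrite addrA subrK.
rewrite -cvg_shiftS; apply/ccvgP => /=.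
have mI : injective Posz by move=> x y [].
rewrite [X in X @ _ --> _](_ : _ = fun n => cabs (V (Posz n))); first exact: hv.
apply/funext => N.
by rewrite sumV [F z - _]addrC addrK cabsN.
Qed.

Lemma taylor_hol z : cabs z < 1 ->
  series (fun n => tcoef (Posz n) * z ^+ n) @ \oo --> F z.
Proof.
move=> z1; have [->|z0] := eqVneq z 0; last first.
  have [t zt] := polar_form z0; rewrite {1 2}zt; apply: taylor_polar.
  by rewrite cabs_gt0 z0.
rewrite -cvg_shiftS (_ : [sequence _]_n = fun=> F 0); first exact: cvg_cst.
apply/funext => n /=; rewrite /series /= big_nat_recl // expr0 mulr1 tcoef0.
by rewrite big1 ?addr0 // => i _; rewrite exprS mul0r mulr0.
Qed.

End Taylor.

(** * Square-summable sequences *)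

Section L2.
Context {R : realType}.
Implicit Types (a b c d : nat -> C R) (M e : R) (k : C R).

Lemma abs_series_cvg (u : nat -> R) M :
  (forall n, \sum_(i < n) `|u i| <= M) -> cvgn (series u).
Proof.
move=> uM; apply: normed_cvg.
suff : cvgn (series (fun n => `|u n|)) by [].
apply: nondecreasing_is_cvgn.
  by apply/nondecreasing_seqP => n; rewrite seriesSr lerDl.
by exists M => _ [n _ <-]; rewrite /series /= big_mkord.
Qed.

Lemma Re_sum (I : Type) (r : seq I) (P : pred I) (G : I -> C R) :
  complex.Re (\sum_(i <- r | P i) G i) = \sum_(i <- r | P i) complex.Re (G i).
Proof. by apply: (big_morph (fun z : C R => complex.Re z) ReD). Qed.

Lemma Im_sum (I : Type) (r : seq I) (P : pred I) (G : I -> C R) :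
  complex.Im (\sum_(i <- r | P i) G i) = \sum_(i <- r | P i) complex.Im (G i).
Proof. by apply: (big_morph (fun z : C R => complex.Im z) ImD). Qed.

Lemma cabs_series_cvg (u : nat -> C R) M :
  (forall n, \sum_(i < n) cabs (u i) <= M) -> cvgn (series u).
Proof.
move=> uM.
have /cvg_ex[x xP] : cvgn (series (fun n => complex.Re (u n))).
  apply: (@abs_series_cvg _ M) => n; apply: le_trans (uM n).
  by apply: ler_sum => i _; exact: cabs_Re.
have /cvg_ex[y yP] : cvgn (series (fun n => complex.Im (u n))).
  apply: (@abs_series_cvg _ M) => n; apply: le_trans (uM n).
  by apply: ler_sum => i _; exact: cabs_Im.
apply/cvg_ex; exists (x +i* y : C R); apply: ccvg_ReIm => /=.
  rewrite (_ : (fun _ => _) = series (fun n => complex.Re (u n))) //.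
  by apply/funext => n; rewrite /series /= Re_sum.
rewrite (_ : (fun _ => _) = series (fun n => complex.Im (u n))) //.
by apply/funext => n; rewrite /series /= Im_sum.
Qed.

(** This and [nrm2] are squared norms. Working without square roots, the triangle inequality is
    replaced by bounds such as [l2D], with a factor 2 on each term. *)
Definition psum a n : R := \sum_(i < n) cabs (a i) ^+ 2.

Definition l2 a := exists M, forall n, psum a n <= M.

(* Locked: otherwise unification unfolds limits of series. *)
Definition nrm2 : (nat -> C R) -> R :=
  locked (fun a => limn (series (fun n => cabs (a n) ^+ 2))).

Definition dot : (nat -> C R) -> (nat -> C R) -> C R :=
  locked (fun a b => limn (series (fun n => a n * cconj (b n)))).

Lemma nrm2E a : nrm2 a = limn (series (fun n => cabs (a n) ^+ 2)).
Proof. by rewrite /nrm2 -lock. Qed.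

Lemma dotE a b : dot a b = limn (series (fun n => a n * cconj (b n))).
Proof. by rewrite /dot -lock. Qed.

Lemma psum_ge0 a n : 0 <= psum a n.
Proof. by apply: sumr_ge0 => i _; exact: sqr_ge0. Qed.

Lemma psumE a : series (fun n => cabs (a n) ^+ 2) = psum a.
Proof. by apply/funext => n; rewrite /series /= big_mkord. Qed.

Lemma nrm2_cvg a : l2 a -> psum a @ \oo --> nrm2 a.
Proof.
move=> [M aM]; rewrite nrm2E -psumE.
suff : cvgn (series (fun n => cabs (a n) ^+ 2)) by [].
apply: (@abs_series_cvg _ M) => n; apply: le_trans (aM n).
by apply: ler_sum => i _; rewrite ger0_norm // sqr_ge0.
Qed.

Lemma psum_nd a : nondecreasing_seq (psum a).
Proof.
by apply/nondecreasing_seqP => n; rewrite /psum big_ord_recr /= lerDl sqr_ge0.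
Qed.

Lemma psum_le_nrm2 a n : l2 a -> psum a n <= nrm2 a.
Proof.
move=> /nrm2_cvg aN; have cv : cvgn (psum a) by apply/cvg_ex; exists (nrm2 a).
have := nondecreasing_cvgn_le (@psum_nd a) cv n.
by rewrite (cvg_lim (@norm_hausdorff _ R) aN).
Qed.

Lemma nrm2_le a M : (forall n, psum a n <= M) -> nrm2 a <= M.
Proof.
move=> aM; have /nrm2_cvg aN : l2 a by exists M.
rewrite -(cvg_lim (@norm_hausdorff _ R) aN); apply: limr_le.
  by apply/cvg_ex; exists (nrm2 a).
by apply: nearW.
Qed.

Lemma nrm2_ge0 a : l2 a -> 0 <= nrm2 a.
Proof. by move=> /(psum_le_nrm2 0); rewrite /psum big_ord0. Qed.

Lemma cabs_coord a n : l2 a -> cabs (a n) ^+ 2 <= nrm2 a.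
Proof.
move=> /(psum_le_nrm2 n.+1); rewrite /psum big_ord_recr /=; apply: le_trans.
by rewrite lerDr psum_ge0.
Qed.

Lemma cabsD_sqr (x y : C R) : cabs (x + y) ^+ 2 <= 2 * cabs x ^+ 2 + 2 * cabs y ^+ 2.
Proof.
rewrite !cabs_sqr ReD ImD.
have := sqr_ge0 (complex.Re x - complex.Re y).
have := sqr_ge0 (complex.Im x - complex.Im y).
nra.
Qed.

Lemma l2D a b : l2 a -> l2 b ->
  l2 (fun n => a n + b n) /\
  nrm2 (fun n => a n + b n) <= 2 * nrm2 a + 2 * nrm2 b.
Proof.
move=> la lb.
have H n : psum (fun n => a n + b n) n <= 2 * nrm2 a + 2 * nrm2 b.
  apply: (@le_trans _ _ (2 * psum a n + 2 * psum b n)).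
    rewrite /psum !mulr_sumr -big_split /=; apply: ler_sum => i _.
    exact: cabsD_sqr.
  by apply: lerD; rewrite ler_pM2l //; exact: psum_le_nrm2.
by split; [exists (2 * nrm2 a + 2 * nrm2 b)|exact: nrm2_le].
Qed.

Lemma psumZ k a n : psum (fun n => k * a n) n = cabs k ^+ 2 * psum a n.
Proof.
rewrite /psum mulr_sumr; apply: eq_bigr => i _.
by rewrite cabsM exprMn.
Qed.

Lemma l2Z k a : l2 a -> l2 (fun n => k * a n).
Proof.
move=> [M aM]; exists (cabs k ^+ 2 * M) => n.
by rewrite psumZ ler_wpM2l ?sqr_ge0.
Qed.

Lemma l2B a b : l2 a -> l2 b -> l2 (fun n => a n - b n).
Proof.
move=> la lb; have [+ _] := l2D la (l2Z (-1) lb).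
rewrite (_ : (fun n => a n + -1 * b n) = (fun n => a n - b n)) //.
by apply/funext => n; rewrite mulN1r.
Qed.

Lemma nrm2B a b : l2 a -> l2 b ->
  nrm2 (fun n => a n - b n) <= 2 * nrm2 a + 2 * nrm2 b.
Proof.
move=> la lb; have [_] := l2D la (l2Z (-1) lb).
have -> : (fun n => a n + -1 * b n) = (fun n => a n - b n).
  by apply/funext => n; rewrite mulN1r.
have -> // : nrm2 (fun n => -1 * b n) = nrm2 b.
by rewrite !nrm2E; congr (limn (series _)); apply/funext => n; rewrite mulN1r cabsN.
Qed.

Lemma l2_0 : l2 (fun=> 0).
Proof.
exists 0 => n; rewrite /psum big1 // => i _.
by rewrite cabs0 expr0n.
Qed.

Lemma weighted_amgm (x y t : R) : 0 < t -> 0 <= x -> 0 <= y ->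
  x * y <= t * x ^+ 2 + t^-1 * y ^+ 2.
Proof.
move=> t0 x0 y0; have ti : 0 < t^-1 by rewrite invr_gt0.
have := mulr_ge0 (ltW ti) (sqr_ge0 (t * x - y)).
have -> : t^-1 * (t * x - y) ^+ 2 = t * x ^+ 2 + t^-1 * y ^+ 2 - 2 * (x * y).
  by field; rewrite gt_eqF.
have := mulr_ge0 x0 y0; lra.
Qed.

Lemma dot_psum a b n (t : R) : 0 < t -> l2 a -> l2 b ->
  \sum_(i < n) cabs (a i * cconj (b i)) <= t * nrm2 a + t^-1 * nrm2 b.
Proof.
move=> t0 la lb; apply: (@le_trans _ _ (t * psum a n + t^-1 * psum b n)).
  rewrite /psum !mulr_sumr -big_split /=; apply: ler_sum => i _.
  by rewrite cabsM cabs_conj weighted_amgm ?cabs_ge0.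
by apply: lerD; rewrite ler_pM2l ?invr_gt0 //; exact: psum_le_nrm2.
Qed.

Lemma dot_cvg a b : l2 a -> l2 b ->
  series (fun n => a n * cconj (b n)) @ \oo --> dot a b.
Proof.
move=> la lb; rewrite dotE.
suff : cvgn (series (fun n => a n * cconj (b n))) by [].
by apply: cabs_series_cvg => n; exact: (dot_psum n ltr01 la lb).
Qed.

Lemma chausdorff : hausdorff_space (C R).
Proof. exact: norm_hausdorff. Qed.

Lemma cvg_eq (u v : nat -> C R) (l : C R) :
  u @ \oo --> l -> (forall n, u n = v n) -> v @ \oo --> l.
Proof. by move=> ul uv; rewrite -(funext uv). Qed.

Lemma dot_unique a b (l : C R) :
  series (fun n => a n * cconj (b n)) @ \oo --> l -> dot a b = l.
Proof. by rewrite dotE => /(cvg_lim chausdorff). Qed.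

(** A substitute for the Cauchy-Schwarz inequality in terms of squared norms: the weight [t] is
    free, and later uses choose it so that both terms are small. *)
Lemma dot_le a b (t : R) : 0 < t -> l2 a -> l2 b ->
  cabs (dot a b) <= t * nrm2 a + t^-1 * nrm2 b.
Proof.
move=> t0 la lb.
have h : (fun n => cabs (series (fun n => a n * cconj (b n)) n)) @ \oo -->
    cabs (dot a b) by exact: ccvg_abs (dot_cvg la lb).
rewrite -(cvg_lim (@norm_hausdorff _ R) h); apply: limr_le.
  by apply/cvg_ex; eexists; exact: h.
apply: nearW => n; apply: le_trans (dot_psum n t0 la lb).
by rewrite /series /= big_mkord; exact: cabs_sum.
Qed.

Lemma dotDl k a b c : l2 a -> l2 b -> l2 c ->
  dot (fun n => k * a n + b n) c = k * dot a c + dot b c.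
Proof.
move=> la lb lc; apply: dot_unique.
refine (cvg_eq (ccvgD (ccvgM (ccvg_cst k) (dot_cvg la lc)) (dot_cvg lb lc)) _).
move=> n; rewrite /series /= mulr_sumr -big_split /=.
by apply: eq_bigr => i _; rewrite mulrDl mulrA.
Qed.

Lemma dotC a b : l2 a -> l2 b -> dot b a = cconj (dot a b).
Proof.
move=> la lb; apply: dot_unique.
refine (cvg_eq (ccvg_conj (dot_cvg la lb)) _).
move=> n; rewrite /series /= cconj_sum.
by apply: eq_bigr => i _; rewrite cconjM cconjK mulrC.
Qed.

Lemma dotDr k a b c : l2 a -> l2 b -> l2 c ->
  dot c (fun n => k * a n + b n) = cconj k * dot c a + dot c b.
Proof.
move=> la lb lc; have [lab _] := l2D (l2Z k la) lb.
by rewrite (dotC lab lc) dotDl // cconjD cconjM -!dotC.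
Qed.

Lemma dot_nrm2 a : l2 a -> dot a a = cofr (nrm2 a).
Proof.
move=> la; apply: dot_unique; refine (cvg_eq (ccvg_cofr (nrm2_cvg la)) _).
move=> n; rewrite /series /= big_mkord /psum cofr_sum.
by apply: eq_bigr => i _; rewrite mul_cconj.
Qed.

Lemma dot0l a : dot (fun=> 0) a = 0.
Proof.
apply: dot_unique; rewrite [X in X @ _ --> _](_ : _ = fun=> 0); first exact: ccvg_cst.
by apply/funext => n; rewrite /series /= big1 // => i _; rewrite mul0r.
Qed.

Lemma nrm2_add k a b : l2 a -> l2 b ->
  nrm2 (fun n => k * a n + b n) =
  cabs k ^+ 2 * nrm2 a + 2 * complex.Re (k * dot a b) + nrm2 b.
Proof.
move=> la lb; have [lab _] := l2D (l2Z k la) lb.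
have := dot_nrm2 lab; rewrite dotDl // !dotDr // (dotC la lb) !dot_nrm2 //.
move=> /(congr1 (fun z : C R => complex.Re z)) /= <-.
rewrite [k * (_ + _)]mulrDr mulrA mul_cconj -cofrM -cconjM.
rewrite !ReD /=; case: (k * dot a b) => x y /=; ring.
Qed.

Lemma nrm2_0 : nrm2 (fun=> 0) = 0.
Proof.
apply: le_anti; rewrite nrm2_ge0 ?andbT; last exact: l2_0.
by apply: nrm2_le => n; rewrite /psum big1 // => i _; rewrite cabs0 expr0n.
Qed.

Lemma dot0r a : l2 a -> dot a (fun=> 0) = 0.
Proof. by move=> la; rewrite (dotC l2_0 la) dot0l cconj0. Qed.

Lemma dotZl k a b : l2 a -> l2 b -> dot (fun n => k * a n) b = k * dot a b.
Proof.
move=> la lb; have := dotDl k la l2_0 lb; rewrite dot0l addr0 => <-.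
by congr dot; apply/funext => n; rewrite addr0.
Qed.

Lemma dotZr k a b : l2 a -> l2 b -> dot a (fun n => k * b n) = cconj k * dot a b.
Proof.
move=> la lb; rewrite (dotC (l2Z k lb) la) (dotZl k lb la) cconjM.
by rewrite -(dotC lb la).
Qed.

Lemma nrm2Z k a : l2 a -> nrm2 (fun n => k * a n) = cabs k ^+ 2 * nrm2 a.
Proof.
move=> la; have := nrm2_add k la l2_0.
rewrite (dot0r la) nrm2_0 mulr0 /= mulr0 !addr0 => <-.
by congr nrm2; apply/funext => n; rewrite addr0.
Qed.

Lemma nrm2_sub0 a b : l2 a -> l2 b -> nrm2 (fun n => a n - b n) <= 0 -> a = b.
Proof.
move=> la lb n0; apply/funext => n; apply/eqP; rewrite -subr_eq0.
have := le_trans (cabs_coord n (l2B la lb)) n0.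
rewrite exprn_even_le0 //= => /eqP h; apply/eqP; exact: cabs0_eq0.
Qed.

End L2.

(** * Completeness and orthogonal projection *)

Section Completeness.
Context {R : realType}.
Implicit Types (a b c x y : nat -> C R) (M e : R) (k : C R).

Lemma ccauchy_cvg (u : nat -> C R) :
  (forall e, 0 < e -> exists K, forall m n, (K <= m)%N -> (K <= n)%N ->
     cabs (u m - u n) <= e) -> exists l : C R, u @ \oo --> l.
Proof.
move=> uC.
have H (p : C R -> R) : (forall z w, `|p z - p w| <= cabs (z - w)) ->
    cvgn (fun n => p (u n)).
  move=> pL; apply/cauchy_cvgP/cauchy_exP => e e0.
  have [K KP] := uC _ (divr_gt0 e0 (ltr0Sn R 1)).
  exists (p (u K)); exists K => // n /= Kn.
  rewrite /ball /=; apply: (le_lt_trans (pL _ _)).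
  apply: (le_lt_trans (KP _ _ (leqnn _) Kn)).
  by rewrite gtr_pMr // invf_lt1 ?ltr1n.
have /cvg_ex[x xP] := H (fun z => complex.Re z)
  (fun z w => ltac:(by rewrite -ReN -ReD cabs_Re)).
have /cvg_ex[y yP] := H (fun z => complex.Im z)
  (fun z w => ltac:(by rewrite -ImN -ImD cabs_Im)).
by exists (x +i* y : C R); apply: ccvg_ReIm.
Qed.

Lemma psum_cvg (u : nat -> nat -> C R) a b n :
  (forall i, (fun m => u m i) @ \oo --> a i) ->
  (fun m => psum (fun i => u m i - b i) n) @ \oo --> psum (fun i => a i - b i) n.
Proof.
move=> ua; elim: n => [|n IH].
  rewrite /psum big_ord0; under eq_fun do rewrite big_ord0.
  exact: cvg_cst.
rewrite /psum big_ord_recr /=; under eq_fun do rewrite big_ord_recr /=.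
apply: cvgD; first exact: IH.
have h : (fun m => cabs (u m n - b n)) @ \oo --> cabs (a n - b n).
  exact: ccvg_abs (ccvgB (ua n) (ccvg_cst (b n))).
exact: (cvgM h h).
Qed.

(** The limit is formed coordinatewise. A Cauchy bound on finite partial sums survives this limit
    and does not depend on their length, so it bounds the full norm. *)
Lemma l2_complete (u : nat -> nat -> C R) :
  (forall m, l2 (u m)) ->
  (forall e, 0 < e -> exists K, forall m n, (K <= m)%N -> (K <= n)%N ->
     nrm2 (fun i => u m i - u n i) <= e) ->
  exists2 a, l2 a & forall e, 0 < e -> exists K, forall m, (K <= m)%N ->
     nrm2 (fun i => a i - u m i) <= e.
Proof.
move=> lu uC.
have cu i : exists l : C R, (fun m => u m i) @ \oo --> l.
  apply: ccauchy_cvg => e e0; have [K KP] := uC _ (exprn_gt0 2 e0).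
  exists K => m n Km Kn; rewrite -(@ler_pXn2r _ 2) ?nnegrE ?cabs_ge0 ?(ltW e0) //.
  by apply: le_trans (KP _ _ Km Kn); apply: (cabs_coord i); exact: l2B.
have [a aP] := boolp.choice cu.
have key e : 0 < e -> exists K, forall m, (K <= m)%N -> forall n,
    psum (fun i => a i - u m i) n <= e.
  move=> /uC[K KP]; exists K => m Km n.
  have h := @psum_cvg u a (u m) n aP.
  rewrite -(cvg_lim (@norm_hausdorff _ R) h); apply: limr_le.
    by apply/cvg_ex; eexists; exact: h.
  exists K => // k /= Kk; apply: le_trans (KP _ _ Kk Km).
  by apply: psum_le_nrm2; exact: l2B.
have la : l2 a.
  have [K KP] := key 1 ltr01.
  have lK : l2 (fun i => a i - u K i) by exists 1 => n; exact: KP.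
  have [+ _] := l2D lK (lu K).
  rewrite (_ : (fun n => _) = a) //; apply/funext => i.
  by rewrite subrK.
exists a => // e /key[K KP]; exists K => m Km.
by apply: nrm2_le; exact: KP.
Qed.

Lemma coord_cvg (u : nat -> nat -> C R) a : (forall m, l2 (u m)) -> l2 a ->
  (forall e, 0 < e -> exists K, forall m, (K <= m)%N ->
     nrm2 (fun i => a i - u m i) <= e) ->
  forall i, (fun m => u m i) @ \oo --> a i.
Proof.
move=> lu la ua i; apply/ccvgP/cvgrPdist_le => e e0.
have [K KP] := ua _ (exprn_gt0 2 e0); exists K => // m /= Km.
rewrite sub0r normrN ger0_norm ?cabs_ge0 //.
rewrite -(@ler_pXn2r _ 2) ?nnegrE ?cabs_ge0 ?(ltW e0) // cabsB.
by apply: le_trans (KP _ Km); apply: (cabs_coord i); exact: l2B.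
Qed.

Definition l2_closed_subspace (M : set (nat -> C R)) :=
  [/\ M `<=` l2, M (fun=> 0),
    forall k a b, M a -> M b -> M (fun n => k * a n + b n) &
    forall a, l2 a -> (forall e, 0 < e -> exists2 b, M b &
      nrm2 (fun n => a n - b n) <= e) -> M a].

Lemma l2_projection (M : set (nat -> C R)) x : l2_closed_subspace M -> l2 x ->
  exists2 y, M y & forall b, M b -> dot (fun n => x n - y n) b = 0.
Proof.
move=> [Ml2 M0 Mlin Mcl] lx.
pose D := [set nrm2 (fun n => x n - b n) | b in M].
have D0 : lbound D 0 by move=> _ [b /Ml2 lb <-]; apply: nrm2_ge0; exact: l2B.
have Dne : D !=set0 by exists (nrm2 (fun n => x n - 0)), (fun=> 0).
have hi : has_inf D by split => //; exists 0.
pose d := inf D.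
have dle b : M b -> d <= nrm2 (fun n => x n - b n).
  by move=> Mb; apply: ge_inf; [exists 0|exists b].
have [u uP] : {u : nat -> nat -> C R & forall m, M (u m) /\
    nrm2 (fun n => x n - u m n) < d + m.+1%:R^-1}.
  apply: (@boolp.choice _ _ (fun m b => M b /\
    nrm2 (fun n => x n - b n) < d + m.+1%:R^-1)) => m.
  have m0 : 0 < (m.+1%:R^-1 : R) by rewrite invr_gt0.
  have [_ [b Mb <-] bd] := inf_adherent m0 hi.
  by exists b.
have lu m : l2 (u m) by apply: Ml2; case: (uP m).
(* The parallelogram law applied to [x - u m] and [x - u n]: the midpoint of [u m] and [u n] lies in
   [M], so its squared distance to [x] is at least [d]. *)
have par m n : nrm2 (fun i => u m i - u n i) <=
    2 * m.+1%:R^-1 + 2 * n.+1%:R^-1.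
  have la := l2B lx (lu m); have lb := l2B lx (lu n).
  have := nrm2_add 1 la lb; have := nrm2_add (-1) la lb.
  rewrite cabsN cabs1 expr1n !mul1r mulN1r ReN.
  have -> : (fun i => -1 * (x i - u m i) + (x i - u n i)) = (fun i => u m i - u n i).
    by apply/funext => i; ring.
  have -> : (fun i => 1 * (x i - u m i) + (x i - u n i)) =
     (fun i => 2 * (x i - (2^-1 * u m i + 2^-1 * u n i))).
    by apply/funext => i; field.
  have Mmid : M (fun i => 2^-1 * u m i + 2^-1 * u n i).
    have Mn : M (fun i => 2^-1 * u n i + 0) by apply: Mlin => //; case: (uP n).
    have [Mm _] := uP m; have := Mlin 2^-1 _ _ Mm Mn.
    by congr M; apply/funext => i; rewrite addr0.
  have -> : nrm2 (fun i => 2 * (x i - (2^-1 * u m i + 2^-1 * u n i))) =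
      4 * nrm2 (fun i => x i - (2^-1 * u m i + 2^-1 * u n i)).
    have lm := l2B lx (Ml2 _ Mmid).
    rewrite (nrm2Z 2 lm).
    have c2 : cabs (2 : C R) ^+ 2 = 4.
      have -> : (2 : C R) = cofr 2 by rewrite /cofr rmorph_nat.
      by rewrite cabs_cofr ger0_norm // expr2 -natrM.
    by rewrite c2.
  have fin (A Mid X Y D' p q d' : R) : A = X + 2 * - D' + Y ->
    4 * Mid = X + 2 * D' + Y -> X < d' + p -> Y < d' + q -> d' <= Mid ->
    A <= 2 * p + 2 * q by lra.
  move=> e1 e2; apply: fin e1 e2 _ _ (dle _ Mmid).
    by case: (uP m).
  by case: (uP n).
have [|y ly yP] := l2_complete lu.
  move=> e e0; exists (Num.bound (4 / e)) => m n Km Kn.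
  have hb (k : nat) : (Num.bound (4 / e) <= k)%N -> 2 * k.+1%:R^-1 <= e / 2.
    move=> Kk; have k0 : (0 : R) < k.+1%:R by [].
    have : 4 / e < k.+1%:R.
      apply: (lt_le_trans (archi_boundP _)); first by rewrite divr_ge0 // ltW.
      by rewrite ler_nat leqW.
    rewrite ltr_pdivrMr // => h4; rewrite ler_pdivrMr // ; lra.
  apply: (le_trans (par m n)).
  by rewrite [leRHS]splitr; apply: lerD; exact: hb.
have My : M y.
  apply: Mcl => // e e0; have [K KP] := yP e e0; exists (u K) => //.
    by case: (uP K).
  exact: KP.
exists y => // b Mb.
have lxy := l2B lx ly; have lb := Ml2 _ Mb.
(* Each finite partial sum passes to the coordinatewise limit, so the limit of the minimizing
   sequence attains the infimum. *)
have yd : nrm2 (fun n => x n - y n) <= d.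
  apply: nrm2_le => n; apply/ler_addgt0Pr => e e0.
  have h := @psum_cvg u y x n (coord_cvg lu ly yP).
  have sym (f g : nat -> C R) : psum (fun i => f i - g i) n = psum (fun i => g i - f i) n.
    by rewrite /psum; apply: eq_bigr => i _; rewrite cabsB.
  rewrite sym -(cvg_lim (@norm_hausdorff _ R) h); apply: limr_le.
    by apply/cvg_ex; eexists; exact: h.
  exists (Num.bound (e^-1)) => // k /= Kk; rewrite sym.
  apply: le_trans (psum_le_nrm2 n (l2B lx (lu k))) _.
  have [_ /ltW/le_trans] := uP k; apply; rewrite lerD2l.
  have k0 : (0 : R) < k.+1%:R by [].
  rewrite -[leRHS]invrK lef_pV2 ?posrE ?invr_gt0 //.
  apply: ltW; apply: (lt_le_trans (archi_boundP _)); first by rewrite invr_ge0 ltW.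
  by rewrite ler_nat leqW.
pose Q := dot (fun n => x n - y n) b.
have Bge : 0 <= nrm2 b := nrm2_ge0 lb.
have B1 : 0 < 1 + nrm2 b by rewrite ltr_pwDl.
(* Moving [y] by [s * Q * b] changes the squared distance by [s ^+ 2 * q ^+ 2 * nrm2 b - 2 * s * q
   ^+ 2], which is at most [- s * q ^+ 2] since [s * nrm2 b <= 1]. Minimality then forces
   [q = 0]. *)
pose s : R := (1 + nrm2 b)^-1.
have s0 : 0 < s by rewrite invr_gt0.
pose k : C R := - cofr s * Q.
have Mk : M (fun n => cofr s * Q * b n + y n) by exact: Mlin.
have := le_trans yd (dle _ Mk).
have -> : (fun n => x n - (cofr s * Q * b n + y n)) =
   (fun n => k * b n + (x n - y n)).
  by apply/funext => n; rewrite /k; ring.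
rewrite nrm2_add // (dotC lxy lb) -/Q /k !mulNr cabsN -mulrA mul_cconj -cofrM.
rewrite cabsM cabs_cofr ger0_norm ?(ltW s0) // ReN /=.
set q := cabs Q.
have sB : s * nrm2 b <= 1.
  by rewrite /s mulrC ler_pdivrMr // mul1r lerDr.
move=> H; apply: cabs0_eq0; apply/eqP; rewrite -sqrf_eq0 -/q.
have q2 := sqr_ge0 q.
have : s * q ^+ 2 <= 0 by nra.
rewrite pmulr_rle0 // => q0; apply/eqP; apply: le_anti; by rewrite q0 q2.
Qed.

End Completeness.

(** * The Hardy space *)

Section Hardy.
Context {R : realType}.
Implicit Types (a b c : nat -> C R) (e : R) (f g : disk R -> C R) (k : C R).
Implicit Types (z : disk R).

Lemma disk_lt1 z : cabs (zcoord z) < 1.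
Proof. by have := valP z; rewrite /= -/(zcoord z) cabsE -cofr_lt. Qed.

Lemma mkdisk_proof (w : C R) : cabs w < 1 -> `|w| < 1.
Proof. by move=> w1; rewrite cabsE -(cofr_lt _ 1) in w1 *. Qed.

Definition mkdisk (w : C R) (w1 : cabs w < 1) : disk R :=
  exist (fun z : C R => is_true (`|z| < 1)) w (mkdisk_proof w1).

Lemma zcoord_mkdisk (w : C R) (w1 : cabs w < 1) : zcoord (mkdisk w1) = w.
Proof. by []. Qed.

Lemma zcoord_inj : injective (@zcoord R).
Proof. exact: val_inj. Qed.

Lemma ext0E f z : ext0 f (zcoord z) = f z.
Proof. by rewrite /ext0 /zcoord valK. Qed.

Lemma ext0_out f (w : C R) : 1 <= cabs w -> ext0 f w = 0.
Proof.
move=> w1; rewrite /ext0 insubF //; apply/negP.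
by rewrite cabsE -[1]/(cofr 1) cofr_lt ltNge w1.
Qed.

Lemma geometric_sum_le (q : R) n : 0 <= q < 1 ->
  \sum_(i < n) q ^+ i <= (1 - q)^-1.
Proof.
move=> /andP[q0 q1]; have q1' : 0 < 1 - q by rewrite subr_gt0.
have -> : \sum_(i < n) q ^+ i = (1 - q ^+ n) / (1 - q).
  elim: n => [|n IH]; first by rewrite big_ord0 expr0 subrr mul0r.
  rewrite big_ord_recr /= IH exprSr; field; by rewrite gt_eqF.
by rewrite ler_pdivrMr // mulVf ?gt_eqF // gerBl exprn_ge0.
Qed.

(** The coefficients of the Szego kernel at [w]: evaluation at [w] is the inner product with it. *)
Definition ker (w : C R) n : C R := cconj w ^+ n.

Lemma l2_ker (w : C R) : cabs w < 1 -> l2 (ker w).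
Proof.
move=> w1; exists (1 - cabs w ^+ 2)^-1 => n; rewrite /psum.
under eq_bigr do rewrite /ker cabsX cabs_conj -exprM mulnC exprM.
by apply: geometric_sum_le; rewrite sqr_ge0 exprn_ilt1 // cabs_ge0.
Qed.

Lemma ker_series a (w : C R) :
  (fun n => a n * w ^+ n) = (fun n => a n * cconj (ker w n)).
Proof. by apply/funext => n; rewrite /ker cconjX cconjK. Qed.

(** Writing the value as an inner product with the kernel gives linearity and continuity in [a] at
    once. *)
Definition Fn : (nat -> C R) -> disk R -> C R :=
  locked (fun a z => dot a (ker (zcoord z))).

Lemma FnE a z : Fn a z = dot a (ker (zcoord z)).
Proof. by rewrite /Fn -lock. Qed.

Definition coef : (disk R -> C R) -> nat -> C R := locked (@taylor_coef R).

Lemma Fn_taylor a : l2 a -> taylor_expansion (Fn a) a.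
Proof.
move=> la z; rewrite (ker_series a (zcoord z)) FnE; apply: dot_cvg => //.
exact: l2_ker (disk_lt1 z).
Qed.

Lemma taylor_expansion_cvg f a (w : C R) : taylor_expansion f a -> cabs w < 1 ->
  series (fun n => a n * w ^+ n) @ \oo --> ext0 f w.
Proof.
by move=> fa w1; rewrite -(zcoord_mkdisk w1) ext0E; exact: fa.
Qed.

(** By strong induction: once the lower coefficients vanish, [cabs (c n) * x ^+ n] is bounded by a
    multiple of [x ^+ n.+1], and [x] tends to 0. Real points are enough for this. *)
Lemma power_series_zero c :
  (forall x : R, 0 < x < 1 ->
    series (fun n => c n * cofr x ^+ n) @ \oo --> (0 : C R)) ->
  forall n, c n = 0.
Proof.
move=> c0; elim/ltn_ind => n IH.
have h01 : (0 : R) < 2^-1 < (1 : R).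
  by apply/andP; split; [rewrite invr_gt0|rewrite invf_lt1 ?ltr1n].
(* The terms of the convergent series at [x = 1/2] are bounded. *)
have [B [B0 Bc]] : exists B : R, 0 < B /\ forall j, cabs (c j) <= B * 2 ^+ j.
  have h0 := cvg_series_cvg_0 (cvgP _ (c0 _ h01)).
  have h : (fun n => cabs (c n * cofr 2^-1 ^+ n)) @ \oo --> cabs (0 : C R).
    exact: ccvg_abs h0.
  have /cvg_seq_bounded[B [_ BP]] : cvgn (fun n => cabs (c n * cofr 2^-1 ^+ n)).
    by apply/cvg_ex; exists (cabs 0).
  exists (`|B| + 1); split; first by rewrite ltr_pwDr.
  move=> j; have Bj : B < `|B| + 1 by rewrite ltr_pwDr // ler_norm.
  have := BP _ Bj j I; rewrite /= ger0_norm ?cabs_ge0 // cabsM cabsX cabs_cofr.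
  by rewrite ger0_norm ?invr_ge0 // exprVn ler_pdivrMr ?exprn_gt0.
apply: cabs0_eq0; apply: le_anti; rewrite cabs_ge0 andbT.
apply/ler_addgt0Pl => e e0; rewrite addr0.
(* The bound [B * 2 ^+ n.+1] on the leading coefficient of the tail is doubled by a geometric series
   of ratio 1/2; the ratio is [2 * x], whence the condition [x <= 4^-1] below. *)
pose K := B * 2 ^+ n.+2.
have K0 : 0 < K by rewrite mulr_gt0 // exprn_gt0.
have [x [x0 x4 xe]] : exists x : R, [/\ 0 < x, x <= 4^-1 & K * x <= e].
  exists (Num.min (4^-1) (e / K)); split.
  - by rewrite lt_min invr_gt0 ltr0n divr_gt0.
  - by rewrite ge_min lexx.
  - by rewrite mulrC -ler_pdivlMr // ge_min lexx orbT.
apply: le_trans xe.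
have x1 : 0 < x < 1.
  by rewrite x0 (le_lt_trans x4) // invf_lt1 ?ltr1n.
have xn0 : 0 < x ^+ n by rewrite exprn_gt0.
have tail N : cabs (c n) * x ^+ n <=
    cabs (series (fun n => c n * cofr x ^+ n) (n.+1 + N)%N) + K * x * x ^+ n.
  have xa : cabs (cofr x : C R) = x by rewrite cabs_cofr gtr0_norm.
  have -> : cabs (c n) * x ^+ n = cabs (c n * cofr x ^+ n).
    by rewrite cabsM cabsX xa.
  have sE : series (fun n => c n * cofr x ^+ n) (n.+1 + N)%N =
      c n * cofr x ^+ n +
      \sum_(i < N) c (n.+1 + i)%N * cofr x ^+ (n.+1 + i).
    rewrite /series /= big_mkord big_split_ord /= big_ord_recr /=.
    by rewrite big1 ?add0r // => i _; rewrite IH ?mul0r.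
  have -> : c n * cofr x ^+ n = series (fun n => c n * cofr x ^+ n) (n.+1 + N)%N +
      - \sum_(i < N) c (n.+1 + i)%N * cofr x ^+ (n.+1 + i) by rewrite sE addrK.
  apply: (le_trans (cabsD _ _)); rewrite lerD2l cabsN.
  apply: (le_trans (cabs_sum _ _ _)).
  apply: (@le_trans _ _ (\sum_(i < N) B * 2 ^+ n.+1 * x ^+ n.+1 * 2^-1 ^+ i)).
    apply: ler_sum => i _; rewrite cabsM cabsX xa !exprD.
    have x2 : x * 2 <= 2^-1 by lra.
    apply: (@le_trans _ _ (B * 2 ^+ (n.+1 + i) * (x ^+ n.+1 * x ^+ i))).
      by rewrite ler_wpM2r // mulr_ge0 // exprn_ge0 // ltW.
    rewrite exprD -!mulrA ler_pM2l // ler_pM2l ?exprn_gt0 //.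
    rewrite mulrCA ler_pM2l ?exprn_gt0 // -exprMn mulrC.
    by rewrite lerXn2r ?nnegrE ?mulr_ge0 ?invr_ge0 // ltW.
  rewrite -mulr_sumr.
  have g : \sum_(i < N) (2^-1 : R) ^+ i <= 2.
    have e2 : (1 - 2^-1 : R)^-1 = 2 by field.
    rewrite -[leRHS]e2.
    by apply: geometric_sum_le; case/andP: h01 => /ltW ->.
  apply: (le_trans (ler_wpM2l _ g)).
    by rewrite !mulr_ge0 ?exprn_ge0 // ltW.
  by rewrite /K !exprS le_eqVlt; apply/orP; left; apply/eqP; ring.
rewrite -(ler_pM2r xn0).
have h : (fun N => cabs (series (fun n => c n * cofr x ^+ n) (n.+1 + N)%N) + K * x * x ^+ n) @ \oo -->
    0 + K * x * x ^+ n.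
  apply: cvgD; last exact: cvg_cst.
  have h1 := c0 _ x1.
  have h2 : (fun N => cabs (series (fun n => c n * cofr x ^+ n) N)) @ \oo --> cabs (0 : C R).
    exact: ccvg_abs h1.
  rewrite cabs0 -(cvg_shiftn n.+1) in h2.
  rewrite (_ : (fun N => _) = [sequence cabs (series (fun n => c n * cofr x ^+ n) (N + n.+1)%N)]_N) //.
  by apply/funext => N; rewrite addnC.
rewrite add0r in h; rewrite -(cvg_lim (@norm_hausdorff _ R) h).
apply: limr_ge; first by apply/cvg_ex; eexists; exact: h.
by apply: nearW.
Qed.

Lemma taylor_unique f a b : taylor_expansion f a -> taylor_expansion f b -> a = b.
Proof.
move=> fa fb; apply/funext => n; apply/eqP; rewrite -subr_eq0; apply/eqP.
apply: (@power_series_zero (fun n => a n - b n)) => x x1.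
have w1 : cabs (cofr x : C R) < 1.
  by rewrite cabs_cofr ger0_norm; case/andP: x1 => // /ltW.
have ha := taylor_expansion_cvg fa w1; have hb := taylor_expansion_cvg fb w1.
rewrite -(subrr (ext0 f (cofr x))).
refine (cvg_eq (ccvgB ha hb) _) => m; rewrite /series /= -sumrB.
by apply: eq_bigr => i _; rewrite mulrBl.
Qed.

Lemma coefE f a : taylor_expansion f a -> coef f = a.
Proof.
move=> fa; rewrite /coef -lock /taylor_coef; case: xgetP => [b _ fb|/(_ a)/(_ fa)//].
exact: taylor_unique fb fa.
Qed.

Lemma H2P f : H2 R f <-> exists2 a, l2 a & f = Fn a.
Proof.
split=> [[a fa ca]|[a la ->]].
  have la : l2 a.
    have /cvg_ex[l h] := ca.
    have h2 : psum a @ \oo --> complex.Re l.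
      rewrite (_ : psum a = (fun n => complex.Re (series (fun n => `|a n| ^+ 2 : C R) n))).
        exact: ccvg_Re.
      apply/funext => n; rewrite /series /= big_mkord Re_sum /psum.
      by apply: eq_bigr => i _; rewrite cabsE -cofrX.
    exists (complex.Re l) => n.
    rewrite -(cvg_lim (@norm_hausdorff _ R) h2).
    apply: nondecreasing_cvgn_le; first exact: psum_nd.
    by apply/cvg_ex; exists (complex.Re l).
  exists a => //; apply/funext => z.
  by rewrite -(cvg_lim chausdorff (fa z)) (cvg_lim chausdorff (@Fn_taylor a la z)).
exists a; first exact: Fn_taylor.
apply/cvg_ex; exists (cofr (nrm2 a)).
refine (cvg_eq (ccvg_cofr (nrm2_cvg la)) _) => n.
rewrite /series /= big_mkord /psum cofr_sum; apply: eq_bigr => i _.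
by rewrite cabsE cofrX.
Qed.

Lemma H2_Fn a : l2 a -> H2 R (Fn a).
Proof. by move=> la; apply/H2P; exists a. Qed.

Lemma coef_Fn a : l2 a -> coef (Fn a) = a.
Proof. by move=> /Fn_taylor/coefE. Qed.

Lemma l2_coef f : H2 R f -> l2 (coef f).
Proof. by move=> /H2P[a la ->]; rewrite coef_Fn. Qed.

Lemma FnK f : H2 R f -> Fn (coef f) = f.
Proof. by move=> /H2P[a la ->]; rewrite coef_Fn. Qed.

Lemma Fn_lin k a b : l2 a -> l2 b ->
  Fn (fun n => k * a n + b n) = (fun z => k * Fn a z + Fn b z).
Proof.
by move=> la lb; apply/funext => z; rewrite !FnE dotDl //; exact: l2_ker (disk_lt1 z).
Qed.

Lemma coef_lin k f g : H2 R f -> H2 R g ->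
  coef (fun z => k * f z + g z) =
  (fun n => k * coef f n + coef g n).
Proof.
move=> /H2P[a la ->] /H2P[b lb ->]; rewrite -Fn_lin // !coef_Fn //.
by have [] := l2D (l2Z k la) lb.
Qed.

Lemma H2_lin k f g : H2 R f -> H2 R g -> H2 R (fun z => k * f z + g z).
Proof.
move=> /H2P[a la ->] /H2P[b lb ->]; rewrite -Fn_lin //.
by apply: H2_Fn; have [] := l2D (l2Z k la) lb.
Qed.

Lemma Fn0 : Fn (fun=> 0) = (fun=> 0).
Proof. by apply/funext => z; rewrite FnE dot0l. Qed.

Lemma H2_0 : H2 R (fun=> 0).
Proof. by rewrite -Fn0; apply: H2_Fn; exact: l2_0. Qed.

Lemma H2Z k f : H2 R f ->
  H2 R (fun z => k * f z) /\ coef (fun z => k * f z) = (fun n => k * coef f n).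
Proof.
move=> hf; have := H2_lin k hf H2_0; have := coef_lin k hf H2_0.
have -> : (fun z => k * f z + 0) = (fun z => k * f z).
  by apply/funext => z; rewrite addr0.
rewrite -{1}Fn0 coef_Fn; last exact: l2_0.
move=> -> ?; split=> //.
by apply/funext => n; rewrite addr0.
Qed.

Lemma subE f g : (fun z => f z - g z) = (fun z => (-1) * g z + f z).
Proof. by apply/funext => z; rewrite mulN1r addrC. Qed.

Lemma H2_sub f g : H2 R f -> H2 R g -> H2 R (fun z => f z - g z).
Proof. by move=> hf hg; rewrite subE; exact: H2_lin. Qed.

Lemma coef_sub f g : H2 R f -> H2 R g ->
  coef (fun z => f z - g z) = (fun n => coef f n - coef g n).
Proof.
move=> hf hg; rewrite subE coef_lin //; apply/funext => n.
by rewrite mulN1r addrC.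
Qed.

Lemma H2dotE f g : H2dot f g = dot (coef f) (coef g).
Proof. by rewrite dotE /coef -lock. Qed.

Definition sqnorm f : R := nrm2 (coef f).

Lemma sqnorm_ge0 f : H2 R f -> 0 <= sqnorm f.
Proof. by move=> /l2_coef/nrm2_ge0. Qed.

Lemma H2norm_lt f e : H2 R f -> 0 < e -> (H2norm f < cofr e) = (sqnorm f < e ^+ 2).
Proof.
move=> hf e0; rewrite /H2norm H2dotE dot_nrm2; last exact: l2_coef.
have n0 : (0 : C R) <= cofr (sqnorm f) by rewrite (_ : 0 = cofr 0) // cofr_le sqnorm_ge0.
have e0' : (0 : C R) <= cofr e by rewrite (_ : 0 = cofr 0) // cofr_le ltW.
rewrite -(@ltr_pXn2r _ 2) ?nnegrE ?sqrtC_ge0 //.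
by rewrite sqrtCK -cofrX cofr_lt.
Qed.

(** This transfers closedness to coefficient sequences, where completeness and projection are
    available. *)
Lemma H2_closed_subspaceP M : H2_closed_subspace M <->
  M `<=` H2 R /\ l2_closed_subspace [set a | l2 a /\ M (Fn a)].
Proof.
split=> [[MH M0 Ml Mc]|[MH [_ [_ M0] Ml Mc]]].
  split=> //; split.
  - by move=> a [].
  - by split; [exact: l2_0|rewrite Fn0].
  - move=> k a b [la Ma] [lb Mb]; have [lab _] := l2D (l2Z k la) lb.
    by split => //; rewrite (Fn_lin k la lb); exact: Ml.
  - move=> a la ac; split=> //; apply: Mc; first exact: H2_Fn.
    move=> e e0.
    have eE : e = cofr (complex.Re e).
      by move: e0; rewrite ltcE => /andP[/eqP]; case: e => x y /= -> _.
    have e0R : 0 < complex.Re e by move: e0; rewrite ltcE => /andP[].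
    set r := complex.Re e in eE e0R; rewrite {}eE.
    (* Halving turns the weak inequality of the sequence version into the strict one required for
       functions. *)
    have [|b [lb Mb] ab] := ac (r ^+ 2 / 2); first by rewrite divr_gt0 ?exprn_gt0.
    exists (Fn b) => //; have hab := H2_sub (H2_Fn la) (H2_Fn lb).
    rewrite (H2norm_lt hab e0R) /sqnorm (coef_sub (H2_Fn la) (H2_Fn lb)) !coef_Fn //.
    apply: (le_lt_trans ab).
    by rewrite gtr_pMr ?exprn_gt0 // invf_lt1 ?ltr1n.
split=> //; first by rewrite -Fn0.
- move=> k f g Mf Mg; have hf := MH _ Mf; have hg := MH _ Mg.
  have Pf : [set a | l2 a /\ M (Fn a)] (coef f).
    by split; [exact: l2_coef|rewrite (FnK hf)].
  have Pg : [set a | l2 a /\ M (Fn a)] (coef g).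
    by split; [exact: l2_coef|rewrite (FnK hg)].
  have [_] := Ml k _ _ Pf Pg.
  rewrite (Fn_lin k (l2_coef hf) (l2_coef hg)).
  rewrite (FnK hf).
  by rewrite (FnK hg).
- move=> f hf fc; have [|_] := Mc _ (l2_coef hf); last by rewrite (FnK hf).
  move=> e e0; have s0 : 0 < Num.sqrt e by rewrite sqrtr_gt0.
  have s0C : (0 : C R) < cofr (Num.sqrt e) by rewrite (_ : 0 = cofr 0) // cofr_lt.
  have [g Mg] := fc _ s0C.
  have hg := MH _ Mg; rewrite (H2norm_lt (H2_sub hf hg) s0).
  rewrite sqr_sqrtr ?(ltW e0) // => h; exists (coef g).
    by split; [exact: l2_coef|rewrite (FnK hg)].
  by rewrite -(coef_sub hf hg) ltW.
Qed.

End Hardy.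

(** * Weighted composition operators, from polynomials to the whole space *)

Section WeightedComposition.
Context {R : realType}.
Implicit Types (a b c : nat -> C R) (e t : R) (f g : disk R -> C R) (k : C R).
Implicit Types (z : disk R).

Definition trunc N a n : C R := if (n < N)%N then a n else 0.

Lemma psum_trunc N a m : psum (trunc N a) m = psum a (minn m N).
Proof.
rewrite /psum (big_ord_widen _ (fun i => cabs (a i) ^+ 2) (geq_minl m N)).
rewrite [RHS]big_mkcond /=; apply: eq_bigr => i _.
rewrite /trunc leq_min ltn_ord /=; case: ifP => // _.
by rewrite cabs0 expr0n.
Qed.

Lemma l2_trunc N a : l2 (trunc N a).
Proof.
exists (psum a N) => m; rewrite psum_trunc; apply: psum_nd; exact: geq_minr.
Qed.

Lemma nrm2_tail N a : l2 a ->
  nrm2 (fun n => a n - trunc N a n) <= nrm2 a - psum a N.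
Proof.
move=> la; apply: nrm2_le => m.
rewrite lerBrDr; apply: le_trans (psum_le_nrm2 (m + N)%N la).
have := psum_trunc N a (m + N); rewrite (minn_idPr (leq_addl m N)) => <-.
apply: (@le_trans _ _ (psum (fun n => a n - trunc N a n) (m + N)
   + psum (trunc N a) (m + N))).
  by rewrite lerD2r; apply: psum_nd; exact: leq_addr.
rewrite /psum -big_split /=; apply: ler_sum => i _.
rewrite /trunc; case: ifP => _; first by rewrite subrr cabs0 expr0n add0r.
by rewrite subr0 cabs0 expr0n addr0.
Qed.

Lemma tail_small a e : l2 a -> 0 < e -> exists K, forall N, (K <= N)%N ->
  nrm2 a - psum a N <= e.
Proof.
move=> la e0; have /cvgrPdist_le/(_ _ e0)[K _ KP] := nrm2_cvg la.
exists K => N KN; have := KP _ KN; rewrite ger0_norm //.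
by rewrite subr_ge0 psum_le_nrm2.
Qed.

Lemma Fn_trunc N a z : Fn (trunc N a) z = \sum_(n < N) a n * zcoord z ^+ n.
Proof.
have h := @Fn_taylor _ _ (l2_trunc N a) z.
rewrite -(cvg_lim chausdorff h); apply: (cvg_lim chausdorff).
rewrite -(cvg_shiftn N); apply: (cvg_eq (u := fun=> \sum_(n < N) a n * zcoord z ^+ n)).
  exact: ccvg_cst.
move=> n /=; rewrite /series /= big_mkord addnC big_split_ord /=.
rewrite [X in _ = _ + X]big1 => [|i _].
  by rewrite addr0; apply: eq_bigr => i _; rewrite /trunc ltn_ord.
by rewrite /trunc ltnNge leq_addr mul0r.
Qed.

Lemma Fn_cvg (u : nat -> nat -> C R) a z : (forall m, l2 (u m)) -> l2 a ->
  (forall e, 0 < e -> exists K, forall m, (K <= m)%N ->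
     nrm2 (fun i => a i - u m i) <= e) ->
  (fun m => Fn (u m) z) @ \oo --> Fn a z.
Proof.
move=> lu la ua; apply/ccvgP/cvgrPdist_le => e e0.
have lk := l2_ker (disk_lt1 z).
set k := nrm2 (ker (zcoord z)).
have k0 : 0 < 1 + k by rewrite ltr_pwDl // nrm2_ge0.
(* With this weight the kernel term of [dot_le] is at most [e / 2]; the tolerance [e / (2 * t)]
   makes the other term as small. *)
pose t := 2 * (1 + k) / e.
have t0 : 0 < t by rewrite divr_gt0 // mulr_gt0.
have et : 0 < e / (2 * t) by rewrite divr_gt0 // mulr_gt0.
have [K KP] := ua _ et; exists K => // m /= Km.
rewrite sub0r normrN ger0_norm ?cabs_ge0 // cabsB.
have -> : Fn a z - Fn (u m) z = dot (fun i => a i - u m i) (ker (zcoord z)).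
  rewrite !FnE addrC -mulN1r -dotDl //; congr dot; apply/funext => i.
  by rewrite mulN1r addrC.
apply: (le_trans (dot_le t0 (l2B la (lu m)) lk)).
rewrite [leRHS]splitr; apply: lerD.
  by have := ler_wpM2l (ltW t0) (KP _ Km); rewrite (_ : t * (e / (2 * t)) = e / 2) //;
    field; rewrite gt_eqF.
rewrite /t invf_div -/k mulrAC ler_pdivrMr ?mulr_gt0 //.
rewrite [e / 2 * _]mulrA divfK // ler_pM2l //.
by rewrite lerDr.
Qed.

Variables (w : disk R -> C R) (psi : disk R -> disk R).

Definition wcomp f z : C R := w z * f (psi z).

Lemma wcomp_lin k f g :
  wcomp (fun z => k * f z + g z) = (fun z => k * wcomp f z + wcomp g z).
Proof. by apply/funext => z; rewrite /wcomp; ring. Qed.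

Lemma wcomp_sub f g :
  wcomp (fun z => f z - g z) = (fun z => wcomp f z - wcomp g z).
Proof. by apply/funext => z; rewrite /wcomp mulrBr. Qed.

Variable B : R.
Hypothesis B0 : 0 <= B.
Hypothesis polB : forall N a, H2 R (wcomp (Fn (trunc N a))) /\
  sqnorm (wcomp (Fn (trunc N a))) <= B * psum a N.

Lemma trunc_sub M N a : (M <= N)%N ->
  (fun n => trunc N a n - trunc M a n) = trunc N (fun n => a n - trunc M a n).
Proof.
move=> MN; apply/funext => n; rewrite /trunc.
case: (ltnP n N) => // nN.
by rewrite ltnNge (leq_trans MN nN) subr0.
Qed.

Lemma wcomp_trunc_cauchy M N a : l2 a -> (M <= N)%N ->
  nrm2 (fun n => coef (wcomp (Fn (trunc N a))) n -
    coef (wcomp (Fn (trunc M a))) n) <= B * (nrm2 a - psum a M).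
Proof.
move=> la MN.
have [hN _] := polB N a; have [hM _] := polB M a.
rewrite -(coef_sub hN hM) -wcomp_sub.
have -> : (fun z => Fn (trunc N a) z - Fn (trunc M a) z) =
    Fn (trunc N (fun n => a n - trunc M a n)).
  rewrite -trunc_sub // (subE (Fn (trunc N a))).
  rewrite -(Fn_lin (-1) (l2_trunc M a) (l2_trunc N a)).
  by congr Fn; apply/funext => n; rewrite mulN1r addrC.
have [_ h] := polB N (fun n => a n - trunc M a n).
apply: (le_trans h); rewrite ler_wpM2l //.
by apply: le_trans (nrm2_tail M la); apply: psum_le_nrm2; apply: l2B => //; exact: l2_trunc.
Qed.

Lemma nrm2_subC a b : nrm2 (fun n => a n - b n) = nrm2 (fun n => b n - a n).
Proof.
rewrite !nrm2E; congr (limn (series _)); apply/funext => n.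
by rewrite cabsB.
Qed.

(** By [polB] the images of the truncations form a Cauchy sequence. Its limit is [wcomp f] because
    evaluation at each point is continuous, both before and after applying the operator. *)
Lemma wcomp_bound f : H2 R f -> H2 R (wcomp f) /\ sqnorm (wcomp f) <= B * sqnorm f.
Proof.
move=> /H2P[a la ->].
pose u m := coef (wcomp (Fn (trunc m a))).
have lu m : l2 (u m) by apply: l2_coef; case: (polB m a).
have [|y ly yP] := l2_complete lu.
  move=> e e0; have B1 : 0 < 1 + B by rewrite ltr_pwDl.
  have [K KP] := tail_small la (divr_gt0 e0 B1).
  have H M N : (K <= M)%N -> (M <= N)%N -> nrm2 (fun i => u N i - u M i) <= e.
    move=> KM MN; apply: (le_trans (wcomp_trunc_cauchy la MN)).
    have := KP _ KM; rewrite ler_pdivlMr // mulrC; apply: le_trans.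
    by rewrite ler_wpM2r ?lerDr // subr_ge0 psum_le_nrm2.
  exists K => m n Km Kn; have [mn|/ltnW nm] := leqP m n.
    by rewrite nrm2_subC; exact: H.
  exact: H.
have yE : wcomp (Fn a) = Fn y.
  apply/funext => z.
  have h1 : (fun m => Fn (u m) z) @ \oo --> Fn y z by exact: Fn_cvg.
  have h2 : (fun m => wcomp (Fn (trunc m a)) z) @ \oo --> wcomp (Fn a) z.
    have h3 : (fun m => Fn (trunc m a) (psi z)) @ \oo --> Fn a (psi z).
      apply: (@Fn_cvg (fun m => trunc m a) a (psi z) _ la) => [m|e e0].
        exact: l2_trunc.
      have [K KP] := tail_small la e0; exists K => m Km.
      exact: le_trans (nrm2_tail m la) (KP _ Km).
    exact: ccvgM (ccvg_cst (w z)) h3.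
  have E : (fun m => Fn (u m) z) = (fun m => wcomp (Fn (trunc m a)) z).
    by apply/funext => m; rewrite /u FnK //; case: (polB m a).
  rewrite E in h1.
  by rewrite -(cvg_lim chausdorff h2) (cvg_lim chausdorff h1).
rewrite yE; split; first exact: H2_Fn.
rewrite /sqnorm !coef_Fn //; apply: nrm2_le => n.
have cu := coord_cvg lu ly yP.
have h : (fun m => psum (fun i => u m i - 0) n) @ \oo --> psum (fun i => y i - 0) n.
  exact: psum_cvg.
have s0 (b : nat -> C R) : (fun i => b i - 0) = b.
  by apply/funext => i; rewrite subr0.
rewrite s0 in h.
rewrite -(cvg_lim (@norm_hausdorff _ R) h); apply: limr_le.
  by apply/cvg_ex; eexists; exact: h.
apply: nearW => m; rewrite s0.
apply: (le_trans (psum_le_nrm2 n (lu m))).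
have [_ hm] := polB m a; apply: (le_trans hm).
by rewrite ler_wpM2l //; exact: psum_le_nrm2.
Qed.

(** Unlike the factor 2 of [nrm2B], the factor of [nrm2 b] can be brought as close to 1 as desired,
    at the expense of the difference term. *)
Lemma nrm2_perturb a b t : 0 < t -> l2 a -> l2 b ->
  nrm2 a <= (1 + 2 * t) * nrm2 b + (1 + 2 * t^-1) * nrm2 (fun n => b n - a n).
Proof.
move=> t0 la lb; have lba := l2B lb la.
have ti : 0 < t^-1 by rewrite invr_gt0.
apply: nrm2_le => n.
apply: (@le_trans _ _ ((1 + 2 * t) * psum b n + (1 + 2 * t^-1) * psum (fun n => b n - a n) n)).
  rewrite /psum !mulr_sumr -big_split /=; apply: ler_sum => i _.
  set x := b i; set y := x - a i.
  have -> : cabs (a i) = cabs (x - y) by rewrite /y opprB addrC subrK.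
  have xy : cabs (x - y) <= cabs x + cabs y.
    by rewrite -(cabsN y); exact: cabsD.
  have := weighted_amgm t0 (cabs_ge0 x) (cabs_ge0 y).
  move=> am; have xy0 : 0 <= cabs (x - y) by exact: cabs_ge0.
  apply: (@le_trans _ _ ((cabs x + cabs y) ^+ 2)).
    by rewrite ler_pXn2r ?nnegrE ?addr_ge0 ?cabs_ge0.
  rewrite sqrrD; move: am.
  move: (cabs x * cabs y) (t^-1) (cabs x ^+ 2) (cabs y ^+ 2) => p ti' X Y am.
  have -> : (1 + 2 * t) * X + (1 + 2 * ti') * Y = X + Y + 2 * (t * X + ti' * Y).
    by ring.
  by rewrite addrAC lerD2l -mulr_natl ler_pM2l.
by apply: lerD; rewrite ler_pM2l ?addr_gt0 ?mulr_gt0 //; exact: psum_le_nrm2.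
Qed.

(** To keep the constant 1, the truncation error is made small for a fixed [t], and only afterwards
    does [t] tend to 0. *)
Lemma wcomp_lower f :
  (forall N a, psum a N <= sqnorm (wcomp (Fn (trunc N a)))) ->
  H2 R f -> sqnorm f <= sqnorm (wcomp f).
Proof.
move=> polL hf; have [hTf _] := wcomp_bound hf; move: hTf.
move/H2P: hf => [a la ->] hTf.
rewrite [leLHS]/sqnorm coef_Fn //.
have lT := l2_coef hTf.
have n0 := sqnorm_ge0 hTf.
suff H t : 0 < t -> nrm2 a <= (1 + 2 * t) * sqnorm (wcomp (Fn a)).
  apply/ler_addgt0Pr => e e0.
  pose t := e / (2 * (1 + sqnorm (wcomp (Fn a)))).
  have n1 : 0 < 1 + sqnorm (wcomp (Fn a)) by rewrite ltr_pwDl.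
  have t0 : 0 < t by rewrite divr_gt0 // mulr_gt0.
  apply: (le_trans (H t t0)); rewrite mulrDl mul1r lerD2l /t.
  rewrite (_ : 2 * (e / (2 * (1 + sqnorm (wcomp (Fn a))))) =
    e / (1 + sqnorm (wcomp (Fn a)))); last by field; rewrite gt_eqF.
  by rewrite mulrAC ler_pdivrMr // ler_pM2l // lerDr.
move=> t0; apply/ler_addgt0Pr => e e0.
have ti : 0 < t^-1 by rewrite invr_gt0.
(* The tail of [a] enters twice: through its image, with factor [(1 + 2 * t^-1) * B], and once more
   when [nrm2 a] is replaced by [psum a K]. *)
pose D := (1 + 2 * t^-1) * B + 1.
have D0 : 0 < D by rewrite ltr_pwDr // mulr_ge0 // addr_ge0 // mulr_ge0 // ltW.
have [K KP] := tail_small la (divr_gt0 e0 D0).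
have tK := KP _ (leqnn K).
have [hK _] := polB K a.
have := nrm2_perturb t0 (l2_coef hK) lT.
rewrite -(coef_sub hTf hK) -wcomp_sub => P.
have hD : H2 R (fun z => Fn a z - Fn (trunc K a) z).
  by apply: H2_sub; apply: H2_Fn => //; exact: l2_trunc.
have [_ bD] := wcomp_bound hD.
have cD : sqnorm (fun z => Fn a z - Fn (trunc K a) z) <= nrm2 a - psum a K.
  rewrite /sqnorm (coef_sub (H2_Fn la) (H2_Fn (l2_trunc K a))) !coef_Fn //.
    exact: nrm2_tail.
  exact: l2_trunc.
have q := polL K a.
have tail0 : 0 <= nrm2 a - psum a K by rewrite subr_ge0 psum_le_nrm2.
rewrite -/(sqnorm _) -/(sqnorm _) in P.
have bD2 : sqnorm (wcomp (fun z => Fn a z - Fn (trunc K a) z)) <=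
    B * (nrm2 a - psum a K) by apply: (le_trans bD); rewrite ler_wpM2l.
have DK : D * (nrm2 a - psum a K) <= e by rewrite mulrC -ler_pdivlMr.
move: P bD2 DK q; rewrite /D -/(sqnorm _).
move: (sqnorm (wcomp (fun z => _))) (sqnorm (wcomp (Fn (trunc K a)))) => p1 p2.
have T1 : 0 <= 1 + 2 * t^-1 by rewrite addr_ge0 // mulr_ge0 // ltW.
move: (1 + 2 * t^-1) T1 (sqnorm _) => T T1 p3 P bD2 DK q.
have := ler_wpM2l T1 bD2.
lra.
Qed.

End WeightedComposition.

(** * Circle means of holomorphic functions *)

Section HolomorphicHardy.
Context {R : realType}.
Implicit Types (a b c : nat -> C R) (e t r : R) (f g : disk R -> C R) (k : C R).
Implicit Types (z : disk R).

Lemma holomorphicP f :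
  holomorphic f <-> forall w, cabs w < 1 -> cdif (ext0 f) w.
Proof.
split=> [hf w w1|hf z].
  by rewrite -(zcoord_mkdisk w1); apply: derivable_cdif; exact: hf.
by apply: cdif_derivable; apply: hf; exact: disk_lt1.
Qed.

Lemma holomorphic_taylor f : holomorphic f ->
  taylor_expansion f (fun n => tcoef (ext0 f) (Posz n)).
Proof.
move=> /holomorphicP hf z; rewrite -(ext0E f z).
by apply: taylor_hol => //; exact: disk_lt1.
Qed.

Lemma Posz_inj : injective Posz.
Proof. by move=> x y []. Qed.

(** Radii tending to 1; the offset 2 keeps the first of them positive. *)
Definition rad (n : nat) : R := 1 - (n.+2%:R)^-1.

Lemma rad01 n : 0 < rad n < 1.
Proof.
by rewrite /rad subr_gt0 invf_lt1 ?ltr1n //= gtrBl invr_gt0.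
Qed.

Lemma rad_cvg : rad @ \oo --> (1 : R).
Proof.
have h : (fun n => n.+2%:R^-1 : R) @ \oo --> (0 : R).
  by have := @cvg_harmonic R; rewrite -cvg_shiftS.
by rewrite -[X in _ --> X](subr0 1); apply: cvgB; [exact: cvg_cst|exact: h].
Qed.

Lemma radX_cvg i : (fun n => rad n ^+ i) @ \oo --> (1 : R).
Proof.
elim: i => [|i IH].
  rewrite (_ : (fun _ => _) = fun=> 1); first exact: cvg_cst.
  by apply/funext => n; rewrite expr0.
rewrite (_ : (fun _ => _) = fun n => rad n * rad n ^+ i); last first.
  by apply/funext => n; rewrite exprS.
by rewrite -[X in _ --> X](mulr1 1); apply: cvgM; [exact: rad_cvg|exact: IH].
Qed.

Lemma sum_pow_le1 (u : nat -> R) n (M : R) :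
  (forall r, 0 < r < 1 -> \sum_(i < n) r ^+ i * u i <= M) ->
  \sum_(i < n) u i <= M.
Proof.
move=> uM.
have h : (fun m => \sum_(i < n) rad m ^+ i * u i) @ \oo --> \sum_(i < n) u i.
  elim: n {uM} => [|n IH].
    rewrite big_ord0 (_ : (fun _ => _) = fun=> 0); first exact: cvg_cst.
    by apply/funext => m; rewrite big_ord0.
  rewrite big_ord_recr /= (_ : (fun _ => _) = fun m =>
    (\sum_(i < n) rad m ^+ i * u i) + rad m ^+ n * u n); last first.
    by apply/funext => m; rewrite big_ord_recr.
  have h2 : (fun m => rad m ^+ n * u n) @ \oo --> 1 * u n.
    by apply: cvgM; [exact: radX_cvg|exact: cvg_cst].
  by rewrite mul1r in h2; exact: (cvgD IH h2).
rewrite -(cvg_lim (@norm_hausdorff _ R) h); apply: limr_le.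
  by apply/cvg_ex; exists (\sum_(i < n) u i).
by apply: nearW => m; apply: uM; exact: rad01.
Qed.

Lemma hol_H2 f (M : R) : holomorphic f ->
  (forall r, 0 < r < 1 -> msq (circ (ext0 f) r) <= M) ->
  H2 R f /\ sqnorm f <= M.
Proof.
move=> hf fM; have ft := holomorphic_taylor hf.
set a := (fun n => tcoef (ext0 f) (Posz n)) in ft.
have aM n : psum a n <= M.
  apply: (@sum_pow_le1 (fun i => cabs (a i) ^+ 2)) => s /andP[s0 s1].
  (* The radius is the square root of [s], so that squaring the coefficients produces the weights
     [s ^+ i]. *)
  have q0 : 0 < Num.sqrt s by rewrite sqrtr_gt0.
  have q1 : Num.sqrt s < 1.
    by rewrite -[ltRHS]sqrtr1 ltr_sqrt.
  have q01 : 0 < Num.sqrt s < 1 by rewrite q0.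
  apply: le_trans (fM _ q01).
  have hF := (holomorphicP f).1 hf.
  have gc : gcont (circ (ext0 f) (Num.sqrt s)).
    by apply: gcont_circF => //; rewrite (ltW q0).
  apply: le_trans (bessel n gc Posz_inj); apply: ler_sum => i _.
  rewrite hat_tcoefn // -/(a i) cabsM cabs_cofr ger0_norm ?exprn_ge0 ?(ltW q0) //.
  rewrite [(_ * cabs (a i)) ^+ 2]exprMn.
  have -> : (Num.sqrt s ^+ i) ^+ 2 = s ^+ i.
    by rewrite -exprM mulnC exprM sqr_sqrtr // ltW.
  exact: lexx.
have la : l2 a by exists M.
have fE : f = Fn a.
  apply/funext => z.
  by rewrite -(cvg_lim chausdorff (ft z)) (cvg_lim chausdorff (@Fn_taylor _ a la z)).
by rewrite fE; split; [exact: H2_Fn|rewrite /sqnorm coef_Fn //; exact: nrm2_le].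
Qed.

Lemma ker_nrm2_le (w : C R) r : cabs w = r -> r < 1 ->
  nrm2 (ker w) <= (1 - r ^+ 2)^-1.
Proof.
move=> wr r1; have r0 : 0 <= r by rewrite -wr cabs_ge0.
apply: nrm2_le => n; rewrite /psum.
under eq_bigr do rewrite /ker cabsX cabs_conj wr -exprM mulnC exprM.
by apply: geometric_sum_le; rewrite sqr_ge0 exprn_ilt1.
Qed.

Lemma hat_residE (h : R -> C R) n t :
  resid h Posz n t = h t - \sum_(i < n) fourier h (Posz i) * cis (i%:R * t).
Proof.
elim: n => [|n IH]; first by rewrite /= big_ord0 subr0.
by rewrite /= IH big_ord_recr /= mulNr opprD addrA -pmulrn.
Qed.

(** In Bessel's identity the residual of the first [N] frequencies is the Taylor tail. It is
    uniformly small on the circle because the kernels at points of modulus [r] have bounded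
    norms. *)
Lemma msq_circ_le f r : holomorphic f -> H2 R f -> 0 < r < 1 ->
  msq (circ (ext0 f) r) <= sqnorm f.
Proof.
move=> hf Hf r01; have /andP[r0 r1] := r01.
have ft := holomorphic_taylor hf.
set a := (fun n => tcoef (ext0 f) (Posz n)) in ft.
have aE : coef f = a by exact: coefE.
have la : l2 a by rewrite -aE; exact: l2_coef.
have hF := (holomorphicP f).1 hf.
have gc : gcont (circ (ext0 f) r) by apply: gcont_circF => //; rewrite (ltW r0).
rewrite /sqnorm aE; apply/ler_addgt0Pr => e e0.
(* The squared norm of the kernel at any point of the circle is at most [k]. *)
pose k := (1 - r ^+ 2)^-1.
have k0 : 0 < k by rewrite invr_gt0 subr_gt0 exprn_ilt1 // ltW.
have [d d0 de] : exists2 d : R, 0 < d & d ^+ 2 <= e.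
  by exists (Num.sqrt e); rewrite ?sqrtr_gt0 // sqr_sqrtr // ltW.
pose t := 2 * k / d.
have t0 : 0 < t by rewrite divr_gt0 // mulr_gt0.
have dt : 0 < d / (2 * t) by rewrite divr_gt0 // mulr_gt0.
have [N NP] := tail_small la dt; have tN := NP _ (leqnn N).
rewrite (bessel_eq N gc Posz_inj); apply: lerD.
  apply: le_trans (psum_le_nrm2 N la); apply: ler_sum => i _.
  rewrite hat_tcoefn // -/(a i) cabsM cabs_cofr ger0_norm ?exprn_ge0 ?(ltW r0) //.
  by rewrite exprMn -exprM ler_piMl ?sqr_ge0 // exprn_ile1 ?(ltW r0) ?(ltW r1).
apply: le_trans de; rewrite -[d ^+ 2](_ : msq (fun=> cofr d) = _); last first.
  by rewrite msq_cst cabs_cofr real_normK // num_real.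
apply: le_msq => [||s].
- exact: gcont_resid.
- exact: gcont_cst.
rewrite cabs_cofr (ger0_norm (ltW d0)) hat_residE.
set w := cofr r * cis s.
have wr : cabs w = r by rewrite cabs_polar // ltW.
have w1 : cabs w < 1 by rewrite wr.
pose z := mkdisk w1.
have -> : circ (ext0 f) r s = Fn a z.
  rewrite /circ -/w -(zcoord_mkdisk w1) ext0E -aE FnK //.
have -> : \sum_(i < N) fourier (circ (ext0 f) r) (Posz i) * cis (i%:R * s) =
    Fn (trunc N a) z.
  rewrite Fn_trunc; apply: eq_bigr => i _; rewrite hat_tcoefn // -/(a i).
  by rewrite zcoord_mkdisk /w exprMn cofrX cisMn [_ * a i]mulrC mulrA.
have -> : Fn a z - Fn (trunc N a) z = dot (fun i => a i - trunc N a i) (ker w).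
  rewrite !FnE zcoord_mkdisk addrC -mulN1r -dotDl //; try exact: l2_trunc.
    by congr dot; apply/funext => i; rewrite mulN1r addrC.
  exact: l2_ker.
apply: (le_trans (dot_le t0 (l2B la (l2_trunc N a)) (l2_ker w1))).
rewrite [leRHS]splitr; apply: lerD.
  have h := le_trans (nrm2_tail N la) tN.
  have := ler_wpM2l (ltW t0) h; rewrite (_ : t * (d / (2 * t)) = d / 2) //.
  by field; rewrite gt_eqF.
have kk := ker_nrm2_le wr r1; rewrite -/k in kk.
apply: (@le_trans _ _ (t^-1 * k)); first by rewrite ler_pM2l // invr_gt0.
rewrite /t (_ : (2 * k / d)^-1 * k = d / 2) //.
by field; rewrite !gt_eqF.
Qed.

Lemma trig_hat (c : nat -> C R) N m : (N <= m)%N ->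
  gcont (fun t => \sum_(n < N) c n * cis (n%:~R * t)) /\
  fourier (fun t => \sum_(n < N) c n * cis (n%:~R * t)) (Posz m) = 0.
Proof.
elim: N => [|N IH] Nm.
  have -> : (fun t => \sum_(n < 0) c n * cis (n%:~R * t)) = fun=> 0.
    by apply/funext => t; rewrite big_ord0.
  split; first exact: gcont_cst.
  rewrite /fourier (eq_mean (g := fun=> 0)) ?mean_cst //.
  by move=> t; rewrite mul0r.
have [gN hN] := IH (ltnW Nm).
have -> : (fun t => \sum_(n < N.+1) c n * cis (n%:~R * t)) =
   (fun t => (\sum_(n < N) c n * cis (n%:~R * t)) + c N * cis (N%:~R * t)).
  by apply/funext => t; rewrite big_ord_recr.
split; first exact: (gcontD gN (gcontM (@gcont_cst _ (c N)) (@gcont_cis _ _))).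
rewrite (fourierD _ _ gN (@gcont_cis _ _)) hN hat_cis.
by rewrite [Posz N == _]ltn_eqF // mulr0 addr0.
Qed.

Lemma trig_parseval (c : nat -> C R) N :
  msq (fun t => \sum_(n < N) c n * cis (n%:~R * t)) = psum c N.
Proof.
elim: N => [|N IH].
  rewrite /psum big_ord0 (_ : (fun _ => _) = fun=> 0).
    by rewrite msq_cst cabs0 expr0n.
  by apply/funext => t; rewrite big_ord0.
have [gN hN] := trig_hat c (leqnn N).
have -> : (fun t => \sum_(n < N.+1) c n * cis (n%:~R * t)) =
   (fun t => (\sum_(n < N) c n * cis (n%:~R * t)) + c N * cis (N%:~R * t)).
  by apply/funext => t; rewrite big_ord_recr.
rewrite (msq_add _ _ gN) hN mulr0 /= mulr0 addr0 IH.
by rewrite /psum big_ord_recr.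
Qed.

(** Defined on all of [C R] rather than on [disk R], since it is also evaluated on the unit
    circle. *)
Definition polc N a (w : C R) : C R := \sum_(n < N) a n * w ^+ n.

Lemma cdif_polc N a w : cdif (polc N a) w.
Proof.
elim: N => [|N IH].
  have -> : polc 0 a = fun=> 0 by apply/funext => v; rewrite /polc big_ord0.
  exact: cdif_cst.
have -> : polc N.+1 a = fun v => polc N a v + a N * v ^+ N.
  by apply/funext => v; rewrite /polc big_ord_recr.
exact: (cdifD IH (cdifM (cdif_cst (a N) w) (cdifX N (cdif_id w)))).
Qed.

Lemma circ_polc N a r t : circ (polc N a) r t =
  \sum_(n < N) (cofr (r ^+ n) * a n) * cis (n%:~R * t).
Proof.
rewrite /circ /polc; apply: eq_bigr => i _.
by rewrite exprMn cofrX -pmulrn cisMn mulrA [a i * _]mulrC.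
Qed.

Lemma msq_polc N a r : 0 <= r <= 1 -> msq (circ (polc N a) r) <= psum a N.
Proof.
move=> /andP[r0 r1].
have -> : circ (polc N a) r = _ := funext (circ_polc N a r).
rewrite (_ : msq _ = psum (fun n => cofr (r ^+ n) * a n) N);
  last exact: trig_parseval.
apply: ler_sum => i _.
rewrite cabsM cabs_cofr ger0_norm ?exprn_ge0 // exprMn -exprM.
by rewrite ler_piMl ?sqr_ge0 // exprn_ile1.
Qed.

Lemma msq_polc1 N a : msq (circ (polc N a) 1) = psum a N.
Proof.
have -> : circ (polc N a) 1 = _ := funext (circ_polc N a 1).
rewrite (_ : msq _ = psum (fun n => cofr (1 ^+ n) * a n) N);
  last exact: trig_parseval.
apply: eq_bigr => i _.
by rewrite expr1n mul1r.
Qed.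

Lemma gcont_polc N a r : gcont (circ (polc N a) r).
Proof.
have -> : circ (polc N a) r = _ := funext (circ_polc N a r).
by have [] := trig_hat (fun n => cofr (r ^+ n) * a n) (leqnn N).
Qed.

End HolomorphicHardy.

(** * Multiplication by inner functions *)

Section Inner.
Context {R : realType}.
Notation mu := (@lebesgue_measure R).
Implicit Types (a b c : nat -> C R) (e t r : R) (f g : disk R -> C R) (k : C R).
Implicit Types (z : disk R).

Lemma ext0M f (p : C R -> C R) (w : C R) : cabs w < 1 ->
  ext0 (fun z => f z * p (zcoord z)) w = ext0 f w * p w.
Proof. by move=> w1; rewrite -(zcoord_mkdisk w1) !ext0E. Qed.

Lemma near_disk (w : C R) (P : C R -> Prop) : cabs w < 1 ->
  (forall v, cabs v < 1 -> P v) -> \forall v \near w, P v.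
Proof.
move=> w1 Pv; apply/near_cabsP; exists (1 - cabs w); first by rewrite subr_gt0.
move=> v vw; apply: Pv; have -> : v = (v - w) + w by rewrite subrK.
by apply: (le_lt_trans (cabsD _ _)); rewrite -ltrBrDr.
Qed.

Lemma holomorphic_mul_cdif f (p : C R -> C R) : holomorphic f ->
  (forall w, cdif p w) -> holomorphic (fun z => f z * p (zcoord z)).
Proof.
move=> /holomorphicP hf hp; apply/holomorphicP => w w1.
apply: cdif_near (cdifM (hf _ w1) (hp w)).
by apply: (near_disk w1) => v v1; rewrite ext0M.
Qed.

Lemma circM f (p : C R -> C R) r t : 0 <= r < 1 ->
  circ (ext0 (fun z => f z * p (zcoord z))) r t = circ (ext0 f) r t * circ p r t.
Proof.
by move=> /andP[r0 r1]; rewrite /circ ext0M // cabs_polar.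
Qed.

Variables (theta : disk R -> C R) (M : R).
Hypotheses (theta_hol : holomorphic theta).
Hypothesis theta_bd : forall z, cabs (theta z) <= M.

Let M0 : 0 <= M.
Proof. by apply: le_trans (theta_bd (disk0 R)); exact: cabs_ge0. Qed.

Lemma cabs_ext0_le (w : C R) : cabs (ext0 theta w) <= M.
Proof.
have [w1|w1] := ltP (cabs w) 1; first by rewrite -(zcoord_mkdisk w1) ext0E.
by rewrite ext0_out // cabs0.
Qed.

Lemma wcomp_trunc N a : wcomp theta id (Fn (trunc N a)) =
  (fun z => theta z * polc N a (zcoord z)).
Proof. by apply/funext => z; rewrite /wcomp Fn_trunc. Qed.

Lemma mul_pol_bound N a : H2 R (wcomp theta id (Fn (trunc N a))) /\
  sqnorm (wcomp theta id (Fn (trunc N a))) <= M ^+ 2 * psum a N.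
Proof.
rewrite wcomp_trunc.
have hh := holomorphic_mul_cdif theta_hol (@cdif_polc _ N a).
apply: hol_H2 => // r /andP[r0 r1].
have gp := @gcont_polc _ N a r.
apply: (@le_trans _ _ (msq (fun t => cofr M * circ (polc N a) r t))).
  apply: le_msq => [||t].
  - by apply: gcont_circF; [exact/holomorphicP|rewrite (ltW r0)].
  - exact: (gcontM (@gcont_cst _ (cofr M)) gp).
  rewrite circM ?(ltW r0) // !cabsM cabs_cofr (ger0_norm M0).
  by rewrite ler_wpM2r ?cabs_ge0 //; exact: cabs_ext0_le.
rewrite (msqZ _ gp) cabs_cofr (ger0_norm M0) ler_wpM2l ?sqr_ge0 //.
by apply: msq_polc; rewrite (ltW r0) (ltW r1).
Qed.

Lemma mul_bound f : H2 R f -> H2 R (fun z => theta z * f z) /\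
  sqnorm (fun z => theta z * f z) <= M ^+ 2 * sqnorm f.
Proof. exact: (wcomp_bound (sqr_ge0 M) mul_pol_bound). Qed.

Hypothesis theta_lim : {ae mu, forall t : R, t \in `[0, 2 * pi] ->
        exists2 l : C R,
          (fun r : R => ext0 theta ((r%:C : C R) * (cos t +i* sin t))) @ 1^'- --> l
        & `|l| = 1}.

Lemma rad_at_left : (@rad R) @ \oo --> (1 : R)^'-.
Proof.
move=> P; rewrite /at_left /within /= => /nbhs_normP[d /= d0 dP].
have /cvgrPdist_lt/(_ _ d0)[K _ KP] := @rad_cvg R.
exists K => // n /= Kn; apply: dP; last by have /andP[] := @rad01 R n.
exact: KP.
Qed.

Lemma cabs_polc_le N a (w : C R) : cabs w <= 1 ->
  cabs (polc N a w) <= \sum_(i < N) cabs (a i).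
Proof.
move=> w1; apply: (le_trans (cabs_sum _ _ _)); apply: ler_sum => i _.
by rewrite cabsM cabsX ler_piMr ?cabs_ge0 // exprn_ile1 ?cabs_ge0.
Qed.

Lemma gcont_abs2_ccont (h : R -> C R) : gcont h ->
  ccont 0 (@tau R) (fun t => cabs (h t) ^+ 2).
Proof. by move=> gh t _; exact: gcont_abs2. Qed.

Lemma msq_radial_lim N a :
  (fun n => msq (circ (ext0 (fun z => theta z * polc N a (zcoord z))) (rad n)))
    @ \oo --> msq (circ (polc N a) 1).
Proof.
set f0 := fun z => _.
have hh : holomorphic f0 := holomorphic_mul_cdif theta_hol (@cdif_polc _ N a).
have gn n : gcont (circ (ext0 f0) (rad n)).
  have /andP[r0 r1] := @rad01 R n.
  by apply: gcont_circF; [exact/holomorphicP|rewrite (ltW r0)].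
have g1 := @gcont_polc _ N a 1.
(* The dominating constant: [theta] is bounded by [M], and the polynomial by the sum of the moduli
   of its coefficients on the closed disk. *)
pose K := (M * \sum_(i < N) cabs (a i)) ^+ 2.
have inn n := ccont_integrable (gcont_abs2_ccont (gn n)).
have in1 := ccont_integrable (gcont_abs2_ccont g1).
have inK : mu.-integrable `[0, @tau R] (EFin \o (fun=> K)).
  by apply: ccont_integrable => t _; exact: cvg_cst.
pose F_ n t : \bar R := (cabs (circ (ext0 f0) (rad n) t) ^+ 2)%:E.
pose F t : \bar R := (cabs (circ (polc N a) 1 t) ^+ 2)%:E.
have Flim : {ae mu, forall t, `[0, @tau R]%classic t -> F_ ^~ t @ \oo --> F t}.
  (* The null set of [theta_lim] serves here too: outside it the radial limit [l] of [theta] has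
     modulus 1 and disappears from the limiting modulus. *)
  case: theta_lim => A [mA A0 subA]; exists A; split => //.
  apply: subset_trans subA; apply: subsetC => t Ht tI.
  have [l thl l1] := Ht tI.
  apply: cvg_EFin; first by apply: nearW.
  have c1 : (fun n => ext0 theta (cofr (rad n) * cis t)) @ \oo --> l.
    exact: (cvg_comp _ _ rad_at_left thl).
  have c2 : (fun n => circ (polc N a) (rad n) t) @ \oo --> circ (polc N a) 1 t.
    have cp := cdif_continuous (@cdif_polc R N a (cofr 1 * cis t)).
    have cr : (fun n => cofr (rad n) * cis t) @ \oo --> (cofr 1 * cis t : C R).
      exact: ccvgM (ccvg_cofr (@rad_cvg R)) (ccvg_cst (cis t)).
    exact: (cvg_comp _ _ cr cp).
  have c3 : (fun n => circ (ext0 f0) (rad n) t) @ \oo --> l * circ (polc N a) 1 t.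
    refine (cvg_eq (ccvgM c1 c2) _) => n.
    by rewrite circM //; have /andP[/ltW -> ->] := @rad01 R n.
  have c4 : (fun n => cabs (circ (ext0 f0) (rad n) t)) @ \oo -->
      cabs (l * circ (polc N a) 1 t) by exact: ccvg_abs c3.
  have l1' : cabs l = 1 by apply: cofr_inj; rewrite -cabsE l1.
  rewrite cabsM l1' mul1r in c4.
  exact: (cvgM c4 c4).
have Fdom : {ae mu, forall t n, `[0, @tau R]%classic t -> (`|F_ n t| <= K%:E)%E}.
  exists set0; split; [exact: measurable0|exact: measure0|].
  rewrite -[X in _ `<=` X](setCT); apply: subsetC => t _ n _; rewrite /F_ /= lee_fin ger0_norm ?sqr_ge0 //.
  have /andP[r0 r1] := @rad01 R n.
  rewrite ler_pXn2r ?nnegrE ?cabs_ge0 ?mulr_ge0 ?sumr_ge0 //; last first.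
    by move=> i _; exact: cabs_ge0.
  rewrite circM ?(ltW r0) // cabsM; apply: ler_pM; rewrite ?cabs_ge0 //.
    exact: cabs_ext0_le.
  by apply: cabs_polc_le; rewrite cabs_polar ltW.
have [_ _ lim] := @dominated_convergence _ _ _ mu `[0, @tau R]%classic
  (measurable_itv _) F_ F (fun=> K%:E)
  (fun n => measurable_int _ (inn n)) (measurable_int _ in1) Flim inK Fdom.
have fin n : (\int[mu]_(t in `[0%R, @tau R]) F_ n t)%E =
    (rint 0 tau (fun t => cabs (circ (ext0 f0) (rad n) t) ^+ 2))%:E.
  by rewrite /rint /Rintegral fineK //; exact: (integrable_fin_num _ (inn n)).
have fin1 : (\int[mu]_(t in `[0%R, @tau R]) F t)%E =
    (rint 0 tau (fun t => cabs (circ (polc N a) 1 t) ^+ 2))%:E.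
  by rewrite /rint /Rintegral fineK //; exact: (integrable_fin_num _ in1).
rewrite fin1 in lim.
have lim2 : (fun n => rint 0 tau (fun t => cabs (circ (ext0 f0) (rad n) t) ^+ 2))
    @ \oo --> rint 0 tau (fun t => cabs (circ (polc N a) 1 t) ^+ 2).
  by move: lim; rewrite (funext fin) => /fine_cvgP[_].
rewrite /msq; apply: cvgM; [exact: cvg_cst|exact: lim2].
Qed.

(** The left side is the mean square of the polynomial on the unit circle, hence the limit of the
    circle means of the product, and each of these is at most the squared norm of the product. *)
Lemma mul_pol_lower N a :
  psum a N <= sqnorm (wcomp theta id (Fn (trunc N a))).
Proof.
have [hH _] := mul_pol_bound N a; move: hH; rewrite wcomp_trunc => hH.
have hh := holomorphic_mul_cdif theta_hol (@cdif_polc _ N a).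
have h := @msq_radial_lim N a.
rewrite -msq_polc1 -(cvg_lim (@norm_hausdorff _ R) h); apply: limr_le.
  by apply/cvg_ex; eexists; exact: h.
by apply: nearW => n; apply: msq_circ_le => //; exact: rad01.
Qed.

Lemma mul_lower f : H2 R f -> sqnorm f <= sqnorm (fun z => theta z * f z).
Proof. exact: (wcomp_lower (sqr_ge0 M) mul_pol_bound mul_pol_lower). Qed.

End Inner.

(** * Closed images and orthogonal complements *)

Section ClosedSubspaces.
Context {R : realType}.
Implicit Types (a b c : nat -> C R) (e : R) (f g : disk R -> C R) (k : C R).
Implicit Types (M : set (disk R -> C R)).

Lemma inv_small e : 0 < e -> exists K, forall m, (K <= m)%N ->
  m.+1%:R^-1 <= e.
Proof.
move=> e0; exists (Num.bound e^-1) => m Km.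
have m0 : (0 : R) < m.+1%:R by [].
rewrite -[leRHS]invrK lef_pV2 ?posrE ?invr_gt0 //.
apply: ltW; apply: (lt_le_trans (archi_boundP _)); first by rewrite invr_ge0 ltW.
by rewrite ler_nat leqW.
Qed.

Lemma nf_sub_Fn a b : l2 a -> l2 b ->
  sqnorm (fun z => Fn a z - Fn b z) = nrm2 (fun n => a n - b n).
Proof.
move=> la lb; rewrite /sqnorm (coef_sub (H2_Fn la) (H2_Fn lb)).
by rewrite (coef_Fn la) (coef_Fn lb).
Qed.

Lemma H2_closed_H2 : H2_closed_subspace (H2 R).
Proof.
split; [by move=> f|exact: H2_0| |by move=> f hf _].
by move=> k f g hf hg; exact: H2_lin.
Qed.

Section Image.
Variables (w : disk R -> C R) (psi : disk R -> disk R) (B L : R).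
Hypotheses (B0 : 0 <= B) (L0 : 0 <= L).
Let T := wcomp w psi.
Hypothesis TB : forall f, H2 R f -> H2 R (T f) /\ sqnorm (T f) <= B * sqnorm f.
Hypothesis TL : forall f, H2 R f -> sqnorm f <= L * sqnorm (T f).

(** The lower bound [TL] turns a convergent sequence of images into a Cauchy sequence of preimages,
    and the upper bound [TB] identifies the image of their limit. *)
Lemma image_closed M : H2_closed_subspace M -> H2_closed_subspace (T @` M).
Proof.
move=> /H2_closed_subspaceP[MH [_ [_ M0] Ml Mc]].
have lin k f g : T (fun z => k * f z + g z) = (fun z => k * T f z + T g z).
  exact: wcomp_lin.
have TH f : M f -> H2 R (T f) by move=> /MH/TB[].
have T0 : T (fun=> 0) = fun=> 0.
  by apply/funext => z; rewrite /T /wcomp mulr0.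
apply/H2_closed_subspaceP; split; first by move=> _ [f Mf <-]; exact: TH.
have Mlin k f g : M f -> M g -> M (fun z => k * f z + g z).
  move=> Mf Mg; have /H2P[a la fa] := MH _ Mf; have /H2P[b lb gb] := MH _ Mg.
  rewrite {}fa in Mf *; rewrite {}gb in Mg *.
  by have [] := Ml k a b (conj la Mf) (conj lb Mg); rewrite (Fn_lin k la lb).
split.
- by move=> a [].
- split; first exact: l2_0.
  by exists (fun=> 0); [rewrite -Fn0; exact: M0|rewrite T0 Fn0].
- move=> k a b [la [f Mf fa]] [lb [g Mg gb]].
  have [lab _] := l2D (l2Z k la) lb; split => //.
  exists (fun z => k * f z + g z); first exact: Mlin.
  by rewrite lin fa gb (Fn_lin k la lb).
move=> a la ac; split => //.
have [c cP] : {c : nat -> nat -> C R & forall m, [/\ l2 (c m), M (Fn (c m)) &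
    nrm2 (fun n => a n - coef (T (Fn (c m))) n) <= m.+1%:R^-1]}.
  apply: (@boolp.choice _ _ (fun m c => [/\ l2 c, M (Fn c) &
    nrm2 (fun n => a n - coef (T (Fn c)) n) <= m.+1%:R^-1])) => m.
  have m0 : 0 < (m.+1%:R^-1 : R) by rewrite invr_gt0.
  have [b [lb [f Mf fb]] ab] := ac _ m0.
  have hf := MH _ Mf; exists (coef f).
  by rewrite (FnK hf) fb (coef_Fn lb); split => //; exact: l2_coef.
have lc m : l2 (c m) by case: (cP m).
have Mc' m : M (Fn (c m)) by case: (cP m).
have lt m : l2 (coef (T (Fn (c m)))) by apply: l2_coef; exact: TH.
have cauchy m n : nrm2 (fun i => c m i - c n i) <=
    L * (2 * m.+1%:R^-1 + 2 * n.+1%:R^-1).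
  rewrite -(nf_sub_Fn (lc m) (lc n)).
  apply: (le_trans (TL (H2_sub (H2_Fn (lc m)) (H2_Fn (lc n))))).
  rewrite ler_wpM2l // /T wcomp_sub -/T /sqnorm.
  rewrite (coef_sub (TH _ (Mc' m)) (TH _ (Mc' n))).
  have -> : (fun i => coef (T (Fn (c m))) i - coef (T (Fn (c n))) i) =
     (fun i => (a i - coef (T (Fn (c n))) i) - (a i - coef (T (Fn (c m))) i)).
    apply/funext => i; have aux (x y z : C R) : y - z = (x - z) - (x - y) by ring.
    exact: aux.
  apply: (le_trans (nrm2B (l2B la (lt n)) (l2B la (lt m)))).
  by rewrite addrC; apply: lerD; rewrite ler_pM2l //; [case: (cP m)|case: (cP n)].
have [|y ly yP] := l2_complete lc.
  move=> e e0; have L1 : 0 < 4 * (1 + L) by rewrite mulr_gt0 // ltr_pwDl.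
  have [K KP] := inv_small (divr_gt0 e0 L1).
  exists K => m n Km Kn; apply: (le_trans (cauchy m n)).
  have := KP _ Km; have := KP _ Kn; rewrite !ler_pdivlMr //.
  have : 0 <= (m.+1%:R^-1 : R) by []; have : 0 <= (n.+1%:R^-1 : R) by [].
  move: (m.+1%:R^-1) (n.+1%:R^-1) => p q q0 p0 h1 h2; nra.
have [_ My] : l2 y /\ M (Fn y).
  apply: Mc => // e e0; have [K KP] := yP e e0; exists (c K); first by split.
  exact: KP.
have lTy := l2_coef (TH _ My).
suff aE : a = coef (T (Fn y)).
  by exists (Fn y) => //; rewrite aE (FnK (TH _ My)).
apply: (nrm2_sub0 la lTy); apply/ler_addgt0Pr => e e0; rewrite add0r.
(* [nrm2B] doubles both errors: one is at most [e / 4], the other at most [B * (e / (4 * (1 + B)))],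
   so the total stays within [e]. *)
have B1 : 0 < 4 * (1 + B) by rewrite mulr_gt0 // ltr_pwDl.
have [K1 K1P] := inv_small (divr_gt0 e0 (ltr0Sn R 3)).
have [K2 K2P] := yP _ (divr_gt0 e0 B1).
pose m := maxn K1 K2.
have h1 := K1P m (leq_maxl _ _); have h2 := K2P m (leq_maxr _ _).
have -> : (fun i => a i - coef (T (Fn y)) i) =
    (fun i => (a i - coef (T (Fn (c m))) i) - (coef (T (Fn y)) i - coef (T (Fn (c m))) i)).
  apply/funext => i; have aux (p q r : C R) : p - q = (p - r) - (q - r) by ring.
  exact: aux.
apply: (le_trans (nrm2B (l2B la (lt m)) (l2B lTy (lt m)))).
have [_ _ h3] := cP m.
have h4 : nrm2 (fun i => coef (T (Fn y)) i - coef (T (Fn (c m))) i) <=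
    B * nrm2 (fun i => y i - c m i).
  rewrite -(coef_sub (TH _ My) (TH _ (Mc' m))).
  have := (TB (H2_sub (H2_Fn ly) (H2_Fn (lc m)))).2.
  by rewrite (nf_sub_Fn ly (lc m)) /T wcomp_sub.
have h5 := le_trans h3 h1.
have n0 := nrm2_ge0 (l2B ly (lc m)).
rewrite ler_pdivlMr // in h2; rewrite ler_pdivlMr // in h5.
move: h2 h4 h5 n0.
do 3!move: (nrm2 _) => ?.
nra.
Qed.

End Image.

Lemma perp_closed M : M `<=` H2 R -> H2_closed_subspace (H2perp M).
Proof.
move=> MH; apply/H2_closed_subspaceP; split; first by move=> f [].
have E a : l2 a -> (forall g, M g -> H2dot (Fn a) g = 0) <->
    (forall g, M g -> dot a (coef g) = 0).
  by move=> la; split=> h g /h; rewrite H2dotE (coef_Fn la).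
split.
- by move=> a [].
- split; first exact: l2_0.
  split; first exact: H2_Fn l2_0.
  by apply/(E _ l2_0) => g _; rewrite dot0l.
- move=> k a b [la [_ /(E _ la) pa]] [lb [_ /(E _ lb) pb]].
  have [lab _] := l2D (l2Z k la) lb; split => //; split; first exact: H2_Fn.
  apply/(E _ lab) => g Mg; rewrite (dotDl k la lb (l2_coef (MH _ Mg))).
  by rewrite pa // pb // mulr0 addr0.
move=> a la ac; split => //; split; first exact: H2_Fn.
apply/(E _ la) => g Mg; have lg := l2_coef (MH _ Mg).
apply: cabs0_eq0; apply: le_anti; rewrite cabs_ge0 andbT.
apply/ler_addgt0Pr => e e0; rewrite add0r.
set N := nrm2 (coef g).
have N0 : 0 <= N by exact: nrm2_ge0.
have N1 : 0 < 1 + N by rewrite ltr_pwDl.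
pose t := 2 * (1 + N) / e.
have t0 : 0 < t by rewrite divr_gt0 // mulr_gt0.
have et : 0 < e / (2 * t) by rewrite divr_gt0 // mulr_gt0.
have [b [lb [_ /(E _ lb) pb]] ab] := ac _ et.
have -> : dot a (coef g) = dot (fun n => a n - b n) (coef g).
  have -> : (fun n => a n - b n) = (fun n => -1 * b n + a n).
    by apply/funext => n; rewrite mulN1r addrC.
  by rewrite (dotDl _ lb la lg) pb // mulr0 add0r.
apply: (le_trans (dot_le t0 (l2B la lb) lg)).
rewrite [leRHS]splitr; apply: lerD.
  have := ler_wpM2l (ltW t0) ab; rewrite (_ : t * (e / (2 * t)) = e / 2) //.
  by field; rewrite gt_eqF.
rewrite /t invf_div -/N mulrAC ler_pdivrMr ?mulr_gt0 //.
rewrite [e / 2 * _]mulrA divfK // ler_pM2l //.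
by rewrite lerDr.
Qed.

(** If [y] is the projection of [x] on [M], then [x - y] lies in the complement. It is orthogonal to
    [x] by assumption and to [y], hence to itself. *)
Lemma perp_perp M x : H2_closed_subspace M -> H2 R x ->
  (forall f, H2perp M f -> H2dot f x = 0) -> M x.
Proof.
move=> Mcl hx xp; have [MH Ml2] := (H2_closed_subspaceP M).1 Mcl.
have lx := l2_coef hx.
have [y [ly My] yP] := l2_projection Ml2 lx.
have lxy := l2B lx ly.
have pf : H2perp M (Fn (fun n => coef x n - y n)).
  split; first exact: H2_Fn.
  move=> g Mg; rewrite H2dotE (coef_Fn lxy); apply: yP.
  by split; [exact: l2_coef (MH _ Mg)|rewrite (FnK (MH _ Mg))].
have := xp _ pf; rewrite H2dotE (coef_Fn lxy) => d1.
have d2 : dot (fun n => coef x n - y n) y = 0 by apply: yP; split.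
have : dot (fun n => coef x n - y n) (fun n => coef x n - y n) = 0.
  have -> : dot (fun n => coef x n - y n) (fun n => coef x n - y n) =
     dot (fun n => coef x n - y n) (fun n => -1 * y n + coef x n).
    by congr dot; apply/funext => n; rewrite mulN1r addrC.
  by rewrite (dotDr _ ly lx lxy) d1 d2 mulr0 addr0.
rewrite (dot_nrm2 lxy) => /(congr1 (fun z : C R => complex.Re z)) /= n0.
have xy : coef x = y by apply: (nrm2_sub0 lx ly); rewrite n0.
by rewrite -(FnK hx) xy.
Qed.

End ClosedSubspaces.

(** * The shift and multiplication by [1 - k z] *)

Section Shift.
Context {R : realType}.
Implicit Types (a b c u v : nat -> C R) (f g : disk R -> C R) (k : C R).
Implicit Types (z : disk R).

Definition cons0 b n : C R := if n is m.+1 then b m else 0.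

Lemma psum_cons0 b n : psum (cons0 b) n.+1 = psum b n.
Proof.
rewrite /psum big_ord_recl /= cabs0 expr0n add0r.
by apply: eq_bigr => i _.
Qed.

Lemma psum_cons0_le b n : psum (cons0 b) n <= psum b n.
Proof.
case: n => [|n]; first by rewrite /psum !big_ord0.
by rewrite psum_cons0; apply: psum_nd.
Qed.

Lemma l2_cons0 b : l2 b -> l2 (cons0 b).
Proof. by move=> [M bM]; exists M => n; apply: le_trans (psum_cons0_le b n) _. Qed.

Lemma l2_sh b : l2 b -> l2 (fun n => b n.+1).
Proof.
move=> [M bM]; exists M => n; apply: le_trans (bM n.+1).
rewrite /psum [leRHS]big_ord_recl lerDr sqr_ge0 //.
Qed.

Lemma dot_cons0 a b : l2 a -> l2 b -> dot (cons0 a) (cons0 b) = dot a b.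
Proof.
move=> la lb; apply: dot_unique; rewrite -cvg_shiftS.
refine (cvg_eq (dot_cvg la lb) _) => n.
by rewrite /series /= big_nat_recl // mul0r add0r.
Qed.

Lemma nrm2_cons0 a : l2 a -> nrm2 (cons0 a) = nrm2 a.
Proof.
move=> la; have := dot_cons0 la la; rewrite !dot_nrm2 //; last exact: l2_cons0.
by move=> /cofr_inj.
Qed.

Lemma Fn_cons0 a z : l2 a -> Fn (cons0 a) z = zcoord z * Fn a z.
Proof.
move=> la; have h := @Fn_taylor _ _ (l2_cons0 la) z.
rewrite -(cvg_lim chausdorff h); apply: (cvg_lim chausdorff).
rewrite -cvg_shiftS.
refine (cvg_eq (ccvgM (ccvg_cst (zcoord z)) (@Fn_taylor _ _ la z)) _) => n.
rewrite /series /= big_nat_recl // mul0r add0r mulr_sumr.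
by apply: eq_bigr => i _; rewrite exprS mulrCA.
Qed.

Lemma Fn_head a z : l2 a -> Fn a z = a 0%N + zcoord z * Fn (fun n => a n.+1) z.
Proof.
move=> la; have h := @Fn_taylor _ _ la z.
rewrite -(cvg_lim chausdorff h); apply: (cvg_lim chausdorff).
rewrite -cvg_shiftS.
refine (cvg_eq (ccvgD (ccvg_cst (a 0%N)) (ccvgM (ccvg_cst (zcoord z))
  (@Fn_taylor _ _ (l2_sh la) z))) _) => n.
rewrite /series /= big_nat_recl // expr0 mulr1 mulr_sumr.
by congr (_ + _); apply: eq_bigr => i _; rewrite exprS mulrCA.
Qed.

Definition mulz f z : C R := zcoord z * f z.

Lemma mulz_H2 f : H2 R f -> H2 R (mulz f) /\ coef (mulz f) = cons0 (coef f).
Proof.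
move=> /H2P[a la ->]; have -> : mulz (Fn a) = Fn (cons0 a).
  by apply/funext => z; rewrite /mulz Fn_cons0.
by rewrite !coef_Fn //; [split => //; apply: H2_Fn|]; exact: l2_cons0.
Qed.

Lemma mulz_inj f g : H2 R f -> H2 R g -> mulz f = mulz g -> f = g.
Proof.
move=> hf hg /(congr1 coef); rewrite (mulz_H2 hf).2 (mulz_H2 hg).2 => e.
rewrite -(FnK hf) -(FnK hg); congr Fn; apply/funext => n.
by have := congr1 (fun u => u n.+1) e.
Qed.

Definition mul1c k f z : C R := (1 - k * zcoord z) * f z.

Lemma mul1cE (k : C R) f : mul1c k f = (fun z => - k * mulz f z + f z).
Proof. by apply/funext => z; rewrite /mul1c /mulz; ring. Qed.

Lemma mul1c_H2 (k : C R) f : H2 R f -> H2 R (mul1c k f) /\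
  coef (mul1c k f) = (fun n => - k * cons0 (coef f) n + coef f n).
Proof.
move=> hf; have [h1 h2] := mulz_H2 hf; rewrite mul1cE; split.
  exact: H2_lin.
by rewrite (coef_lin _ h1 hf) h2.
Qed.

Lemma sqnorm_mul1c (k : C R) f : H2 R f ->
  sqnorm (mul1c k f) <= (2 * cabs k ^+ 2 + 2) * sqnorm f.
Proof.
move=> hf; have [_ e] := mul1c_H2 k hf; rewrite /sqnorm e.
have lf := l2_coef hf; have lb := l2_cons0 lf.
have [_] := l2D (l2Z (- k) lb) lf.
rewrite (nrm2Z (- k) lb) cabsN (nrm2_cons0 lf).
by move=> h; apply: (le_trans h); rewrite [leRHS]mulrDl -!mulrA lexx.
Qed.

(** The coefficients of [f / (1 - k z)] when [b] are those of [f], obtained by comparing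
    coefficients. *)
Fixpoint div1 (k : C R) b n : C R :=
  if n is m.+1 then b m.+1 + k * div1 k b m else b 0%N.

Lemma div1E (k : C R) b : (fun n => k * cons0 (div1 k b) n + b n) = div1 k b.
Proof.
by apply/funext => -[|n] /=; rewrite ?mulr0 ?add0r // addrC.
Qed.

(** Convexity of the square with weights [q] and [1 - q] bounds each squared coefficient by [q]
    times the preceding one plus [cabs (b i) ^+ 2 / (1 - q)]. After summation the first term is
    absorbed by the left side, as [q < 1]. *)
Lemma l2_div1 (k : C R) b : cabs k < 1 -> l2 b -> l2 (div1 k b).
Proof.
move=> k1 [M bM]; set q := cabs k in k1.
have q0 : 0 <= q by exact: cabs_ge0.
have q1 : 0 < 1 - q by rewrite subr_gt0.
exists (M / (1 - q) / (1 - q)) => n.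
have step i : cabs (div1 k b i) ^+ 2 <=
    cabs (b i) ^+ 2 / (1 - q) + q * cabs (cons0 (div1 k b) i) ^+ 2.
  rewrite -{1}(div1E k b).
  set x := cons0 _ i; set y := b i.
  have h : cabs (k * x + y) <= q * cabs x + cabs y.
    by apply: (le_trans (cabsD _ _)); rewrite cabsM.
  have x0 := cabs_ge0 x; have y0 := cabs_ge0 y.
  have h2 : cabs (k * x + y) ^+ 2 <= (q * cabs x + cabs y) ^+ 2.
    by rewrite ler_pXn2r ?nnegrE ?cabs_ge0 // addr_ge0 // mulr_ge0.
  apply: (le_trans h2).
  move: (cabs x) (cabs y) x0 y0 {h h2} => X Y X0 Y0.
  rewrite -subr_ge0.
  have -> : Y ^+ 2 / (1 - q) + q * X ^+ 2 - (q * X + Y) ^+ 2 =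
     q * ((1 - q) * X - Y) ^+ 2 / (1 - q).
    by field; rewrite gt_eqF.
  by rewrite divr_ge0 ?(ltW q1) // mulr_ge0 // sqr_ge0.
have H : psum (div1 k b) n <= psum b n / (1 - q) + q * psum (div1 k b) n.
  apply: (@le_trans _ _ (psum b n / (1 - q) + q * psum (cons0 (div1 k b)) n)).
    rewrite /psum mulr_suml mulr_sumr -big_split /=; apply: ler_sum => i _.
    exact: step.
  by rewrite lerD2l ler_wpM2l //; exact: psum_cons0_le.
rewrite ler_pdivlMr //; apply: (@le_trans _ _ (psum b n / (1 - q))).
  by move: H; lra.
by rewrite ler_pM2r ?invr_gt0.
Qed.

Definition div1c k f z : C R := (1 - k * zcoord z)^-1 * f z.

Lemma one_sub_neq0 (k w : C R) : cabs k <= 1 -> cabs w < 1 -> 1 - k * w != 0.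
Proof.
move=> k1 w1; rewrite subr_eq0; apply/negP => /eqP /(congr1 cabs).
rewrite cabs1 cabsM => e.
have : cabs k * cabs w <= cabs w by rewrite ler_piMl ?cabs_ge0.
by rewrite -e leNgt w1.
Qed.

Lemma div1c_H2 (k : C R) f : cabs k < 1 -> H2 R f -> H2 R (div1c k f).
Proof.
move=> k1 /H2P[b lb ->]; have ld := l2_div1 k1 lb.
rewrite (_ : div1c k (Fn b) = Fn (div1 k b)); first exact: H2_Fn.
apply/funext => z; rewrite /div1c.
have n0 := one_sub_neq0 (ltW k1) (disk_lt1 z).
apply: (mulfI n0); rewrite mulrA divff // mul1r.
have := Fn_lin k (l2_cons0 ld) lb; rewrite div1E => /(congr1 (fun f => f z)) /=.
rewrite Fn_cons0 // => e.
by rewrite mulrBl mul1r {1}e -mulrA addrC addKr.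
Qed.

End Shift.

(** * Disk automorphisms *)

Section Mobius.
Context {R : realType}.
Implicit Types (b c u v : nat -> C R) (f g h : disk R -> C R) (k : C R).
Implicit Types (z : disk R).
Variable a : C R.
Hypothesis a1 : cabs a < 1.

Let ac := cconj a.

Lemma cabs_ac : cabs ac < 1.
Proof. by rewrite cabs_conj. Qed.

Definition s2 : R := 1 - cabs a ^+ 2.

Lemma s2_gt0 : 0 < s2.
Proof. by rewrite subr_gt0 exprn_ilt1 // cabs_ge0. Qed.

(** The involutive automorphism that exchanges 0 and [a]. *)
Definition mobc (w : C R) : C R := (a - w) / (1 - ac * w).

Lemma den_neq0 (w : C R) : cabs w < 1 -> 1 - ac * w != 0.
Proof. by apply: one_sub_neq0; exact: ltW cabs_ac. Qed.

Lemma ac_mul : ac * a = cofr (cabs a ^+ 2).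
Proof. by rewrite mulrC mul_cconj. Qed.

Lemma s2C_neq0 : cofr s2 != 0 :> C R.
Proof. by rewrite -cabs_gt0 cabs_cofr normr_gt0 gt_eqF // s2_gt0. Qed.

Lemma s2C : cofr s2 = 1 - ac * a.
Proof. by rewrite /s2 cofrB ac_mul. Qed.

Lemma mobc_lt1 (w : C R) : cabs w < 1 -> cabs (mobc w) < 1.
Proof.
move=> w1; rewrite /mobc cabsM cabsV ltr_pdivrMr ?cabs_gt0 ?den_neq0 // mul1r.
rewrite -(@ltr_pXn2r _ 2) ?nnegrE ?cabs_ge0 // -subr_gt0.
have -> : cabs (1 - ac * w) ^+ 2 - cabs (a - w) ^+ 2 =
    (1 - cabs a ^+ 2) * (1 - cabs w ^+ 2).
  apply: cofr_inj; rewrite cofrB (cofrM (1 - _) (1 - _)) !cofrB -!mul_cconj.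
  by rewrite !cconjB !cconjM /ac cconjK cconj1 /cofr rmorph1; ring.
by rewrite mulr_gt0 // subr_gt0 exprn_ilt1 // cabs_ge0.
Qed.

Definition mob z : disk R := mkdisk (mobc_lt1 (disk_lt1 z)).

Lemma zcoord_mob z : zcoord (mob z) = mobc (zcoord z).
Proof. by []. Qed.

Lemma den_mob (w : C R) : cabs w < 1 ->
  1 - ac * mobc w = cofr s2 / (1 - ac * w).
Proof.
move=> w1; have d0 := den_neq0 w1; apply: (mulIf d0).
by rewrite divfK // mulrBl mul1r /mobc mulrA divfK // s2C; ring.
Qed.

Lemma mobK : involutive mob.
Proof.
move=> z; apply: zcoord_inj; rewrite !zcoord_mob.
have w1 := disk_lt1 z; move: (zcoord z) w1 => w w1.
have d0 := den_neq0 w1; have s0 := s2C_neq0.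
rewrite {1}/mobc den_mob // invf_div mulrA.
apply: (mulIf s0); rewrite divfK //.
by rewrite mulrBl /mobc divfK // s2C; ring.
Qed.

Lemma mob0 (z : disk R) : zcoord z = a -> zcoord (mob z) = 0.
Proof. by rewrite zcoord_mob /mobc => ->; rewrite subrr mul0r. Qed.

Definition sq : R := Num.sqrt s2.

Lemma sq2 : sq ^+ 2 = s2.
Proof. by rewrite sqr_sqrtr // ltW // s2_gt0. Qed.

Lemma sq_gt0 : 0 < sq.
Proof. by rewrite sqrtr_gt0 s2_gt0. Qed.

Lemma sqC_neq0 : cofr sq != 0 :> C R.
Proof. by rewrite -cabs_gt0 cabs_cofr normr_gt0 gt_eqF // sq_gt0. Qed.

(* The normalized reproducing kernel at [a]. *)
Definition nker z : C R := cofr sq * (1 - ac * zcoord z)^-1.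

Lemma l2_kera : l2 (ker a).
Proof. exact: l2_ker a1. Qed.

Lemma dot_ker b (w : C R) (w1 : cabs w < 1) : l2 b ->
  dot b (ker w) = Fn b (mkdisk w1).
Proof. by rewrite FnE. Qed.

Definition nker_coef n : C R := cofr sq * ker a n.

Lemma l2_nker : l2 nker_coef.
Proof. exact: l2Z l2_kera. Qed.

Lemma Fn_nker : Fn nker_coef = nker.
Proof.
apply/funext => z; rewrite /nker.
have n0 := den_neq0 (disk_lt1 z).
have -> : Fn nker_coef z = cofr sq * Fn (ker a) z.
  have := Fn_lin (cofr sq) l2_kera l2_0 => /(congr1 (fun f => f z)) /=.
  rewrite Fn0 addr0 => <-; congr (Fn _ z); apply/funext => n.
  by rewrite addr0.
congr (_ * _); apply: (mulfI n0); rewrite divff // mulrBl mul1r.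
rewrite {1}(Fn_head z l2_kera) {1}/ker expr0.
have -> : (fun n => ker a n.+1) = (fun n => ac * ker a n).
  by apply/funext => n; rewrite /ker exprS.
have -> : Fn (fun n => ac * ker a n) z = ac * Fn (ker a) z.
  have := Fn_lin ac l2_kera l2_0 => /(congr1 (fun f => f z)) /=.
  rewrite Fn0 addr0 => <-; congr (Fn _ z); apply/funext => n.
  by rewrite addr0.
by ring.
Qed.

Definition mulmob g z : C R := mobc (zcoord z) * g z.

(** Here [u] is the coefficient sequence of [g / (1 - ac z)]. Then [g] is [(1 - ac z)] times this
    function and [mulmob g] is [(a - z)] times it, so both are combinations of [u] and its shift. *)
Lemma mulmob_H2 g : H2 R g -> H2 R (mulmob g) /\
  exists u, [/\ l2 u, coef g = (fun n => - ac * cons0 u n + u n) &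
    coef (mulmob g) = (fun n => a * u n - cons0 u n)].
Proof.
move=> hg; have hd := div1c_H2 cabs_ac hg.
set d := div1c ac g in hd; have [hz cz] := mulz_H2 hd.
have gE : g = mul1c ac d.
  apply/funext => z; rewrite /d /mul1c /div1c mulrA divff ?mul1r //.
  exact: den_neq0 (disk_lt1 z).
have mE : mulmob g = (fun z => a * d z - mulz d z).
  apply/funext => z; rewrite /mulmob /d /div1c /mulz /mobc.
  by rewrite -mulrA; move: (_ ^-1 * g z) => x; ring.
have hm : H2 R (fun z => a * d z - mulz d z).
  rewrite (_ : (fun _ => _) = fun z => -1 * mulz d z + (a * d z + 0)).
    exact: (H2_lin (-1) hz (H2_lin a hd H2_0)).
  by apply/funext => z; rewrite mulN1r addr0 addrC.
have ld := l2_coef hd.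
rewrite mE; split => //; exists (coef d); split => //.
  by rewrite {1}gE (mul1c_H2 ac hd).2.
have -> : (fun z => a * d z - mulz d z) = Fn (fun n => a * coef d n + -1 * cons0 (coef d) n).
  rewrite (Fn_lin a ld (l2Z (-1) (l2_cons0 ld))); apply/funext => z.
  congr (_ + _); first by rewrite (FnK hd).
  have := Fn_lin (-1) (l2_cons0 ld) l2_0 => /(congr1 (fun f => f z)) /=.
  rewrite Fn0 addr0 -cz (FnK hz) mulN1r => <-; congr (Fn _ z).
  by apply/funext => n; rewrite addr0.
have [l1 _] := l2D (l2Z a ld) (l2Z (-1) (l2_cons0 ld)).
by rewrite (coef_Fn l1); apply/funext => n; rewrite mulN1r.
Qed.

(** An algebraic proof, without boundary values, that multiplication by [mobc] is isometric: in
    terms of [u] and [v] the cross terms agree, and the remaining two are exchanged because the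
    shift preserves the inner product. *)
Lemma mulmob_dot g h : H2 R g -> H2 R h ->
  dot (coef (mulmob g)) (coef (mulmob h)) = dot (coef g) (coef h).
Proof.
move=> hg hh.
have [_ [u [lu -> ->]]] := mulmob_H2 hg.
have [_ [v [lv -> ->]]] := mulmob_H2 hh.
have lbu := l2_cons0 lu; have lbv := l2_cons0 lv.
have sub (x : nat -> C R) :
    (fun n => a * x n - cons0 x n) = (fun n => -1 * cons0 x n + a * x n).
  by apply/funext => n; rewrite mulN1r addrC.
have [lS _] := l2D (l2Z (-1) lbv) (l2Z a lv).
have [lT _] := l2D (l2Z (- ac) lbv) lv.
rewrite !sub (dotDl (-1) lbu (l2Z a lu) lS) (dotZl a lu lS).
rewrite (dotDr (-1) lbv (l2Z a lv) lbu) (dotDr (-1) lbv (l2Z a lv) lu).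
rewrite (dotZr a lbu lv) (dotZr a lu lv).
rewrite (dotDl (- ac) lbu lu lT).
rewrite (dotDr (- ac) lbv lv lbu) (dotDr (- ac) lbv lv lu).
rewrite !(dot_cons0 lu lv) !cconjN /ac cconjK cconj1.
by move: (dot _ _) (dot _ _) (dot _ _) (cconj a) => x y w a'; ring.
Qed.

Definition unitary_mob f : disk R -> C R := wcomp nker mob f.

(** The images of the monomials under [unitary_mob], written as iterates so that [mulmob_dot]
    applies inductively. *)
Definition mob_basis n : disk R -> C R := iter n mulmob nker.

Lemma mob_basisE n z : mob_basis n z = mobc (zcoord z) ^+ n * nker z.
Proof.
elim: n => [|n IH] /=; first by rewrite expr0 mul1r.
by rewrite /mulmob IH exprS mulrA.
Qed.

Lemma mob_basis_H2 n : H2 R (mob_basis n).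
Proof.
elim: n => [|n IH] /=; first by rewrite -Fn_nker; apply: H2_Fn; exact: l2_nker.
by have [] := mulmob_H2 IH.
Qed.

Lemma dot_nker f : H2 R f -> dot (coef f) (coef nker) = cofr sq * f (mkdisk a1).
Proof.
move=> hf; rewrite -Fn_nker (coef_Fn l2_nker).
have := dotDr (cofr sq) l2_kera l2_0 (l2_coef hf).
rewrite (dotC l2_0 (l2_coef hf)) dot0l cconj0 addr0.
have -> : (fun n => cofr sq * ker a n + 0) = nker_coef.
  by apply/funext => n; rewrite addr0.
move=> ->; rewrite (dot_ker a1 (l2_coef hf)) (FnK hf); congr (_ * _).
by rewrite /cofr /cconj /= oppr0.
Qed.

(** Cancelling the common power of [mobc] leaves an inner product with [nker], that is an evaluation
    at [a], where [mobc] vanishes. *)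
Lemma dot_mob_basis m n : (m <= n)%N -> dot (coef (mob_basis n)) (coef (mob_basis m)) = (n == m)%:R.
Proof.
elim: m n => [|m IH] [|n] //= mn.
- rewrite (dot_nker (mob_basis_H2 0)) /= /nker /= zcoord_mkdisk -s2C mulrA -cofrM.
  by rewrite -expr2 sq2 divff ?s2C_neq0.
- rewrite (dot_nker (mob_basis_H2 n.+1)) /= /mulmob zcoord_mkdisk /mobc subrr.
  by rewrite mul0r mul0r mulr0.
by rewrite (mulmob_dot (mob_basis_H2 n) (mob_basis_H2 m)) IH.
Qed.

Lemma unitary_mob_trunc N b : unitary_mob (Fn (trunc N b)) = (fun z => \sum_(n < N) b n * mob_basis n z).
Proof.
apply/funext => z; rewrite /unitary_mob /wcomp Fn_trunc mulr_sumr.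
by apply: eq_bigr => i _; rewrite mob_basisE zcoord_mob mulrCA [nker z * _]mulrC.
Qed.

Lemma mob_basis_comb N b : let g := (fun z => \sum_(n < N) b n * mob_basis n z) in
  [/\ H2 R g, sqnorm g = psum b N &
    forall m, (N <= m)%N -> dot (coef g) (coef (mob_basis m)) = 0].
Proof.
elim: N => [|N IH] /=.
  have -> : (fun z => \sum_(n < 0) b n * mob_basis n z) = fun=> 0.
    by apply/funext => z; rewrite big_ord0.
  have c0 : coef (fun=> 0 : C R) = fun=> 0.
    by rewrite -Fn0 coef_Fn //; exact: l2_0.
  split; first exact: H2_0.
    by rewrite /sqnorm c0 /psum big_ord0 nrm2_0.
  by move=> m _; rewrite c0 dot0l.
have [hg ng og] := IH; set g := (fun z => _) in hg ng og.
have -> : (fun z => \sum_(n < N.+1) b n * mob_basis n z) = (fun z => b N * mob_basis N z + g z).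
  by apply/funext => z; rewrite big_ord_recr addrC.
have hN := mob_basis_H2 N; have lN := l2_coef hN; have lg := l2_coef hg.
have cE := coef_lin (b N) hN hg.
split; first exact: H2_lin.
  rewrite /sqnorm cE (nrm2_add _ lN lg) (dotC lg lN) og // cconj0 mulr0 /= mulr0 addr0.
  have nN : nrm2 (coef (mob_basis N)) = 1.
    have := dot_nrm2 lN; rewrite (dot_mob_basis (leqnn N)) eqxx.
    by move=> /(congr1 (fun z : C R => complex.Re z)).
  by rewrite nN mulr1 -/(sqnorm g) ng /psum big_ord_recr /= addrC.
move=> m Nm; have hm := mob_basis_H2 m.
rewrite cE (dotDl _ lN lg (l2_coef hm)) og ?(ltnW Nm) // addr0.
rewrite (dotC (l2_coef hm) lN) (dot_mob_basis (ltnW Nm)) gtn_eqF // cconj0.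
by rewrite mulr0.
Qed.

Lemma unitary_mob_pol N b : H2 R (unitary_mob (Fn (trunc N b))) /\ sqnorm (unitary_mob (Fn (trunc N b))) = psum b N.
Proof. by rewrite unitary_mob_trunc; have [] := mob_basis_comb N b. Qed.

Lemma unitary_mob_H2 f : H2 R f -> H2 R (unitary_mob f) /\ sqnorm (unitary_mob f) = sqnorm f.
Proof.
have pB N b : H2 R (wcomp nker mob (Fn (trunc N b))) /\
    sqnorm (wcomp nker mob (Fn (trunc N b))) <= 1 * psum b N.
  by have [h1 h2] := unitary_mob_pol N b; split => //; rewrite mul1r -h2.
have pL N b : psum b N <= sqnorm (wcomp nker mob (Fn (trunc N b))).
  by have [_ <-] := unitary_mob_pol N b.
move=> hf; have [h1 h2] := wcomp_bound ler01 pB hf.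
split=> //; apply: le_anti; rewrite mul1r in h2; rewrite h2 /=.
exact: (wcomp_lower ler01 pB pL hf).
Qed.

Lemma unitary_mob_invol f : unitary_mob (unitary_mob f) = f.
Proof.
apply/funext => z; rewrite /unitary_mob /wcomp mobK /nker zcoord_mob.
have w1 := disk_lt1 z; have d0 := den_neq0 w1.
rewrite den_mob // invf_div mulrA.
have -> : cofr sq / (1 - ac * zcoord z) * (cofr sq * ((1 - ac * zcoord z) / cofr s2)) = 1.
  have s0 := sqC_neq0.
  rewrite -sq2 expr2 cofrM; field.
  by rewrite d0 s0.
by rewrite mul1r.
Qed.

(* Both sides are sesquilinear and agree on the diagonal: polarize. *)
Lemma unitary_mob_dot f g : H2 R f -> H2 R g ->
  dot (coef (unitary_mob f)) (coef (unitary_mob g)) = dot (coef f) (coef g).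
Proof.
move=> hf hg; have [hWf nWf] := unitary_mob_H2 hf; have [hWg nWg] := unitary_mob_H2 hg.
have P k : complex.Re (k * dot (coef (unitary_mob f)) (coef (unitary_mob g))) =
           complex.Re (k * dot (coef f) (coef g)).
  have [_] := unitary_mob_H2 (H2_lin k hf hg); rewrite /unitary_mob wcomp_lin -/(unitary_mob f) -/(unitary_mob g).
  rewrite /sqnorm (coef_lin k hWf hWg) (coef_lin k hf hg).
  rewrite (nrm2_add k (l2_coef hWf) (l2_coef hWg)).
  rewrite (nrm2_add k (l2_coef hf) (l2_coef hg)) -/(sqnorm _) -/(sqnorm _) -/(sqnorm _) -/(sqnorm _).
  by rewrite nWf nWg => h; lra.
apply: eq_ReIm; first by have := P 1; rewrite !mul1r.
have := P (cpt 0 1); rewrite !ReM /= !mul0r !mul1r !sub0r.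
by move=> /oppr_inj.
Qed.

Lemma sqVC : cofr sq^-1 = (cofr sq)^-1 :> C R.
Proof.
apply: (mulfI sqC_neq0); rewrite divff ?sqC_neq0 // -cofrM divff //.
by rewrite gt_eqF // sq_gt0.
Qed.

(** Removing the weight of the unitary operator costs a polynomial factor of degree at most one,
    whose adjoint the shift describes. *)
Lemma comp_mobE f : (fun z => f (mob z)) =
  (fun z => cofr sq^-1 * mul1c ac (unitary_mob f) z).
Proof.
apply/funext => z; rewrite /mul1c /unitary_mob /wcomp /nker sqVC.
have d0 := den_neq0 (disk_lt1 z); have s0 := sqC_neq0.
by field; rewrite d0 s0.
Qed.

Lemma comp_mob_bound : exists2 B, 0 <= B & forall f, H2 R f ->
  H2 R (fun z => f (mob z)) /\ sqnorm (fun z => f (mob z)) <= B * sqnorm f.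
Proof.
exists (cabs (cofr sq^-1 : C R) ^+ 2 * (2 * cabs ac ^+ 2 + 2)).
  by rewrite mulr_ge0 ?sqr_ge0 // addr_ge0 // mulr_ge0 // sqr_ge0.
move=> f hf; have [hW nW] := unitary_mob_H2 hf; have [hm _] := mul1c_H2 ac hW.
rewrite comp_mobE; have [hz cz] := H2Z (cofr sq^-1) hm; split => //.
rewrite /sqnorm cz (nrm2Z _ (l2_coef hm)).
rewrite -(mulrA (cabs (cofr sq^-1 : C R) ^+ 2)); apply: ler_wpM2l; first exact: sqr_ge0.
by have := sqnorm_mul1c ac hW; rewrite nW.
Qed.

(** The adjoint of multiplication by [1 - ac z] sends [z h] to [G = (z - a) h]. Applying
    [unitary_mob] to [G], the factor [mobc z - a] equals [- s2 * z / (1 - ac z)]: the factor [z]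
    reappears because [mob] exchanges [a] and 0. *)
Lemma comp_mob_adjoint f h : H2 R f -> H2 R h ->
  H2dot (fun z => f (mob z)) (mulz h) =
  H2dot f (fun z => - cofr s2 * zcoord z * (1 - ac * zcoord z)^-2 * h (mob z)).
Proof.
move=> hf hh; have [hW _] := unitary_mob_H2 hf; have [hm cm] := mul1c_H2 ac hW.
have [hz cz] := mulz_H2 hh; have hG := H2_lin (- a) hh hz.
have cG := coef_lin (- a) hh hz.
set G := (fun z => _) in hG cG.
have [hWG _] := unitary_mob_H2 hG.
have KE : (fun z => - cofr s2 * zcoord z * (1 - ac * zcoord z)^-2 * h (mob z)) =
    (fun z => cofr sq^-1 * unitary_mob G z).
  apply/funext => z; rewrite /unitary_mob /wcomp /G /mulz /nker zcoord_mob /mobc s2C sqVC.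
  have d0 := den_neq0 (disk_lt1 z); have s0 := sqC_neq0.
  by field; rewrite d0 s0.
have [hZ cZ] := H2Z (cofr sq^-1) hm; have [hK cK] := H2Z (cofr sq^-1) hWG.
rewrite KE comp_mobE !H2dotE cZ cK cm.
have lu := l2_coef hW; have lv := l2_coef hh; have lbu := l2_cons0 lu.
have lbv := l2_cons0 lv.
rewrite (dotZr _ (l2_coef hf) (l2_coef hWG)).
have [lm _] := l2D (l2Z (- ac) lbu) lu.
have lmz := l2_coef hz.
rewrite (dotZl _ lm lmz).
have -> : cconj (cofr sq^-1) = cofr sq^-1 :> C R by rewrite /cofr /cconj /= oppr0.
congr (_ * _).
rewrite -(unitary_mob_dot hf hWG) unitary_mob_invol cG cz.
rewrite (dotDl _ lbu lu lbv) (dotDr _ lv lbv lu) (dot_cons0 lu lv).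
by rewrite cconjN.
Qed.

End Mobius.

(** * The form of an automorphism and the adjoint of its composition operator *)

Section Automorphisms.
Context {R : realType}.
Implicit Types (b c u v : nat -> C R) (f g h : disk R -> C R) (k : C R).
Implicit Types (z : disk R) (psi : disk R -> disk R).

Lemma disk_map_H2 psi : holomorphic (fun z => zcoord (psi z)) ->
  H2 R (fun z => zcoord (psi z)) /\ sqnorm (fun z => zcoord (psi z)) <= 1.
Proof.
move=> hp; apply: hol_H2 => // r /andP[r0 r1].
have -> : (1 : R) = msq (fun=> (1 : C R)) by rewrite msq_cst cabs1 expr1n.
apply: le_msq => [||t].
- by apply: gcont_circF; [exact/holomorphicP|rewrite (ltW r0)].
- exact: gcont_cst.
rewrite cabs1; apply: cabs_ext0_le => z; exact: ltW (disk_lt1 (psi z)).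
Qed.

Lemma zcoord_disk0 : zcoord (disk0 R) = 0.
Proof. by []. Qed.

Lemma Fn_disk0 b : l2 b -> Fn b (disk0 R) = b 0%N.
Proof. by move=> lb; rewrite Fn_head // zcoord_disk0 mul0r addr0. Qed.

Lemma Fn_cvg0 b (zs : nat -> disk R) : l2 b ->
  (fun n => zcoord (zs n)) @ \oo --> (0 : C R) ->
  (fun n => Fn b (zs n)) @ \oo --> b 0%N.
Proof.
move=> lb zs0; have ls := l2_sh lb.
(* The summand 2 bounds the squared norm of the kernel at points of modulus at most 1/2. *)
pose N := nrm2 (fun n => b n.+1) + 2.
have N0 : 0 < N by rewrite ltr_wpDl // nrm2_ge0.
apply/ccvgP/cvgrPdist_le => e e0.
have /ccvgP/cvgrPdist_le z0 := zs0.
have h0 : (0 : R) < 2^-1 by rewrite invr_gt0.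
have [K1 _ K1P] := z0 _ h0; have [K2 _ K2P] := z0 _ (divr_gt0 e0 N0).
exists (maxn K1 K2) => // n /=; rewrite geq_max => /andP[n1 n2].
have {K1P n1} := K1P n n1; have {K2P n2} := K2P n n2.
rewrite /= !sub0r !normrN !ger0_norm ?cabs_ge0 // subr0 => h2 h1.
rewrite Fn_head // [b 0%N + _]addrC addrK cabsM.
have kb : cabs (Fn (fun n => b n.+1) (zs n)) <= N.
  rewrite FnE; apply: (le_trans (dot_le ltr01 ls (l2_ker (disk_lt1 _)))).
  rewrite invr1 !mul1r lerD2l.
  apply: (le_trans (ker_nrm2_le (erefl _) (disk_lt1 _))).
  rewrite -[leRHS]invrK lef_pV2 ?posrE ?invr_gt0 //.
    rewrite lerBrDr; apply: (@le_trans _ _ (2^-1 + 2^-1 ^+ 2)).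
      by rewrite lerD2l lerXn2r ?nnegrE ?cabs_ge0 // ltW.
    by rewrite expr2; lra.
  by rewrite subr_gt0 exprn_ilt1 ?cabs_ge0 // disk_lt1.
apply: (@le_trans _ _ (e / N * N)); first by apply: ler_pM => //; exact: cabs_ge0.
by rewrite divfK // gt_eqF.
Qed.

Lemma small_point (n : nat) : cabs (cofr n.+2%:R^-1 : C R) < 1.
Proof. by rewrite cabs_cofr ger0_norm ?invr_ge0 // invf_lt1 // ltr1n. Qed.

(* If [psi] has inverse [chi] and both fix 0, their derivatives at 0 have
   product 1 and modulus at most 1, as the Taylor coefficients of a self-map of
   the disk are square-summable with sum at most 1; so [psi] is a rotation. *)
Lemma rotation_of_fix0 psi chi : holomorphic (fun z => zcoord (psi z)) ->
  holomorphic (fun z => zcoord (chi z)) -> cancel chi psi ->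
  zcoord (psi (disk0 R)) = 0 -> zcoord (chi (disk0 R)) = 0 ->
  exists2 k : C R, cabs k = 1 & forall z, zcoord (psi z) = k * zcoord z.
Proof.
move=> hp hc chiK p0 c0.
have [hf nf1] := disk_map_H2 hp; have [hg ng1] := disk_map_H2 hc.
set f := fun z => zcoord (psi z) in hf nf1; set g := fun z => zcoord (chi z) in hg ng1.
pose b := coef f; pose c := coef g.
have lb : l2 b := l2_coef hf; have lc : l2 c := l2_coef hg.
have b0 : b 0%N = 0 by rewrite -Fn_disk0 // /b FnK.
have c00 : c 0%N = 0 by rewrite -Fn_disk0 // /c FnK.
have fE z : f z = zcoord z * Fn (fun n => b n.+1) z.
  by rewrite -{1}(FnK hf) Fn_head // -/b b0 add0r.
have gE z : g z = zcoord z * Fn (fun n => c n.+1) z.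
  by rewrite -{1}(FnK hg) Fn_head // -/c c00 add0r.
pose zs n := mkdisk (small_point n).
have zs0 : (fun n => zcoord (zs n)) @ \oo --> (0 : C R).
  have h : (fun n => n.+2%:R^-1 : R) @ \oo --> (0 : R).
    by have := @cvg_harmonic R; rewrite -cvg_shiftS.
  exact: (ccvg_cofr h).
have zsn n : zcoord (zs n) != 0.
  by rewrite -cabs_gt0 cabs_cofr normr_gt0 invr_eq0 pnatr_eq0.
have h1 := Fn_cvg0 (l2_sh lc) zs0.
have cz0 : (fun n => zcoord (chi (zs n))) @ \oo --> (0 : C R).
  rewrite -[X in _ --> X](mul0r (c 1%N)).
  refine (cvg_eq (ccvgM zs0 h1) _) => n.
  by rewrite -gE.
have h2 := Fn_cvg0 (l2_sh lb) cz0.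
(* By [gE] at [zs n] and [fE] at its image under [chi], the identity [psi (chi (zs n)) = zs n]
   factors through [zcoord (zs n)]; this nonzero factor is cancelled before the limit. *)
have prod1 : c 1%N * b 1%N = 1.
  have h3 : (fun _ : nat => 1 : C R) @ \oo --> c 1%N * b 1%N.
    refine (cvg_eq (ccvgM h1 h2) _) => n.
    apply: (mulfI (zsn n)); rewrite mulr1 mulrA -gE.
    have := fE (chi (zs n)); rewrite /f chiK => ->; by [].
  have h4 : (fun _ : nat => 1 : C R) @ \oo --> (1 : C R) by exact: ccvg_cst.
  by rewrite -(cvg_lim chausdorff h3) (cvg_lim chausdorff h4).
have pb n : psum b n <= 1 by apply: le_trans nf1; exact: psum_le_nrm2.
have pc n : psum c n <= 1 by apply: le_trans ng1; exact: psum_le_nrm2.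
have p2 (d : nat -> C R) : d 0%N = 0 -> psum d 2 = cabs (d 1%N) ^+ 2.
  by move=> d0; rewrite /psum !big_ord_recr big_ord0 /= d0 cabs0 expr0n add0r add0r.
have bb : cabs (b 1%N) <= 1.
  by rewrite -(@ler_pXn2r _ 2) ?nnegrE ?cabs_ge0 // expr1n -p2.
have cc : cabs (c 1%N) <= 1.
  by rewrite -(@ler_pXn2r _ 2) ?nnegrE ?cabs_ge0 // expr1n -p2.
have b1 : cabs (b 1%N) = 1.
  apply: le_anti; rewrite bb /=.
  have := congr1 cabs prod1; rewrite cabsM cabs1 => <-.
  by rewrite ler_piMl ?cabs_ge0.
exists (b 1%N) => // z.
(* The coefficient [b 1] alone exhausts the bound 1 on the squared norm, so all later ones
   vanish. *)
have bT : b = trunc 2 b.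
  apply/funext => n; rewrite /trunc; case: ltnP => // n2.
  apply: cabs0_eq0; apply/eqP; rewrite -sqrf_eq0; apply/eqP/le_anti.
  rewrite sqr_ge0 andbT; have := pb n.+1; rewrite /psum big_ord_recr /= -/(psum b n).
  have := psum_nd b n2; rewrite p2 // b1 expr1n; lra.
have : Fn b z = f z by rewrite /b (FnK hf).
rewrite bT Fn_trunc -[zcoord (psi z)]/(f z) => <-.
by rewrite !big_ord_recr big_ord0 /= b0 mul0r add0r add0r expr1.
Qed.

Lemma cdif_mobc (a w : C R) : cabs a < 1 -> cabs w < 1 -> cdif (mobc a) w.
Proof.
move=> a1 w1.
have d1 := cdifD (cdif_cst a w) (cdifM (cdif_cst (-1) w) (cdif_id w)).
have d2 := cdifD (cdif_cst 1 w) (cdifM (cdif_cst (- cconj a) w) (cdif_id w)).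
have n0 : 1 + - cconj a * w != 0 by rewrite mulNr; exact: den_neq0.
have := cdifM d1 (@cdifV _ (fun v : C R => 1 + - cconj a * v) _ n0 d2).
apply: cdif_near; apply: near_call => v.
by rewrite /mobc mulN1r mulNr.
Qed.

Lemma aut_form (phi : disk_aut R) : exists (a k : C R) (a1 : cabs a < 1),
  cabs k = 1 /\ forall z, zcoord (phi z) = k * zcoord (mob a1 z).
Proof.
pose a := zcoord (aut_inv phi (disk0 R)).
have a1 : cabs a < 1 by exact: disk_lt1.
pose psi z := phi (mob a1 z); pose chi z := mob a1 (aut_inv phi z).
have [|||||k k1 kP] := @rotation_of_fix0 psi chi.
- have hphi := (holomorphicP _).1 (@aut_fun_hol _ phi).
  apply/holomorphicP => w w1.
  have := cdif_comp (cdif_mobc a1 w1) (hphi _ (mobc_lt1 a1 w1)).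
  apply: cdif_near; apply: (near_disk w1) => v v1.
  rewrite -[in RHS](zcoord_mkdisk v1) ext0E /psi -(ext0E (fun z => zcoord (phi z))).
  by rewrite zcoord_mob zcoord_mkdisk.
- have hphi := (holomorphicP _).1 (@aut_inv_hol _ phi).
  apply/holomorphicP => w w1.
  have b1 : cabs (ext0 (fun z => zcoord (aut_inv phi z)) w) < 1.
    by rewrite -(zcoord_mkdisk w1) ext0E; exact: disk_lt1.
  have := cdif_comp (hphi _ w1) (cdif_mobc a1 b1).
  apply: cdif_near; apply: (near_disk w1) => v v1.
  by rewrite -(zcoord_mkdisk v1) !ext0E /chi zcoord_mob.
- by move=> z; rewrite /psi /chi mobK aut_invK.
- have e : mob a1 (disk0 R) = aut_inv phi (disk0 R).
    apply: zcoord_inj; rewrite zcoord_mob zcoord_disk0 /mobc.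
    by rewrite mulr0 !subr0 invr1 mulr1.
  by rewrite /psi e aut_invK.
- by rewrite /chi; exact: mob0.
exists a, k, a1; split => // z.
by rewrite -kP /psi mobK.
Qed.

Lemma rot_proof (k : C R) z : cabs k = 1 -> cabs (k * zcoord z) < 1.
Proof. by move=> k1; rewrite cabsM k1 mul1r disk_lt1. Qed.

Definition rot (k : C R) (k1 : cabs k = 1) z : disk R := mkdisk (rot_proof z k1).

Definition rotc (k : C R) b n : C R := k ^+ n * b n.

Lemma psum_rotc (k : C R) b n : cabs k = 1 -> psum (rotc k b) n = psum b n.
Proof.
by move=> k1; apply: eq_bigr => i _; rewrite cabsM cabsX k1 expr1n mul1r.
Qed.

Lemma l2_rotc (k : C R) b : cabs k = 1 -> l2 b -> l2 (rotc k b).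
Proof. by move=> k1 [M bM]; exists M => n; rewrite psum_rotc. Qed.

Lemma nrm2_rotc (k : C R) b : cabs k = 1 -> nrm2 (rotc k b) = nrm2 b.
Proof.
move=> k1; rewrite !nrm2E; congr (limn (series _)); apply/funext => n.
by rewrite cabsM cabsX k1 expr1n mul1r.
Qed.

Lemma Fn_rot (k : C R) (k1 : cabs k = 1) b z : l2 b ->
  Fn b (rot k1 z) = Fn (rotc k b) z.
Proof.
move=> lb; have h1 := @Fn_taylor _ _ lb (rot k1 z).
have h2 := @Fn_taylor _ _ (l2_rotc k1 lb) z.
rewrite -(cvg_lim chausdorff h2); symmetry; apply: (cvg_lim chausdorff).
refine (cvg_eq h1 _) => n; rewrite /series /=; apply: eq_bigr => i _.
by rewrite zcoord_mkdisk exprMn /rotc mulrA [b i * _]mulrC.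
Qed.

Lemma rot_H2 (k : C R) (k1 : cabs k = 1) f : H2 R f ->
  H2 R (fun z => f (rot k1 z)) /\ coef (fun z => f (rot k1 z)) = rotc k (coef f).
Proof.
move=> hf; have lf := l2_coef hf; have lr := l2_rotc k1 lf.
have -> : (fun z => f (rot k1 z)) = Fn (rotc k (coef f)).
  by apply/funext => z; rewrite -(Fn_rot k1) // FnK.
by split; [exact: H2_Fn|rewrite coef_Fn].
Qed.

Lemma dot_rotc (k : C R) b c : dot (rotc k b) c = dot b (rotc (cconj k) c).
Proof.
rewrite !dotE; congr (limn (series _)); apply/funext => n.
by rewrite /rotc cconjM cconjX cconjK mulrCA mulrA.
Qed.

Lemma cabs_conj1 (k : C R) : cabs k = 1 -> cabs (cconj k) = 1.
Proof. by rewrite cabs_conj. Qed.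

Lemma H2dot_rot (k : C R) (k1 : cabs k = 1) f g : H2 R f -> H2 R g ->
  H2dot (fun z => f (rot k1 z)) g = H2dot f (fun z => g (rot (cabs_conj1 k1) z)).
Proof.
move=> hf hg; rewrite !H2dotE (rot_H2 k1 hf).2 (rot_H2 (cabs_conj1 k1) hg).2.
exact: dot_rotc.
Qed.

Lemma aut_inv_form (phi : disk_aut R) (a k : C R) (a1 : cabs a < 1) (k1 : cabs k = 1) :
  (forall z, zcoord (phi z) = k * zcoord (mob a1 z)) ->
  forall z, aut_inv phi z = mob a1 (rot (cabs_conj1 k1) z).
Proof.
move=> phiE z; set y := mob a1 _; rewrite -(aut_funK phi y); congr aut_inv.
apply: zcoord_inj; rewrite phiE /y mobK zcoord_mkdisk mulrA mul_cconj k1 expr1n.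
by rewrite mul1r.
Qed.

Lemma aut_bound (phi : disk_aut R) : exists2 B, 0 <= B & forall f, H2 R f ->
  H2 R (fun z => f (phi z)) /\ sqnorm (fun z => f (phi z)) <= B * sqnorm f.
Proof.
have [a [k [a1 [k1 phiE]]]] := aut_form phi.
have [B B0 BP] := comp_mob_bound a1; exists B; first exact: B0.
move=> f hf.
have [hr cr] := rot_H2 k1 hf.
have -> : (fun z => f (phi z)) = (fun z => f (rot k1 (mob a1 z))).
  by apply/funext => z; congr f; apply: zcoord_inj; rewrite phiE.
have [h1 h2] := BP _ hr; split; first exact: h1.
apply: (le_trans h2).
by rewrite /sqnorm cr nrm2_rotc.
Qed.

(* The key identity behind (1) <=> (2): up to an invertible weight, the adjoint
   of [C_phi] acts on [z H2] as composition with [phi^-1]. *)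
Lemma aut_adjoint (phi : disk_aut R) : exists k c : C R, [/\ k != 0, cabs c < 1 &
  forall f h, H2 R f -> H2 R h ->
  H2dot (fun z => f (phi z)) (mulz h) =
  H2dot f (mulz (fun z => k * div1c c (div1c c (fun z => h (aut_inv phi z))) z))].
Proof.
have [a [k [a1 [k1 phiE]]]] := aut_form phi.
have [B B0 BP] := comp_mob_bound a1.
have kc1 := cabs_conj1 k1.
(* Both constants come from substituting the rotated variable [cconj k * z] in
   [comp_mob_adjoint]. *)
exists (- cofr (s2 a) * cconj k), (cconj a * cconj k); split.
- rewrite mulf_neq0 // ?oppr_eq0 ?s2C_neq0 // -cabs_gt0 kc1 //.
- by rewrite cabsM kc1 mulr1 cabs_conj.
move=> f h hf hh; have [hr _] := rot_H2 k1 hf.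
have [hm _] := BP _ hh.
have -> : (fun z => f (phi z)) = (fun z => f (rot k1 (mob a1 z))).
  by apply/funext => z; congr f; apply: zcoord_inj; rewrite phiE.
rewrite (comp_mob_adjoint a1 hr hh).
set K := (fun z => - cofr (s2 a) * _ * _ * _).
have KE : K = (fun z => - cofr (s2 a) * mulz (div1c (cconj a) (div1c (cconj a) (fun z => h (mob a1 z)))) z).
  apply/funext => z; rewrite /K /mulz /div1c expr2 invfM.
  by move: (_^-1) (h _) => x y; ring.
have hK : H2 R K.
  rewrite KE; apply: (H2Z _ _).1.
  have ac1 := cabs_ac a1.
  exact: (mulz_H2 (div1c_H2 ac1 (div1c_H2 ac1 hm))).1.
rewrite (H2dot_rot k1 hf hK); congr H2dot; apply/funext => z.
rewrite /K /mulz /div1c -(aut_inv_form k1 phiE) zcoord_mkdisk expr2 invfM mulrA.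
by move: (_^-1) (h _) => x y; ring.
Qed.

End Automorphisms.

(** * Invariant subspaces *)

Section InvariantSubspaces.
Context {R : realType}.
Implicit Types (f g h : disk R -> C R) (theta : disk R -> C R).
Implicit Types (phi : disk_aut R) (T : disk R -> disk R) (M : set (disk R -> C R)).

Definition inv_aut phi : disk_aut R :=
  DiskAut (@aut_invK _ phi) (@aut_funK _ phi) (@aut_inv_hol _ phi) (@aut_fun_hol _ phi).

Lemma aut_H2 phi f : H2 R f -> H2 R (f \o phi).
Proof. by move=> hf; have [B _ BP] := aut_bound phi; exact: (BP _ hf).1. Qed.

(** The lower bound for [C_phi] is the upper bound for composition with the inverse automorphism. *)
Lemma aut_image_closed phi M : H2_closed_subspace M ->
  H2_closed_subspace (composition_op phi @` M).
Proof.
move=> hM; have [B B0 BP] := aut_bound phi.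
have [L L0 LP] := aut_bound (inv_aut phi).
have e f : wcomp (fun=> 1) phi f = f \o phi.
  by apply/funext => z; rewrite /wcomp mul1r.
have -> : composition_op phi @` M = wcomp (fun=> 1) phi @` M.
  by congr (_ @` _); apply/funext => f; rewrite e.
have TB f : H2 R f -> H2 R (wcomp (fun=> 1) phi f) /\
    sqnorm (wcomp (fun=> 1) phi f) <= B * sqnorm f by rewrite e; exact: BP.
have TL f : H2 R f -> sqnorm f <= L * sqnorm (wcomp (fun=> 1) phi f).
  move=> hf; rewrite e; have [_] := LP _ (aut_H2 phi hf).
  by have -> : (fun z => (f \o phi) (inv_aut phi z)) = f
    by apply/funext => z /=; rewrite aut_invK.
exact: (image_closed B0 L0 TB TL hM).
Qed.

Lemma inner_image_closed theta : inner_function theta ->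
  H2_closed_subspace (mulH2 theta).
Proof.
move=> [th [N thN] tl].
have N0 : exists2 K : R, 0 <= K & forall z, cabs (theta z) <= K.
  exists (complex.Re N) => [|z].
    have := le_trans (normr_ge0 _) (thN (disk0 R)).
    by rewrite lecE => /andP[].
  by have := thN z; rewrite cabsE lecE => /andP[].
have [K K0 KP] := N0.
have TB f : H2 R f -> H2 R (wcomp theta id f) /\
  sqnorm (wcomp theta id f) <= K ^+ 2 * sqnorm f := @mul_bound _ _ _ th KP f.
have TL f : H2 R f -> sqnorm f <= 1 * sqnorm (wcomp theta id f).
  by move=> hf; rewrite mul1r; exact: (@mul_lower _ _ _ th KP tl f hf).
exact: (image_closed (sqr_ge0 K) ler01 TB TL H2_closed_H2).
Qed.

Lemma shift_image_closed M : H2_closed_subspace M ->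
  H2_closed_subspace (@mulz R @` M).
Proof.
move=> hM.
have n1 f : H2 R f -> sqnorm (mulz f) = sqnorm f.
  by move=> hf; rewrite /sqnorm (mulz_H2 hf).2 (nrm2_cons0 (l2_coef hf)).
have TB f : H2 R f -> H2 R (wcomp (@zcoord R) id f) /\
    sqnorm (wcomp (@zcoord R) id f) <= 1 * sqnorm f.
  by move=> hf; split; [exact: (mulz_H2 hf).1|rewrite mul1r -(n1 _ hf)].
have TL f : H2 R f -> sqnorm f <= 1 * sqnorm (wcomp (@zcoord R) id f).
  by move=> hf; rewrite mul1r -(n1 _ hf).
exact: (image_closed ler01 ler01 TB TL hM).
Qed.

Lemma mulH2_shift theta : mulH2 (@zcoord R \* theta) = @mulz R @` mulH2 theta.
Proof.
apply/seteqP; split => [_ [f hf <-]|_ [_ [f hf <-] <-]].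
  exists (theta \* f); first by exists f.
  by apply/funext => z; rewrite /mulz /= mulrA.
by exists f; [exact: hf|apply/funext => z; rewrite /mulz /= mulrA].
Qed.

(** Composition with [phi] is multiplicative and maps [H2] onto itself, [f] being the image of
    [f \o aut_inv phi]. *)
Lemma mulH2_comp phi theta :
  mulH2 (theta \o phi) = composition_op phi @` mulH2 theta.
Proof.
apply/seteqP; split => [_ [f hf <-]|_ [_ [f hf <-] <-]].
  exists (theta \* (f \o aut_inv phi)).
    by exists (f \o aut_inv phi); [exact: (aut_H2 (inv_aut phi) hf)|].
  by apply/funext => z; rewrite /composition_op /= aut_funK.
by exists (f \o phi); [exact: aut_H2|].
Qed.

Lemma Lat_mulH2_comp phi T theta : phi \o T = T \o phi ->
  Lat (composition_op T) (mulH2 theta) ->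
  Lat (composition_op T) (mulH2 (theta \o phi)).
Proof.
move=> phiT [hM TM]; rewrite mulH2_comp; split; first exact: aut_image_closed.
move=> _ [_ [f Mf <-] <-]; exists (f \o T); first by apply: TM; exists f.
apply/funext => z; rewrite /composition_op /=; congr f.
exact: esym (congr1 (fun F => F z) phiT).
Qed.

(** Both [phi] and its inverse commute with [T], so [Lat_mulH2_comp] can add a factor [phi] to the
    symbol or remove one. *)
Lemma Lat_mulH2_iter phi T theta (n : nat) : phi \o T = T \o phi ->
  Lat (composition_op T) (mulH2 (theta \o iter n phi)) <->
  Lat (composition_op T) (mulH2 theta).
Proof.
move=> phiT.
have phiT' : inv_aut phi \o T = T \o inv_aut phi.
  apply/funext => z /=; apply: (can_inj (@aut_funK _ phi)).
  have := congr1 (fun F => F (aut_inv phi z)) phiT => /= ->.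
  by rewrite !aut_invK.
elim: n => [|n IH]; first by have -> : theta \o iter 0 phi = theta.
rewrite -IH; have e : theta \o iter n.+1 phi = (theta \o iter n phi) \o phi.
  by apply/funext => z /=; rewrite -iterSr.
split; last by rewrite e; exact: Lat_mulH2_comp.
move=> /(Lat_mulH2_comp phiT').
have -> // : (theta \o iter n.+1 phi) \o inv_aut phi = theta \o iter n phi.
by rewrite e; apply/funext => z /=; rewrite aut_invK.
Qed.

Lemma Lat_mulH2_aut_iter phi T theta (n : int) : phi \o T = T \o phi ->
  Lat (composition_op T) (mulH2 (theta \o aut_iter phi n)) <->
  Lat (composition_op T) (mulH2 theta).
Proof.
move=> phiT; case: n => n; first exact: Lat_mulH2_iter.
apply: (@Lat_mulH2_iter (inv_aut phi)).
apply/funext => z /=; apply: (can_inj (@aut_funK _ phi)).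
have := congr1 (fun F => F (aut_inv phi z)) phiT => /= ->.
by rewrite !aut_invK.
Qed.

Lemma Lat_perp_shift phi theta : H2_closed_subspace (mulH2 theta) ->
  Lat (composition_op phi) (H2perp (mulH2 (@zcoord R \* theta))) <->
  Lat (composition_op (aut_inv phi)) (mulH2 theta).
Proof.
move=> hM; have hN := shift_image_closed hM; rewrite -mulH2_shift in hN.
have [k [c [k0 c1 adj]]] := aut_adjoint phi.
have MH : mulH2 theta `<=` H2 R by case: hM.
have NH : mulH2 (@zcoord R \* theta) `<=` H2 R by case: hN.
pose G h z := k * div1c c (div1c c (fun z => h (aut_inv phi z))) z.
have GH h : H2 R h -> H2 R (G h).
  move=> hh; have hi := aut_H2 (inv_aut phi) hh.
  exact: (H2Z k (div1c_H2 c1 (div1c_H2 c1 hi))).1.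
split=> [[_ Tperp]|[_ TM]]; split.
- exact: hM.
- move=> _ [h Mh <-]; have hh := MH _ Mh.
  (* By [adj], pairing [f] with [mulz (G h)] is pairing [C_phi f] with [mulz h]; this vanishes for
     [f] in the invariant complement. *)
  have : mulH2 (@zcoord R \* theta) (mulz (G h)).
    apply: (perp_perp hN); first exact: (mulz_H2 (GH _ hh)).1.
    move=> f pf; have [hf _] := pf.
    rewrite -(adj f h hf hh).
    have [_ pTf] : H2perp (mulH2 (@zcoord R \* theta)) (composition_op phi f).
      by apply: Tperp; exists f.
    by apply: pTf; rewrite mulH2_shift; exists h.
  rewrite mulH2_shift => -[_ [g hg <-] e].
  have hthg : H2 R (theta \* g) by apply: MH; exists g.
  have {}e := mulz_inj hthg (GH _ hh) e.
  (* Since [e] reads [theta \* g = G h], undoing the weight of [G] on the factor [g] gives the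
     cofactor of [h \o aut_inv phi]. *)
  exists (fun z => k^-1 * mul1c c (mul1c c g) z).
    exact: (H2Z k^-1 (mul1c_H2 c (mul1c_H2 c hg).1).1).1.
  apply/funext => z; rewrite /composition_op /mul1c /=.
  have n0 := one_sub_neq0 (ltW c1) (disk_lt1 z).
  have := congr1 (fun F => F z) e; rewrite /G /div1c /= => ez.
  have -> : theta z * (k^-1 * ((1 - c * zcoord z) * ((1 - c * zcoord z) * g z))) =
    k^-1 * ((1 - c * zcoord z) * ((1 - c * zcoord z) * (theta z * g z))).
    by move: (1 - _) (k^-1) => x y; ring.
  rewrite ez; move: (1 - _) n0 => x n0.
  by rewrite !(mulrCA x k) (mulKf k0) !(mulVKf n0).
- exact: (perp_closed NH).
- move=> _ [f [hf pf] <-]; split; first exact: aut_H2.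
  rewrite mulH2_shift => _ [h Mh <-].
  rewrite (adj f h hf (MH _ Mh)); apply: pf; rewrite mulH2_shift.
  exists (G h); last by [].
  have [|g hg gE] := TM (h \o aut_inv phi); first by exists h.
  (* Invariance supplies [h \o aut_inv phi = theta \* g]; the weight of [G] commutes with [theta]
     and is moved onto [g]. *)
  exists (fun z => k * div1c c (div1c c g) z).
    exact: (H2Z k (div1c_H2 c1 (div1c_H2 c1 hg))).1.
  apply/funext => z; rewrite /G /div1c -[h (aut_inv phi z)]/((h \o aut_inv phi) z).
  by rewrite -gE /=; move: (_^-1) => x; ring.
Qed.

End InvariantSubspaces.

Theorem theorem4p2 (R : realType) (phi : disk_aut R)
    (phi0 : zcoord (phi (disk0 R)) != 0)
    (theta : disk R -> C R) (theta_inner : inner_function theta) :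
  [<-> Lat (composition_op phi) (H2perp (mulH2 (@zcoord R \* theta)));
       Lat (composition_op (aut_inv phi)) (mulH2 theta);
       exists n : int,
         Lat (composition_op (aut_inv phi)) (mulH2 (theta \o aut_iter phi n));
       forall n : int,
         Lat (composition_op (aut_inv phi)) (mulH2 (theta \o aut_iter phi n));
       exists n : int,
         Lat (composition_op phi)
           (H2perp (mulH2 (@zcoord R \* (theta \o aut_iter phi n))));
       forall n : int,
         Lat (composition_op phi)
           (H2perp (mulH2 (@zcoord R \* (theta \o aut_iter phi n))))].
Proof.
have hM := inner_image_closed theta_inner.
have iterA n : Lat (composition_op (aut_inv phi)) (mulH2 (theta \o aut_iter phi n)) <->
    Lat (composition_op (aut_inv phi)) (mulH2 theta).
  apply: Lat_mulH2_aut_iter.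
  by apply/funext => z /=; rewrite aut_funK aut_invK.
(* [Lat] of [C_id] consists of all closed subspaces. *)
have closed_iter n : H2_closed_subspace (mulH2 (theta \o aut_iter phi n)).
  have [] // := (@Lat_mulH2_aut_iter _ phi id theta n erefl).2.
  by split => // _ [f Mf <-].
have perpA := Lat_perp_shift phi hM.
have perpAn n := Lat_perp_shift phi (closed_iter n).
tfae.
- by move/perpA.
- by move=> A0; exists 0; apply/iterA.
- by move=> [n /iterA A0] m; apply/iterA.
- by move=> An; exists 0; apply/perpAn.
- by move=> [n /perpAn/iterA A0] m; apply/perpAn/iterA.
- by move=> /(_ 0)/perpAn/iterA/perpA.
Qed.
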